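(* (Diversity order of the direct link from outage probability.) Let $h$ be the fading coefficient of a single direct link with turbulence/pointing-error parameters $\psi,\phi,P,\zeta_l,C_l,a_{l,w},b_{l,w},m,n,p,q$ of one of the models $\mathcal{GG},\mathcal M,\mathcal F$ and fog parameters $v>0$, $k$ a positive integer, as described in the context. Let $t\in\{1,2\}$, $\gamma_0>0$, $\gamma_{\rm th}>0$, let $\gamma=\gamma_0h^t$ be the SNR and $P^{\rm DL}_{\rm out}=\Pr(\gamma\le\gamma_{\rm th})$. Then the diversity order $G^{\rm DL}_{\rm out}=-\lim_{\gamma_0\to\infty}\frac{\ln P^{\rm DL}_{\rm out}}{\ln\gamma_0}$ (all other parameters fixed) equals $$G^{\rm DL}_{\rm out}=\min\left\{\frac{\phi+b_{l,i}}t,\ \frac vt\ :\ 1\le l\le P,\ 1\le i\le m\right\}.$$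
   Context: Meijer's G-function: $G_{p,q}^{m,n}\left(x\middle|\begin{array}{c}a_1,\dots,a_p\\ b_1,\dots,b_q\end{array}\right)=\frac{1}{2\pi\jmath}\int_{\mathcal L}\frac{\prod_{j=1}^m\Gamma(b_j-s)\prod_{j=1}^n\Gamma(1-a_j+s)}{\prod_{j=n+1}^p\Gamma(a_j-s)\prod_{j=m+1}^q\Gamma(1-b_j+s)}x^s\,ds$, where $\jmath$ is the imaginary unit and $\mathcal L$ runs from $-\jmath\infty$ to $+\jmath\infty$, with the poles of $\Gamma(b_j-s)$ ($j\le m$) on its right and those of $\Gamma(1-a_j+s)$ ($j\le n$) on its left. Fading coefficient of a link: $h=h^{(tp)}h^{(f)}$ with $h^{(tp)}$, $h^{(f)}$ independent. The fog gain $h^{(f)}$ has density $\frac{v^k}{\Gamma(k)}[\ln(1/x)]^{k-1}x^{v-1}$ on $(0,1]$, $v>0$, $k$ a positive integer. The turbulence/pointing-error gain $h^{(tp)}$ has density $\psi x^{\phi-1}\sum_{l=1}^{P}\zeta_lG_{p,q}^{m,n}\left(C_lx\middle|\begin{array}{c}\{a_{l,w}\}_{w=1}^p\\\{b_{l,w}\}_{w=1}^q\end{array}\right)$, $x>0$, with parameters of one of the following models ($\rho>0$, $A_0>0$ pointing-error parameters): $\mathcal{GG}$ (Gamma-Gamma), $\alpha,\beta>0$: $\psi=\frac{\alpha\beta\rho^2}{A_0\Gamma(\alpha)\Gamma(\beta)}$, $\phi=1$, $P=1$, $\zeta_1=1$, $C_1=\frac{\alpha\beta}{A_0}$, $(m,n,p,q)=(3,0,1,3)$,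 $a=\{\rho^2\}$, $b=\{\rho^2-1,\alpha-1,\beta-1\}$. $\mathcal{M}$ (Málaga), $\alpha>0$, $\beta$ a positive integer, $g,\Omega'>0$: $\psi=\frac{\rho^2A_{mg}}{2}$, $\phi=0$, $P=\beta$, $\zeta_l=b_l$, $C_l=\frac{\alpha\beta}{(g\beta+\Omega')A_0}$, $(m,n,p,q)=(3,0,1,3)$, $a_l=\{\rho^2+1\}$, $\{b_{l,w}\}=\{\rho^2,\alpha,l\}$, where $A_{mg}=\frac{2\alpha^{\alpha/2}}{g^{1+\alpha/2}\Gamma(\alpha)}\left(\frac{g\beta}{g\beta+\Omega'}\right)^{\beta+\alpha/2}$ and $b_l=\binom{\beta-1}{l-1}\frac{(g\beta+\Omega')^{1-l/2}}{(l-1)!}\left(\frac{\Omega'}{g}\right)^{l-1}\left(\frac{\alpha}{\beta}\right)^{l/2}\left(\frac{\alpha\beta}{g\beta+\Omega'}\right)^{-(\alpha+l)/2}$. $\mathcal{F}$ (Fisher–Snedecor), $\alpha>0$, $\beta>1$: $\psi=\frac{\alpha\rho^2}{(\beta-1)A_0\Gamma(\alpha)\Gamma(\beta)}$, $\phi=1$, $P=1$, $\zeta_1=1$, $C_1=\frac{\alpha}{(\beta-1)A_0}$, $(m,n,p,q)=(2,1,2,2)$, $a=\{-\beta,\rho^2\}$, $b=\{\alpha-1,\rho^2-1\}$. *)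

(* Defs.v *)
From mathcomp Require Import all_boot all_order all_algebra.
From mathcomp Require Import complex.
From mathcomp Require Import all_classical all_reals all_analysis.

Set Implicit Arguments.
Unset Strict Implicit.
Unset Printing Implicit Defensive.

Import Order.TTheory GRing.Theory Num.Theory.
Import numFieldNormedType.Exports.

Local Open Scope classical_set_scope.
Local Open Scope ring_scope.
Local Open Scope complex_scope.

Definition cexp (R : realType) (z : R[i]) : R[i] :=
  (expR (complex.Re z) * cos (complex.Im z)) +i*
  (expR (complex.Re z) * sin (complex.Im z)).

(* Principal value of [x ^ s]; only used for [x > 0]. *)
Definition cpow (R : realType) (x : R) (s : R[i]) : R[i] :=
  cexp ((ln x)%:C * s).

Definition Cintegral (R : realType) (D : set R) (f : R -> R[i]) : R[i] :=
  Rintegral lebesgue_measure D (fun x => complex.Re (f x)) +i*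
  Rintegral lebesgue_measure D (fun x => complex.Im (f x)).

(* Euler's integral, convergent for [0 < Re z]. *)
Definition eulerGamma (R : realType) (z : R[i]) : R[i] :=
  Cintegral `]0, +oo[ (fun u => cpow u (z - 1) * (expR (- u))%:C).

(* Analytic continuation by Gamma z = Gamma (z + N) / (z (z+1) ... (z+N-1)),
   where N is the least natural number such that 0 < Re z + N (so N = 0 if
   0 < Re z).  Since 0^-1 = 0, Gamma takes the value 0 at its poles, hence
   (Gamma z)^-1 is the entire function 1/Gamma on the whole plane. *)
Definition Gamma (R : realType) (z : R[i]) : R[i] :=
  let N := Num.truncn (1 - complex.Re z) in
  eulerGamma (z + N%:R) / \prod_(0 <= k < N) (z + k%:R).

Definition rGamma (R : realType) (x : R) : R := complex.Re (Gamma x%:C).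

(* In [meijerG m n a b x] the orders p and q are [size a] and [size b], and the
   parameters are indexed from 0: a_j is [a`_(j-1)], b_j is [b`_(j-1)]. *)
Definition meijerG_integrand (R : realType) (m n : nat) (a b : seq R)
    (x : R) (s : R[i]) : R[i] :=
  (\prod_(0 <= j < m) Gamma ((b`_j)%:C - s) *
   \prod_(0 <= j < n) Gamma (1 - (a`_j)%:C + s)) /
  (\prod_(n <= j < size a) Gamma ((a`_j)%:C - s) *
   \prod_(m <= j < size b) Gamma (1 - (b`_j)%:C + s)) *
  cpow x s.

(* The line Re s = c has every pole b_j + k of Gamma(b_j - s) (j <= m) on its
   right and every pole a_j - 1 - k of Gamma(1 - a_j + s) (j <= n) on its
   left. *)
Definition separates (R : realType) (m n : nat) (a b : seq R) (c : R) : Prop :=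
  (forall j k : nat, (j < m)%N -> c < b`_j + k%:R) /\
  (forall j k : nat, (j < n)%N -> a`_j - 1 - k%:R < c).

(* The contour is a vertical line s = c + iy (ds = i dy) separating the two
   families of poles; by Cauchy's theorem the value does not depend on which.
   Such a line exists iff max_(j <= n) a_j - 1 < min_(j <= m) b_j, which holds
   for the three fading models below. *)
Definition meijerG (R : realType) (m n : nat) (a b : seq R) (x : R) : R[i] :=
  let c := xget 0 [set c | separates m n a b c] in
  ((2 * pi)%:C * 'i)^-1 *
  Cintegral setT (fun y => meijerG_integrand m n a b x (c +i* y) * 'i).

(* Parameters of the turbulence/pointing-error gain.  The index l of
   [tp_zeta], [tp_C], [tp_a], [tp_b] ranges over 1..P. *)
Record tp_params (R : realType) := TpParams {
  tp_psi : R;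
  tp_phi : R;
  tp_P : nat;
  tp_zeta : nat -> R;
  tp_C : nat -> R;
  tp_m : nat;
  tp_n : nat;
  tp_a : nat -> seq R;
  tp_b : nat -> seq R
}.

Definition GG_params (R : realType) (rho A0 alpha beta : R) : tp_params R := {|
  tp_psi := alpha * beta * rho ^+ 2 / (A0 * rGamma alpha * rGamma beta);
  tp_phi := 1;
  tp_P := 1;
  tp_zeta := fun=> 1;
  tp_C := fun=> alpha * beta / A0;
  tp_m := 3;
  tp_n := 0;
  tp_a := fun=> [:: rho ^+ 2];
  tp_b := fun=> [:: rho ^+ 2 - 1; alpha - 1; beta - 1]
|}.

Definition malaga_A (R : realType) (alpha : R) (beta : nat) (g Omega : R) : R :=
  2 * alpha `^ (alpha / 2) / (g `^ (1 + alpha / 2) * rGamma alpha) *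
  (g * beta%:R / (g * beta%:R + Omega)) `^ (beta%:R + alpha / 2).

Definition malaga_b (R : realType) (alpha : R) (beta : nat) (g Omega : R)
    (l : nat) : R :=
  'C(beta.-1, l.-1)%:R *
  ((g * beta%:R + Omega) `^ (1 - l%:R / 2) / (l.-1)`!%:R) *
  (Omega / g) ^+ l.-1 *
  (alpha / beta%:R) `^ (l%:R / 2) *
  (alpha * beta%:R / (g * beta%:R + Omega)) `^ (- ((alpha + l%:R) / 2)).

Definition M_params (R : realType) (rho A0 alpha : R) (beta : nat)
    (g Omega : R) : tp_params R := {|
  tp_psi := rho ^+ 2 * malaga_A alpha beta g Omega / 2;
  tp_phi := 0;
  tp_P := beta;
  tp_zeta := malaga_b alpha beta g Omega;
  tp_C := fun=> alpha * beta%:R / ((g * beta%:R + Omega) * A0);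
  tp_m := 3;
  tp_n := 0;
  tp_a := fun=> [:: rho ^+ 2 + 1];
  tp_b := fun l => [:: rho ^+ 2; alpha; l%:R]
|}.

Definition F_params (R : realType) (rho A0 alpha beta : R) : tp_params R := {|
  tp_psi := alpha * rho ^+ 2 /
            ((beta - 1) * A0 * rGamma alpha * rGamma beta);
  tp_phi := 1;
  tp_P := 1;
  tp_zeta := fun=> 1;
  tp_C := fun=> alpha / ((beta - 1) * A0);
  tp_m := 2;
  tp_n := 1;
  tp_a := fun=> [:: - beta; rho ^+ 2];
  tp_b := fun=> [:: alpha - 1; rho ^+ 2 - 1]
|}.

Inductive tp_model (R : realType) : tp_params R -> Prop :=
| ModelGG (rho A0 alpha beta : R) :
    0 < rho -> 0 < A0 -> 0 < alpha -> 0 < beta ->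
    tp_model (GG_params rho A0 alpha beta)
| ModelM (rho A0 alpha : R) (beta : nat) (g Omega : R) :
    0 < rho -> 0 < A0 -> 0 < alpha -> (0 < beta)%N -> 0 < g -> 0 < Omega ->
    tp_model (M_params rho A0 alpha beta g Omega)
| ModelF (rho A0 alpha beta : R) :
    0 < rho -> 0 < A0 -> 0 < alpha -> 1 < beta ->
    tp_model (F_params rho A0 alpha beta).

(* Since all parameters are real, [meijerG] is real-valued for [0 < x] (the
   integrand at conj s is the conjugate of the integrand at s), and
   [complex.Re] only casts from R[i] to R. *)
Definition tp_pdf (R : realType) (X : tp_params R) (x : R) : R :=
  if 0 < x then
    tp_psi X * x `^ (tp_phi X - 1) *
    \sum_(1 <= l < (tp_P X).+1)
      tp_zeta X l *
      complex.Re (meijerG (tp_m X) (tp_n X) (tp_a X l) (tp_b X l)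
                          (tp_C X l * x))
  else 0.

Definition fog_pdf (R : realType) (v : R) (k : nat) (x : R) : R :=
  if (0 < x) && (x <= 1) then
    v ^+ k / rGamma (k%:R : R) * ln (1 / x) ^+ k.-1 * x `^ (v - 1)
  else 0.

Definition has_density (R : realType) (d : measure_display)
    (T : measurableType d) (Pr : probability T R) (X : {RV Pr >-> R})
    (f : R -> R) : Prop :=
  [/\ measurable_fun setT f,
      forall x, 0 <= f x &
      forall A : set R, measurable A ->
        distribution Pr X A = (\int[lebesgue_measure]_(x in A) (f x)%:E)%E].

Definition independent_RV (R : realType) (d : measure_display)
    (T : measurableType d) (Pr : probability T R) (X Y : {RV Pr >-> R}) : Prop :=
  forall A B : set R, measurable A -> measurable B ->
    Pr (X @^-1` A `&` Y @^-1` B) = (Pr (X @^-1` A) * Pr (Y @^-1` B))%E.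

Definition outage (R : realType) (d : measure_display)
    (T : measurableType d) (Pr : probability T R) (h : T -> R) (t : nat)
    (gamma_th gamma0 : R) : R :=
  fine (Pr [set w | gamma0 * h w ^+ t <= gamma_th]).

Definition log_ratio (R : realType) (Pout : R -> R) (gamma0 : R) : R :=
  ln (Pout gamma0) / ln gamma0.

(* Only meaningful when the limit exists. *)
Definition diversity_order (R : realType) (Pout : R -> R) : R :=
  - lim (log_ratio Pout gamma0 @[gamma0 --> +oo]).

(* Main.v *)
(* On the contour Re s = c, every Meijer integrand of the three models is x^s
   times a product of two Gamma factors and one ratio Gamma(z) / Gamma(z + 1) =
   1 / z.  Each factor is the Mellin transform of an explicit positive density
   (Euler's integral, or u^(z-1) on (0, 1]), so the G-function is the density of
   a product of three independent positive variables.  Instead of inverting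
   pointwise, both sides are integrated against a Gaussian in ln x - b, for which
   Fourier inversion is two applications of Fubini; integrability on the contour
   comes from Gamma(z) = Gamma(z + 2) / (z (z + 1)).  This identity does not
   depend on c and compares the law of the turbulence gain with a triple
   convolution of elementary densities: as b -> -oo the smoothed law is
   O(exp (r b)) for every r < phi + b_{l,i} and is at least a multiple of
   exp ((phi + b_{l,i}) b) for every (l, i).  Gaussian tails being negligible,
   the distribution function at x of the turbulence gain is x^(mu + o(1)) with
   mu = min (phi + b_{l,i}); that of the fog gain is x^(v + o(1)).  For the
   product, the upper bound sums over the annuli exp (-j - 1) < h^(f) <= exp (-j),
   and the lower bound lets one gain be small while the other stays bounded. *)
Require Import Defs.
From mathcomp Require Import all_boot all_order all_algebra.
From mathcomp Require Import complex ring lra.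
From mathcomp Require Import all_classical all_reals all_analysis measurable_realfun.

Set Implicit Arguments.
Unset Strict Implicit.
Unset Printing Implicit Defensive.

Import Order.TTheory GRing.Theory Num.Theory.
Import numFieldNormedType.Exports.

Local Open Scope classical_set_scope.
Local Open Scope ring_scope.

(** * Lebesgue integrals over the real line *)

(** Summing residues would mean separating simple poles from coinciding ones and from poles
    differing by integers, where logarithms appear. Comparing exponential rates treats all these
    cases alike, at the price of an arbitrarily small loss in the exponent, which the logarithmic
    limit does not see. The abscissa c cancels without any contour being moved: the weight x^(phi -
    1) x^c dx tilts the Gaussian and contributes the rate phi + c, while the convolution contributes
    rates b_i - c. In the model F the numerator also holds Gamma(1 - a + s), where s has the
    opposite sign. The corresponding variable enters the convolution reflected, so it shapes the law
    at infinity and not at 0; all it imposes on a rate e is beta + e > 0. The lower bounds rest on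
    positivity: the three elementary densities and the weights zeta_l are positive, so neither the
    factors of a term nor the terms of the sum can cancel. *)

Definition integ (R : realType) (f : R -> R) : Prop :=
  (@lebesgue_measure R).-integrable setT (EFin \o f).

Definition RI (R : realType) (f : R -> R) : R :=
  Rintegral (@lebesgue_measure R) setT f.

Section integ_theory.
Variable R : realType.
Implicit Types f g h : R -> R.
Local Notation mu := (@lebesgue_measure R).

Lemma integ_measurable f : integ f -> measurable_fun setT f.
Proof. by move=> /measurable_int /measurable_EFinP. Qed.

Lemma integ_le f g : measurable_fun setT f -> (forall x, `|f x| <= g x) ->
  integ g -> integ f.
Proof.
move=> mf fg; apply: le_integrable => //; first exact/measurable_EFinP.
move=> x _ /=; rewrite lee_fin (le_trans (fg x))//; exact: ler_norm.
Qed.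

Lemma integ_abs f : integ f -> integ (fun x => `|f x|).
Proof. exact: integrable_norm. Qed.

Lemma integD f g : integ f -> integ g -> integ (fun x => f x + g x).
Proof. by move=> fi gi; apply: (integrableD _ fi gi). Qed.

Lemma integB f g : integ f -> integ g -> integ (fun x => f x - g x).
Proof. by move=> fi gi; apply: (integrableB _ fi gi). Qed.

Lemma integZ k f : integ f -> integ (fun x => k * f x).
Proof. by move=> fi; apply: (integrableZl _ k fi). Qed.

Lemma integM f h B : integ f -> measurable_fun setT h ->
  (forall x, `|h x| <= B) -> integ (fun x => f x * h x).
Proof.
move=> fi mh hB; apply: (@integ_le _ (fun x => B * `|f x|)).
- by apply: measurable_funM => //; exact: integ_measurable.
- by move=> x; rewrite normrM mulrC ler_wpM2r.
- exact/integZ/integ_abs.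
Qed.

Lemma RI_ext f g : f =1 g -> RI f = RI g.
Proof. by move=> fg; congr Rintegral; exact/funext. Qed.

Lemma integ_ext f g : f =1 g -> integ f -> integ g.
Proof. by move=> /funext ->. Qed.

Lemma RID f g : integ f -> integ g -> RI (fun x => f x + g x) = RI f + RI g.
Proof. exact: RintegralD. Qed.

Lemma RIB f g : integ f -> integ g -> RI (fun x => f x - g x) = RI f - RI g.
Proof. exact: RintegralB. Qed.

Lemma RIZ k f : integ f -> RI (fun x => k * f x) = k * RI f.
Proof. exact: RintegralZl. Qed.

Lemma RI_le f g : integ f -> integ g -> (forall x, f x <= g x) -> RI f <= RI g.
Proof. by move=> fi gi fg; exact: le_Rintegral. Qed.

Lemma RI_ge0 f : (forall x, 0 <= f x) -> 0 <= RI f.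
Proof. by move=> f0; apply: Rintegral_ge0. Qed.

Lemma RI_abs f : integ f -> `|RI f| <= RI (fun x => `|f x|).
Proof. exact: le_normr_Rintegral. Qed.

Lemma EFin_RI f : integ f -> (RI f)%:E = (\int[mu]_x (f x)%:E)%E.
Proof. by move=> fi; rewrite /RI /Rintegral fineK//; exact: integrable_fin_num. Qed.

Lemma integ_ge0P f : measurable_fun setT f -> (forall x, 0 <= f x) ->
  (\int[mu]_x (f x)%:E < +oo)%E -> integ f.
Proof.
move=> mf f0 foo; apply/integrableP; split; first exact/measurable_EFinP.
apply: le_lt_trans foo; rewrite le_eqVlt; apply/orP; left; apply/eqP.
by apply: eq_integral => x _ /=; rewrite ger0_norm.
Qed.

(** The standard majorant on the line: densities and kernels are shown integrable, and primitives
    shown to vanish at infinity, by comparison with a multiple of it. *)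
Lemma integ_invsqr : integ (fun x : R => (1 + x ^+ 2)^-1).
Proof.
apply: integ_ge0P.
- by apply: continuous_measurable_fun; exact: continuous_oneDsqrV.
- by move=> x; rewrite invr_ge0 addr_ge0 ?sqr_ge0.
- rewrite ge0_symfun_integralT//=.
  + rewrite (_ : [set x | _] = `[0, +oo[%classic); last first.
      by apply/seteqP; split => x/=; rewrite in_itv/= andbT.
    by rewrite integral0y_oneDsqr -EFinM ltry.
  + by move=> x; rewrite invr_ge0 addr_ge0 ?sqr_ge0.
  + exact: continuous_oneDsqrV.
  + by move=> x /=; rewrite sqrrN.
Qed.

Lemma integ_dom f C : measurable_fun setT f ->
  (forall x, `|f x| <= C * (1 + x ^+ 2)^-1) -> integ f.
Proof. by move=> mf fC; apply: (integ_le mf fC); exact/integZ/integ_invsqr. Qed.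

(** Dominated convergence for the restrictions of [f] to [Dn], with majorant [|f|]: at each point
    they are eventually equal to [f]. *)
Lemma cvg_RI_exhaust (D : set R) (Dn : (set R)^nat) f :
  measurable D -> (forall n, measurable (Dn n)) -> (forall n, Dn n `<=` D) ->
  (forall x, D x -> \forall n \near \oo, Dn n x) ->
  mu.-integrable D (EFin \o f) ->
  Rintegral mu (Dn n) f @[n --> \oo] --> Rintegral mu D f.
Proof.
move=> mD mDn DnD nearD fi.
have E n : Rintegral mu (Dn n) f = Rintegral mu D (f \_ (Dn n)).
  by rewrite -Rintegral_mkcondr; congr Rintegral; rewrite setIC; exact/esym/setIidl.
under eq_fun do rewrite E.
have mf : measurable_fun D (EFin \o f) by exact: measurable_int fi.
have mf' : measurable_fun D f by exact/measurable_EFinP.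
have [] := @dominated_convergence _ _ _ mu D mD
  (fun n => EFin \o (f \_ (Dn n))) (EFin \o f) (fun x => `|f x|%:E).
- move=> n; apply/measurable_EFinP; apply/measurable_restrict; [exact: mDn|exact: mD|].
  by apply: (measurable_funS mD _ mf'); exact: subIsetl.
- exact: mf.
- apply: aeW => x Dx; apply: cvg_near_cst.
  apply: filterS (nearD _ Dx) => n Dnx /=.
  by rewrite patchE mem_set.
- exact: integrable_norm.
- apply: aeW => x n Dx /=; rewrite lee_fin patchE; case: ifP => //.
  by rewrite normr0.
move=> _ _ H; apply: fine_cvg.
by rewrite /Rintegral fineK//; exact: integrable_fin_num.
Qed.

End integ_theory.

(** * Fundamental theorem of calculus and change of variable on unbounded domains *)

Section ftc_and_substitution.
Variable R : realType.
Implicit Types f F h phi : R -> R.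
Local Notation mu := (@lebesgue_measure R).

Let Rn (n : nat) : set R := `[- n%:R, n%:R].

Let mRn n : measurable (Rn n). Proof. exact: measurable_itv. Qed.

Lemma is_derive_continuous F f :
  (forall x : R, is_derive x 1 F (f x)) -> continuous F.
Proof.
move=> dF x; apply/differentiable_continuous/derivable1_diffP.
exact: ex_derive.
Qed.

Lemma Rintegral_itv_FTC F f a b : (forall x : R, is_derive x 1 F (f x)) ->
  continuous f -> a < b -> Rintegral mu `[a, b] f = F b - F a.
Proof.
move=> dF cf ab; have cF := is_derive_continuous dF.
rewrite /Rintegral (@continuous_FTC2 _ f F)//.
- exact: continuous_subspaceT.
- split=> [x _||].
  + exact: ex_derive.
  + exact/cvg_at_right_filter/cF.
  + exact/cvg_at_left_filter/cF.
- by move=> x _; rewrite derive1E; exact: derive_val.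
Qed.

Let near_Rn (x : R) : \forall n \near \oo, Rn n x.
Proof.
near=> n; rewrite /Rn /= in_itv/= -ler_norml.
by near: n; exact: nbhs_infty_ger.
Unshelve. all: end_near. Qed.

(** The sign [s] treats both ends n and -n of an exhausting interval at once. *)
Lemma cvgn_invsqr0 (C : R) (s : R) : s ^+ 2 = 1 ->
  C * (1 + (s * n%:R) ^+ 2)^-1 @[n --> \oo] --> (0:R).
Proof.
move=> s1; rewrite -(mulr0 C); apply: cvgM; first exact: cvg_cst.
apply: (@squeeze_cvgr _ _ _ _ (cst 0) (fun n => n.+1%:R^-1)).
- apply: nearW => n; rewrite /= invr_ge0 addr_ge0 ?sqr_ge0//= lef_pV2 ?posrE//.
  + rewrite exprMn s1 mul1r -natr1 addrC lerD2l -natrX ler_nat.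
    by case: n => // n; rewrite leq_pmulr.
  + by rewrite ltr_wpDr ?sqr_ge0.
- exact: cvg_cst.
- exact: cvg_harmonic.
Qed.

Let sqrN1 : (-1 : R) ^+ 2 = 1. Proof. by rewrite sqrrN expr1n. Qed.

(** Serves as integration by parts on the whole line: the boundary terms [F n] and [F (- n)] vanish
    in the limit. *)
Lemma RI_derive0 F f C : (forall x : R, is_derive x 1 F (f x)) ->
  continuous f -> integ f -> (forall x, `|F x| <= C * (1 + x ^+ 2)^-1) ->
  RI f = 0.
Proof.
move=> dF cf fi FC.
have cvgF (s : R) : s ^+ 2 = 1 -> F (s * n%:R) @[n --> \oo] --> 0.
  move=> s1; apply/norm_cvg0P; apply: (@squeeze_cvgr _ _ _ _ (fun=> 0)) (cvgn_invsqr0 C s1).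
    by apply: nearW => n; rewrite /= normr_ge0 FC.
  exact: cvg_cst.
have c1 : Rintegral mu (Rn n) f @[n --> \oo] --> RI f.
  by apply: cvg_RI_exhaust => // x _; exact: near_Rn.
have c2 : Rintegral mu (Rn n) f @[n --> \oo] --> (0:R).
  have : F (1 * n%:R) - F (-1 * n%:R) @[n --> \oo] --> (0 - 0 : R).
    by apply: cvgB; apply: cvgF; rewrite ?expr1n.
  rewrite subrr; apply: cvg_trans; apply: near_eq_cvg; near=> n.
  rewrite mul1r mulN1r (Rintegral_itv_FTC dF)// gtrN//.
  by rewrite ltr0n; near: n; exact: nbhs_infty_gt.
exact: cvg_unique c1 c2.
Unshelve. all: end_near. Qed.

Lemma RI_deriveNy F f C : (forall x : R, is_derive x 1 F (f x)) ->
  continuous f -> mu.-integrable `]-oo, 0] (EFin \o f) ->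
  (forall x, x <= 0 -> `|F x| <= C * (1 + x ^+ 2)^-1) ->
  Rintegral mu `]-oo, 0] f = F 0.
Proof.
move=> dF cf fi FC.
have cvgF : F (-1 * n%:R) @[n --> \oo] --> 0.
  apply/norm_cvg0P; apply: (@squeeze_cvgr _ _ _ _ (fun=> 0)) (cvgn_invsqr0 C sqrN1).
    by apply: nearW => n; rewrite /= normr_ge0 FC// mulN1r oppr_le0.
  exact: cvg_cst.
have c1 : Rintegral mu `[- n%:R, 0] f @[n --> \oo] --> Rintegral mu `]-oo, 0] f.
  apply: cvg_RI_exhaust => //.
    by move=> n x /=; rewrite !in_itv/= => /andP[].
  move=> x /=; rewrite in_itv/= => x0; near=> n.
  by rewrite in_itv/= x0 andbT lerNl; near: n; exact: nbhs_infty_ger.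
have c2 : Rintegral mu `[- n%:R, 0] f @[n --> \oo] --> F 0.
  have : F 0 - F (-1 * n%:R) @[n --> \oo] --> (F 0 - 0 : R).
    by apply: cvgB => //; exact: cvg_cst.
  rewrite subr0; apply: cvg_trans; apply: near_eq_cvg; near=> n.
  rewrite mulN1r (Rintegral_itv_FTC dF)// oppr_lt0.
  by rewrite ltr0n; near: n; exact: nbhs_infty_gt.
exact: cvg_unique c1 c2.
Unshelve. all: end_near. Qed.

Section substitution.
Variables (phi phi' : R -> R) (D : set R).
Hypothesis dphi : forall x : R, is_derive x 1 phi (phi' x).
Hypothesis cphi' : continuous phi'.
Hypothesis phi'0 : forall x, 0 <= phi' x.
Hypothesis phi_incr : {homo phi : x y / x < y}.
Hypothesis oD : open D.
Hypothesis DE : D = \bigcup_n [set` `[phi (- n%:R), phi n%:R]].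

Let cphi : continuous phi. Proof. exact: is_derive_continuous dphi. Qed.

Let phi_nd : {homo phi : x y / x <= y}.
Proof. by move=> x y; rewrite le_eqVlt => /predU1P[->//|/phi_incr/ltW]. Qed.

Let Dphi x : D (phi x).
Proof.
rewrite DE; have [n _ nx] := near_Rn x; have := nx n (leqnn n).
rewrite /Rn /= in_itv/= => /andP[h1 h2]; exists n => //=.
by rewrite in_itv/= !phi_nd.
Qed.

Let nd_itv (a b : nat -> R) : {homo a : n m / (n <= m)%N >-> m <= n} ->
  {homo b : n m / (n <= m)%N >-> n <= m} ->
  nondecreasing_seq (fun n => [set` `[a n, b n]]).
Proof.
move=> ha hb n m nm; apply/subsetPset => x /=; rewrite !in_itv/= => /andP[h1 h2].
by rewrite (le_trans _ h1) ?ha// (le_trans h2)// hb.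
Qed.

(** The substitution rule on the compact intervals [[phi (- n), phi n]] passes to the limit by
    monotone convergence on both sides. *)
Lemma ge0_integral_subst h : {in D, continuous h} ->
  (forall x, D x -> 0 <= h x) ->
  (\int[mu]_(x in D) (h x)%:E = \int[mu]_x (h (phi x) * phi' x)%:E)%E.
Proof.
move=> ch h0.
have ch' : continuous (fun x => h (phi x) * phi' x).
  move=> x; apply: cvgM; last exact: cphi'.
  apply: (@continuous_comp _ _ _ phi h); first exact: cphi.
  by apply: ch; rewrite inE; exact: Dphi.
have mh : measurable_fun D h by exact: open_continuous_measurable_fun.
have mD : measurable D by exact: open_measurable.
have T : [set: R] = \bigcup_n Rn n.
  apply/seteqP; split=> // x _; have [n _ nx] := near_Rn x.
  by exists n => //; exact: nx (leqnn n).
have En n : (\int[mu]_(x in [set` `[phi (- n%:R), phi n%:R]]) (h x)%:E =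
    \int[mu]_(x in Rn n) (h (phi x) * phi' x)%:E)%E.
  rewrite (@integration_by_substitution_increasing _ phi h)//.
  - apply: eq_integral => x _; rewrite /= fctE derive1E.
    by rewrite (@derive_val _ _ _ _ _ _ _ (dphi x)).
  - by rewrite ge0_cp// lerNl oppr0.
  - by move=> x y _ _; exact: phi_incr.
  - move=> x _; rewrite (_ : phi^`()%classic = phi')//.
    by apply/funext => z; rewrite derive1E; exact: derive_val.
  - rewrite (_ : phi^`()%classic = phi'); last first.
      by apply/funext => z; rewrite derive1E; exact: derive_val.
    by apply/cvg_ex; exists (phi' (- n%:R)); exact/cvg_at_right_filter/cphi'.
  - rewrite (_ : phi^`()%classic = phi'); last first.
      by apply/funext => z; rewrite derive1E; exact: derive_val.
    by apply/cvg_ex; exists (phi' n%:R); exact/cvg_at_left_filter/cphi'.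
  - split=> [x _||].
    + exact: ex_derive.
    + exact/cvg_at_right_filter/cphi.
    + exact/cvg_at_left_filter/cphi.
  - apply: continuous_in_subspaceT => x; rewrite inE /= => xn.
    by apply: ch; rewrite inE DE; exists n.
have c1 : (\int[mu]_(x in [set` `[phi (- n%:R), phi n%:R]]) (h x)%:E @[n --> \oo]
    --> \int[mu]_(x in D) (h x)%:E)%E.
  rewrite DE; apply: ge0_nondecreasing_set_cvg_integral.
  - apply: nd_itv => n m nm; apply: phi_nd; last by rewrite ler_nat.
    by rewrite lerN2 ler_nat.
  - by move=> n; exact: measurable_itv.
  - move=> n; apply/measurable_EFinP; apply: (measurable_funS mD _ mh).
    by rewrite DE => x nx; exists n.
  - by move=> n x nx; rewrite lee_fin h0// DE; exists n.
have c2 : (\int[mu]_(x in Rn n) (h (phi x) * phi' x)%:E @[n --> \oo]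
    --> \int[mu]_x (h (phi x) * phi' x)%:E)%E.
  rewrite T; apply: ge0_nondecreasing_set_cvg_integral.
  - apply: nd_itv => n m nm; last by rewrite ler_nat.
    by rewrite lerN2 ler_nat.
  - by move=> n; exact: measurable_itv.
  - move=> n; apply/measurable_EFinP/measurable_funTS.
    exact: continuous_measurable_fun.
  - by move=> n x _; rewrite lee_fin mulr_ge0// h0.
move: c1; rewrite (funext En) => c1.
exact: cvg_unique c1 c2.
Qed.

Lemma Rintegral_subst h : {in D, continuous h} ->
  integ (fun x => h (phi x) * phi' x) ->
  mu.-integrable D (EFin \o h) /\
  Rintegral mu D h = RI (fun x => h (phi x) * phi' x).
Proof.
move=> ch hi.
have mD : measurable D by exact: open_measurable.
have mh : measurable_fun D h by exact: open_continuous_measurable_fun.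
have cah : {in D, continuous (fun x => `|h x|)}.
  by move=> x Dx; apply: cvg_norm; exact: ch.
have Dh : mu.-integrable D (EFin \o h).
  apply/integrableP; split; first exact/measurable_EFinP.
  have -> : (\int[mu]_(x in D) `|(EFin \o h) x|)%E =
            (\int[mu]_x (`|h (phi x)| * phi' x)%:E)%E.
    exact: (ge0_integral_subst cah).
  have /integrableP[_] := hi; apply: le_lt_trans.
  rewrite le_eqVlt; apply/orP; left; apply/eqP; apply: eq_integral => x _ /=.
  by rewrite normrM (ger0_norm (phi'0 x)).
have Dah : mu.-integrable D (EFin \o (fun x => `|h x|)) by exact: integrable_norm.
have ahi : integ (fun x => `|h (phi x)| * phi' x).
  apply: integ_ext (integ_abs hi) => x.
  by rewrite normrM (ger0_norm (phi'0 x)).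
split => //.
(* [h] is the difference of the nonnegative functions [k] and [|h|]; the nonnegative case applies to
   both, and the common term cancels. *)
pose k x := h x + `|h x|.
have k0 x : D x -> 0 <= k x by move=> _; rewrite /k -lerBlDl sub0r -normrN ler_norm.
have ck : {in D, continuous k}.
  by move=> x Dx; apply: cvgD; [exact: ch|exact: cah].
have Ek : Rintegral mu D k = RI (fun x => k (phi x) * phi' x).
  by rewrite /RI /Rintegral (ge0_integral_subst ck).
have Ea : Rintegral mu D (fun x => `|h x|) = RI (fun x => `|h (phi x)| * phi' x).
  by rewrite /RI /Rintegral (ge0_integral_subst cah).
have : Rintegral mu D k = Rintegral mu D h + Rintegral mu D (fun x => `|h x|).
  exact: RintegralD.
rewrite Ek Ea (_ : RI _ = RI (fun x => h (phi x) * phi' x) +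
   RI (fun x => `|h (phi x)| * phi' x)); last first.
  by rewrite -RID//; apply: RI_ext => x; rewrite -mulrDl.
by move/addIr.
Qed.

End substitution.

Lemma RI_shift h m : continuous h -> integ h ->
  integ (fun x => h (x + m)) /\ RI (fun x => h (x + m)) = RI h.
Proof.
move=> ch hi.
have [] := @Rintegral_subst (fun x => x - m) (fun=> 1) setT _ _ _ _ _ _
  (fun x => h (x + m)) _ _.
- by move=> x; apply: is_derive_eq; rewrite ?oppr0 ?addr0.
- exact: cst_continuous.
- by [].
- by move=> x y; rewrite ltrD2r.
- exact: openT.
- apply/seteqP; split=> // x _.
  have [n _ nx] := near_Rn (x + m); exists n => //.
  have := nx n (leqnn n).
  by rewrite /Rn /= !in_itv/= lerBlDr lerBrDr.
- move=> x _; apply: (@continuous_comp _ _ _ (fun x => x + m) h).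
    by apply: cvgD; [exact: cvg_id|exact: cvg_cst].
  exact: ch.
- by apply: integ_ext hi => x; rewrite subrK mulr1.
move=> h1 h2; split=> //; rewrite /RI h2.
by apply: RI_ext => x; rewrite subrK mulr1.
Qed.

(** The passage to the logarithmic variable, in which Mellin transforms become Fourier
    transforms. *)
Lemma Rintegral_expR h : {in `]0, +oo[, continuous h} ->
  integ (fun w => h (expR w) * expR w) ->
  mu.-integrable `]0, +oo[ (EFin \o h) /\
  Rintegral mu `]0, +oo[ h = RI (fun w => h (expR w) * expR w).
Proof.
move=> ch; apply: (@Rintegral_subst expR expR).
- exact: continuous_expR.
- exact: expR_ge0.
- by move=> x y; rewrite ltr_expR.
- exact: interval_open.
- apply/seteqP; split => x /=; rewrite in_itv/= andbT.
  + move=> x0; have [n _ nx] := near_Rn (ln x); exists n => //.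
    have := nx n (leqnn n); rewrite /Rn /= !in_itv/= => /andP[h1 h2].
    by rewrite -[x]lnK ?posrE// !ler_expR h1.
  + by move=> [n _ /=]; rewrite in_itv/= => /andP[+ _]; exact/lt_le_trans/expR_gt0.
- by move=> x; rewrite inE /= => x0; apply: ch.
Qed.

End ftc_and_substitution.

(** * Exchange of integrals for a product of integrable functions times a bounded kernel *)

Section double_integral.
Variable R : realType.
Implicit Types K d : R -> R.
Local Notation mu := (@lebesgue_measure R).

(** Tonelli: replacing [h] by its bound [B] leaves a product of two integrable functions. In the
    applications [h] is a cosine or a sine coupling the two variables. *)
Lemma integrable_prodM K d (h : R * R -> R) B :
  integ K -> integ d -> measurable_fun setT h -> (forall p, `|h p| <= B) ->
  (mu \x mu)%E.-integrable setT (fun p => (K p.1 * d p.2 * h p)%:E).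
Proof.
move=> Ki di mh hB.
have mK := integ_measurable Ki; have md := integ_measurable di.
have mf : measurable_fun setT (fun p : R * R => (K p.1 * d p.2 * h p)%:E).
  apply/measurable_EFinP; apply: measurable_funM => //.
  by apply: measurable_funM; exact: measurableT_comp.
apply/integrable12ltyP => //.
have iB y : (\int[mu]_w `|(K y * d w * h (y, w))%:E| <=
             (B * `|K y| * RI (fun w => `|d w|))%:E)%E.
  rewrite EFinM EFin_RI; last exact: integ_abs.
  rewrite -ge0_integralZl//.
  - apply: ge0_le_integral => //.
    + apply/measurable_EFinP; apply: measurableT_comp => //.
      apply: measurable_funM; first exact: measurable_funM.
      exact: measurableT_comp.
    + apply/measurable_EFinP; apply: measurable_funM => //.
      exact: measurableT_comp.
    + move=> w _; rewrite -EFinM lee_fin !normrM [B * _]mulrC -!mulrA.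
      by rewrite ler_wpM2l// mulrC ler_wpM2r.
  - exact/measurable_EFinP/measurableT_comp.
  - by rewrite lee_fin mulr_ge0// (le_trans _ (hB (0, 0))).
apply: (@le_lt_trans _ _ (\int[mu]_y (B * `|K y| * RI (fun w => `|d w|))%:E)%E).
  apply: ge0_le_integral => //.
  - by move=> y _; exact: integral_ge0.
  - apply: (@measurable_fun_fubini_tonelli_F _ _ (measurableTypeR R)
      (measurableTypeR R) R mu (fun p => `|(K p.1 * d p.2 * h p)%:E|%E)).
    + exact: measurableT_comp.
    + by move=> p; exact: abse_ge0.
  - apply/measurable_EFinP; apply: measurable_funM => //.
    by apply: measurable_funM => //; exact: measurableT_comp.
  - by move=> y _; exact: iB.
have /integrableP[_] : integ (fun y => B * `|K y| * RI (fun w => `|d w|)).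
  apply: (@integ_ext _ (fun y => RI (fun w => `|d w|) * B * `|K y|)).
    by move=> y; ring.
  exact/integZ/integ_abs.
move=> H; apply: le_lt_trans H; apply: ge0_le_integral => //.
- move=> y _; rewrite lee_fin !mulr_ge0// ?(le_trans _ (hB (0, 0)))//.
  by apply: RI_ge0 => w.
- apply/measurable_EFinP; apply: measurable_funM => //.
  by apply: measurable_funM => //; exact: measurableT_comp.
- apply/measurable_EFinP; apply: measurableT_comp => //; apply: measurable_funM => //.
  by apply: measurable_funM => //; exact: measurableT_comp.
- by move=> y _; rewrite lee_fin ler_norm.
Qed.

Lemma RI_swap K d (h : R * R -> R) B :
  integ K -> integ d -> measurable_fun setT h -> (forall p, `|h p| <= B) ->
  RI (fun y => RI (fun w => K y * d w * h (y, w))) =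
  RI (fun w => RI (fun y => K y * d w * h (y, w))).
Proof.
move=> Ki di mh hB.
have Pi := integrable_prodM Ki di mh hB.
have i1 y : integ (fun w => K y * d w * h (y, w)).
  apply: (@integM _ (fun w => K y * d w) (fun w => h (y, w)) B).
  - exact: integZ.
  - exact: measurableT_comp.
  - by [].
have i2 w : integ (fun y => K y * d w * h (y, w)).
  apply: (@integM _ (fun y => K y * d w) (fun y => h (y, w)) B).
  - by apply: integ_ext (integZ (d w) Ki) => y; rewrite mulrC.
  - exact: measurableT_comp.
  - by [].
have := Fubini Pi; rewrite /fubini_F /fubini_G /= => H.
apply: (congr1 fine).
transitivity (\int[mu]_y \int[mu]_w (K y * d w * h (y, w))%:E)%E.
  by apply: eq_integral => y _; exact: EFin_RI.
by rewrite H; apply: eq_integral => w _; exact/esym/EFin_RI.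
Qed.

End double_integral.

(** * Fourier transforms *)

Section trigonometric_integrals.
Variable R : realType.
Implicit Types (K d F : R -> R) (s y w a : R).
Local Notation mu := (@lebesgue_measure R).

(* Writing e(x) = cos x + i sin x, [Fcos d s y - i Fsin d s y] is the Fourier
   transform of [d] at [s y], and [Finv K1 K2 a] is the real part of the integral
   of [(K1 + i K2)(y) e(y a)].  The sign [s] (1 or -1) lets the law [d] of a
   logarithm also serve for its opposite. *)
Definition Fcos d s y : R := RI (fun w => d w * cos (y * (s * w))).
Definition Fsin d s y : R := RI (fun w => d w * sin (y * (s * w))).
Definition Finv K1 K2 a : R := RI (fun y => K1 y * cos (y * a) - K2 y * sin (y * a)).
(** Up to normalization, the density of Z + s W when Z and W are independent with densities [F] and
    [d]. *)
Definition conv s d F a : R := RI (fun w => d w * F (a - s * w)).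

Lemma normr_cos (x : R) : `|cos x| <= 1.
Proof. by rewrite ler_norml cos_geN1 cos_le1. Qed.

Lemma normr_sin (x : R) : `|sin x| <= 1. Proof. exact: sin_max. Qed.

Lemma integ_cos d (u : R) : integ d -> integ (fun w => d w * cos (w * u)).
Proof.
move=> di; apply: (integM (B := 1) di); last by move=> w; exact: normr_cos.
apply: continuous_measurable_fun => x; apply: continuous_comp; last exact: continuous_cos.
by apply: cvgM; [exact: cvg_id|exact: cvg_cst].
Qed.

Lemma integ_sin d (u : R) : integ d -> integ (fun w => d w * sin (w * u)).
Proof.
move=> di; apply: (integM (B := 1) di); last by move=> w; exact: normr_sin.
apply: continuous_measurable_fun => x; apply: continuous_comp; last exact: continuous_sin.
by apply: cvgM; [exact: cvg_id|exact: cvg_cst].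
Qed.

Lemma RI_continuous (f : R -> R -> R) d : (forall x, integ (f x)) -> integ d ->
  (forall w, continuous (f^~ w)) -> (forall x w, `|f x w| <= `|d w|) ->
  continuous (fun x => RI (f x)).
Proof.
move=> fi di cf fd x.
have := @continuity_under_integral R _ _ mu f setT measurableT (x - 1) (x + 1) _ _
  (fun w => `|d w|) _ _ x.
apply.
- by move=> z _; exact: fi.
- by apply: aeW => w _ z _; exact: cf.
- exact: integ_abs.
- by move=> z _; apply: aeW => w _; exact: fd.
- by rewrite inE /= in_itv/=; apply/andP; split; lra.
Qed.


Lemma continuous_Fcos d s : integ d -> continuous (Fcos d s).
Proof.
move=> di; apply: (RI_continuous _ di).
- by move=> y; apply: integ_ext (integ_cos (y * s) di) => w; rewrite [w * (y * s)]mulrC -[y * s * w]mulrA.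
- move=> w x; apply: cvgM; first exact: cvg_cst.
  apply: continuous_comp; last exact: continuous_cos.
  by apply: cvgM; [exact: cvg_id|exact: cvg_cst].
- by move=> y w; rewrite normrM ler_piMr// normr_cos.
Qed.

Lemma continuous_Fsin d s : integ d -> continuous (Fsin d s).
Proof.
move=> di; apply: (RI_continuous _ di).
- by move=> y; apply: integ_ext (integ_sin (y * s) di) => w; rewrite [w * (y * s)]mulrC -[y * s * w]mulrA.
- move=> w x; apply: cvgM; first exact: cvg_cst.
  apply: continuous_comp; last exact: continuous_sin.
  by apply: cvgM; [exact: cvg_id|exact: cvg_cst].
- by move=> y w; rewrite normrM ler_piMr// normr_sin.
Qed.

Lemma Fcos_bound d s y : integ d -> `|Fcos d s y| <= RI (fun w => `|d w|).
Proof.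
move=> di.
have i : integ (fun w => d w * cos (y * (s * w))).
  by apply: integ_ext (integ_cos (y * s) di) => w; rewrite [w * (y * s)]mulrC -[y * s * w]mulrA.
apply: le_trans (RI_abs i) _; apply: RI_le; [exact: integ_abs|exact: integ_abs|].
by move=> w; rewrite normrM ler_piMr// normr_cos.
Qed.

Lemma Fsin_bound d s y : integ d -> `|Fsin d s y| <= RI (fun w => `|d w|).
Proof.
move=> di.
have i : integ (fun w => d w * sin (y * (s * w))).
  by apply: integ_ext (integ_sin (y * s) di) => w; rewrite [w * (y * s)]mulrC -[y * s * w]mulrA.
apply: le_trans (RI_abs i) _; apply: RI_le; [exact: integ_abs|exact: integ_abs|].
by move=> w; rewrite normrM ler_piMr// normr_sin.
Qed.

Lemma integ_Finv K1 K2 a : integ K1 -> integ K2 ->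
  integ (fun y => K1 y * cos (y * a) - K2 y * sin (y * a)).
Proof. by move=> i1 i2; apply: integB; [exact: integ_cos|exact: integ_sin]. Qed.

Lemma continuous_Finv K1 K2 : integ K1 -> integ K2 -> continuous (Finv K1 K2).
Proof.
move=> i1 i2.
apply: (@RI_continuous _ (fun y => `|K1 y| + `|K2 y|)).
- by move=> a; exact: integ_Finv.
- by apply: integD; exact: integ_abs.
- move=> y x; apply: cvgB; (apply: cvgM; first exact: cvg_cst);
    (apply: continuous_comp; last (exact: continuous_cos || exact: continuous_sin));
    by apply: cvgM; [exact: cvg_cst|exact: cvg_id].
- move=> a y; rewrite [leRHS]ger0_norm ?addr_ge0// (le_trans (ler_normB _ _))//.
  by rewrite !normrM lerD// ler_piMr// ?normr_cos ?normr_sin.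
Qed.

Lemma Finv_bound K1 K2 a : integ K1 -> integ K2 ->
  `|Finv K1 K2 a| <= RI (fun y => `|K1 y| + `|K2 y|).
Proof.
move=> i1 i2; apply: le_trans (RI_abs (integ_Finv a i1 i2)) _.
apply: RI_le; [exact/integ_abs/integ_Finv|by apply: integD; exact: integ_abs|].
move=> y; rewrite (le_trans (ler_normB _ _))//.
by rewrite !normrM lerD// ler_piMr// ?normr_cos ?normr_sin.
Qed.

Lemma integ_mulFcos K d s : integ K -> integ d -> integ (fun y => K y * Fcos d s y).
Proof.
move=> Ki di; apply: (integM (B := RI (fun w => `|d w|)) Ki).
- by apply: continuous_measurable_fun; exact: continuous_Fcos.
- by move=> y; exact: Fcos_bound.
Qed.

Lemma integ_mulFsin K d s : integ K -> integ d -> integ (fun y => K y * Fsin d s y).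
Proof.
move=> Ki di; apply: (integM (B := RI (fun w => `|d w|)) Ki).
- by apply: continuous_measurable_fun; exact: continuous_Fsin.
- by move=> y; exact: Fsin_bound.
Qed.

(* Real and imaginary parts of [(K1 + i K2) (Fcos d s - i Fsin d s)]. *)
Definition KRe K1 K2 d s y := K1 y * Fcos d s y + K2 y * Fsin d s y.
Definition KIm K1 K2 d s y := K2 y * Fcos d s y - K1 y * Fsin d s y.

Lemma integ_KRe K1 K2 d s : integ K1 -> integ K2 -> integ d ->
  integ (KRe K1 K2 d s).
Proof.
move=> i1 i2 di; apply: integD; [exact: integ_mulFcos|exact: integ_mulFsin].
Qed.

Lemma integ_KIm K1 K2 d s : integ K1 -> integ K2 -> integ d ->
  integ (KIm K1 K2 d s).
Proof.
move=> i1 i2 di; apply: integB; [exact: integ_mulFcos|exact: integ_mulFsin].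
Qed.

Lemma integ_cos_comp d (f : R -> R) : integ d -> continuous f ->
  integ (fun w => d w * cos (f w)).
Proof.
move=> di cf; apply: (@integM _ d (fun w => cos (f w)) 1 di).
- apply: continuous_measurable_fun => x; apply: continuous_comp; first exact: cf.
  exact: continuous_cos.
- by move=> w; exact: normr_cos.
Qed.

Lemma integ_sin_comp d (f : R -> R) : integ d -> continuous f ->
  integ (fun w => d w * sin (f w)).
Proof.
move=> di cf; apply: (@integM _ d (fun w => sin (f w)) 1 di).
- apply: continuous_measurable_fun => x; apply: continuous_comp; first exact: cf.
  exact: continuous_sin.
- by move=> w; exact: normr_sin.
Qed.

Lemma continuous_affine (a s : R) : continuous (fun w => a - s * w).
Proof.
move=> x; apply: cvgB; first exact: cvg_cst.
by apply: cvgM; [exact: cvg_cst|exact: cvg_id].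
Qed.

Lemma continuous_mulr (y s : R) : continuous (fun w : R => y * (s * w)).
Proof.
move=> x; apply: cvgM; first exact: cvg_cst.
by apply: cvgM; [exact: cvg_cst|exact: cvg_id].
Qed.

Lemma continuous_mul_affine (y a s : R) : continuous (fun w => y * (a - s * w)).
Proof. by move=> x; apply: cvgM; [exact: cvg_cst|exact: continuous_affine]. Qed.

Lemma RI_cosB d s a y : integ d -> RI (fun w => d w * cos (y * (a - s * w))) =
  cos (y * a) * Fcos d s y + sin (y * a) * Fsin d s y.
Proof.
move=> di.
have ic := integ_cos_comp di (@continuous_mulr y s).
have is_ := integ_sin_comp di (@continuous_mulr y s).
rewrite /Fcos /Fsin -(RIZ (cos (y * a)) ic) -(RIZ (sin (y * a)) is_).
rewrite -(RID (integZ (cos (y * a)) ic) (integZ (sin (y * a)) is_)).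
by apply: RI_ext => w; rewrite mulrBr cosB; ring.
Qed.

Lemma RI_sinB d s a y : integ d -> RI (fun w => d w * sin (y * (a - s * w))) =
  sin (y * a) * Fcos d s y - cos (y * a) * Fsin d s y.
Proof.
move=> di.
have ic := integ_cos_comp di (@continuous_mulr y s).
have is_ := integ_sin_comp di (@continuous_mulr y s).
rewrite /Fcos /Fsin -(RIZ (sin (y * a)) ic) -(RIZ (cos (y * a)) is_).
rewrite -(RIB (integZ (sin (y * a)) ic) (integZ (cos (y * a)) is_)).
by apply: RI_ext => w; rewrite mulrBr sinB; ring.
Qed.

Lemma integ_conv s d K1 K2 a : integ d -> integ K1 -> integ K2 ->
  integ (fun w => d w * Finv K1 K2 (a - s * w)).
Proof.
move=> di i1 i2; apply: (integM di); last by move=> w; exact: Finv_bound.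
apply: measurableT_comp.
  by apply: continuous_measurable_fun; exact: continuous_Finv.
by apply: continuous_measurable_fun; exact: continuous_affine.
Qed.

Let integ0 : integ (fun _ : R => 0 : R).
Proof. exact: integrable0. Qed.

Let FinvRe K a : integ K -> Finv K (fun=> 0) a = RI (fun y => K y * cos (y * a)).
Proof. by move=> Ki; apply: RI_ext => y; rewrite mul0r subr0. Qed.

Let FinvIm K a : integ K -> Finv (fun=> 0) K a = - RI (fun y => K y * sin (y * a)).
Proof.
move=> Ki; rewrite -[RHS]mulN1r -(RIZ (-1) (integ_sin a Ki)).
by apply: RI_ext => y; rewrite mul0r sub0r mulN1r.
Qed.

(** Multiplying a kernel by the Fourier transform of [d] convolves its inverse transform with [d].
    The transform is written back as an integral over w, the trigonometric factors merge into those
    of y (a - s w) by the addition formulas, and the two integrals are exchanged, separately for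
    cosine and sine. *)
Lemma Finv_conv K1 K2 d s a : integ K1 -> integ K2 -> integ d ->
  Finv (KRe K1 K2 d s) (KIm K1 K2 d s) a = conv s d (Finv K1 K2) a.
Proof.
move=> i1 i2 di.
have mu0 : measurable_fun setT (fun p : R * R => p.1 * (a - s * p.2)).
  apply: measurable_funM => //; apply: measurable_funB => //.
  exact: measurable_funM.
have mc : measurable_fun setT (fun p : R * R => cos (p.1 * (a - s * p.2))).
  apply: measurableT_comp mu0.
  by apply: continuous_measurable_fun; exact: continuous_cos.
have ms : measurable_fun setT (fun p : R * R => sin (p.1 * (a - s * p.2))).
  apply: measurableT_comp mu0.
  by apply: continuous_measurable_fun; exact: continuous_sin.
have S1 := RI_swap i1 di mc (fun p => normr_cos _).
have S2 := RI_swap i2 di ms (fun p => normr_sin _).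
have P1 y : RI (fun w => K1 y * d w * cos (y * (a - s * w))) =
            K1 y * RI (fun w => d w * cos (y * (a - s * w))).
  rewrite -(RIZ (K1 y) (integ_cos_comp di (@continuous_mul_affine y a s))).
  by apply: RI_ext => w; rewrite mulrA.
have P2 y : RI (fun w => K2 y * d w * sin (y * (a - s * w))) =
            K2 y * RI (fun w => d w * sin (y * (a - s * w))).
  rewrite -(RIZ (K2 y) (integ_sin_comp di (@continuous_mul_affine y a s))).
  by apply: RI_ext => w; rewrite mulrA.
have bc : integ (fun y => RI (fun w => K1 y * d w * cos (y * (a - s * w)))).
  apply: (@integ_ext _ (fun y => K1 y * Fcos d s y * cos (y * a) + K1 y * Fsin d s y * sin (y * a))).
    by move=> y; rewrite P1 (RI_cosB s a y di) mulrDr -!mulrA [cos _ * _]mulrC [sin _ * _]mulrC.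
  apply: integD.
  - by apply: (@integ_cos (fun y => K1 y * Fcos d s y) a); exact: integ_mulFcos.
  - by apply: (@integ_sin (fun y => K1 y * Fsin d s y) a); exact: integ_mulFsin.
have bs : integ (fun y => RI (fun w => K2 y * d w * sin (y * (a - s * w)))).
  apply: (@integ_ext _ (fun y => K2 y * Fcos d s y * sin (y * a) - K2 y * Fsin d s y * cos (y * a))).
    by move=> y; rewrite P2 (RI_sinB s a y di) mulrBr -!mulrA [cos _ * _]mulrC [sin _ * _]mulrC.
  apply: integB.
  - by apply: (@integ_sin (fun y => K2 y * Fcos d s y) a); exact: integ_mulFcos.
  - by apply: (@integ_cos (fun y => K2 y * Fsin d s y) a); exact: integ_mulFsin.
transitivity (RI (fun y => RI (fun w => K1 y * d w * cos (y * (a - s * w)))) -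
              RI (fun y => RI (fun w => K2 y * d w * sin (y * (a - s * w))))).
  rewrite -(RIB bc bs); apply: RI_ext => y.
  rewrite P1 P2 (RI_cosB s a y di) (RI_sinB s a y di) /KRe /KIm.
  move: (Fcos d s y) (Fsin d s y) (cos _) (sin _) => *; ring.
have Q1 w : RI (fun y => K1 y * d w * cos (y * (a - s * w))) =
    d w * Finv K1 (fun=> 0) (a - s * w).
  rewrite (FinvRe _ i1) -(RIZ (d w) (integ_cos (a - s * w) i1)).
  by apply: RI_ext => y; rewrite mulrCA mulrA.
have Q2 w : RI (fun y => K2 y * d w * sin (y * (a - s * w))) =
    - (d w * Finv (fun=> 0) K2 (a - s * w)).
  rewrite (FinvIm _ i2) mulrN opprK -(RIZ (d w) (integ_sin (a - s * w) i2)).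
  by apply: RI_ext => y; rewrite mulrCA mulrA.
rewrite S1 S2 /= (RI_ext Q1) (RI_ext Q2).
have -> : RI (fun w => - (d w * Finv (fun=> 0) K2 (a - s * w))) =
  - RI (fun w => d w * Finv (fun=> 0) K2 (a - s * w)).
  rewrite -[RHS]mulN1r -(RIZ (-1) (integ_conv s a di integ0 i2)).
  by apply: RI_ext => w; rewrite mulN1r.
rewrite opprK -(RID (integ_conv s a di i1 integ0) (integ_conv s a di integ0 i2)).
apply: RI_ext => w; rewrite -mulrDr; congr (_ * _).
rewrite (FinvRe _ i1) (FinvIm _ i2).
by rewrite /Finv (RIB (integ_cos (a - s * w) i1) (integ_sin (a - s * w) i2)).
Qed.

End trigonometric_integrals.

(** * The Gaussian and its Fourier transform *)

Section gaussian.
Variable R : realType.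
Local Notation mu := (@lebesgue_measure R).
Implicit Types (x w a y : R).

Definition gauss x : R := expR (- (x ^+ 2) / 2).

Lemma gauss_gt0 x : 0 < gauss x. Proof. exact: expR_gt0. Qed.

Lemma gauss_le1 x : gauss x <= 1.
Proof. by rewrite -expR0 ler_expR mulNr oppr_le0 divr_ge0// sqr_ge0. Qed.

Lemma is_derive_gauss x : is_derive x 1 gauss (- x * gauss x).
Proof.
have h : is_derive x 1 (fun x : R => - (x ^+ 2) / 2) (- x).
  by apply: is_derive_eq; rewrite /GRing.scale/= !mulr1; lra.
by have := is_derive1_comp (is_derive_expR _) h; rewrite mulrC.
Qed.

Lemma continuous_gauss : continuous gauss.
Proof. exact: is_derive_continuous is_derive_gauss. Qed.

(** The inequality exp u >= 1 + u at u = x^2 / 4, squared. The square leaves room for the additional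
    factor |x| in [mul_gauss_bound]. *)
Lemma gauss_bound2 x : gauss x <= ((1 + x ^+ 2 / 4) ^+ 2)^-1.
Proof.
rewrite /gauss mulNr expRN lef_pV2 ?posrE ?expR_gt0//; last first.
  by rewrite exprn_gt0// ltr_wpDr// divr_ge0// sqr_ge0.
rewrite (_ : x ^+ 2 / 2 = x ^+ 2 / 4 * 2%:R); last by field.
rewrite expRM_natr lerXn2r ?nnegrE ?expR_ge0 ?expR_ge1Dx//.
by rewrite addr_ge0// divr_ge0// sqr_ge0.
Qed.

Lemma gauss_bound x : gauss x <= 16 * (1 + x ^+ 2)^-1.
Proof.
apply: le_trans (gauss_bound2 x) _.
have := sqr_ge0 x; set u := x ^+ 2 => u0.
rewrite -[16]invrK -invfM lef_pV2 ?posrE.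
- nra.
- by rewrite exprn_gt0//; lra.
- by rewrite mulr_gt0//; lra.
Qed.

Lemma mul_gauss_bound x : `|x| * gauss x <= 16 * (1 + x ^+ 2)^-1.
Proof.
apply: (@le_trans _ _ (`|x| * ((1 + x ^+ 2 / 4) ^+ 2)^-1)).
  by rewrite ler_wpM2l// gauss_bound2.
have x1 : `|x| <= 1 + x ^+ 2.
  by rewrite -(real_normK (num_real x)); have := sqr_ge0 (`|x| - 1); have := normr_ge0 x; nra.
have := sqr_ge0 x; move: x1; set u := x ^+ 2 => x1 u0.
rewrite ler_pdivrMr; last by rewrite exprn_gt0//; lra.
rewrite mulrAC ler_pdivlMr; last by lra.
have := normr_ge0 x; nra.
Qed.

Lemma integ_gauss : integ gauss.
Proof.
apply: (@integ_dom _ _ 16).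
  by apply: continuous_measurable_fun; exact: continuous_gauss.
by move=> x; rewrite ger0_norm ?gauss_bound// ltW// gauss_gt0.
Qed.

Lemma integ_mul_gauss : integ (fun x => x * gauss x).
Proof.
apply: (@integ_dom _ _ 16).
  apply: continuous_measurable_fun => x; apply: cvgM; first exact: cvg_id.
  exact: continuous_gauss.
move=> x; rewrite normrM (ger0_norm (ltW (gauss_gt0 x))).
exact: mul_gauss_bound.
Qed.

(* The phase [th] covers cosine and sine, hence also translates of the Gaussian. *)
Definition gaussF th a : R := RI (fun w => gauss w * cos (w * a + th)).

Let lin_continuous a th : continuous (fun w => w * a + th).
Proof.
move=> w; apply: cvgD; last exact: cvg_cst.
by apply: cvgM; [exact: cvg_id|exact: cvg_cst].
Qed.

(** Differentiating under the integral produces the factor w [gauss w], which is minus the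
    derivative of [gauss]; integrating by parts returns to [gaussF]. *)
Lemma is_derive_gaussF th a : is_derive a 1 (gaussF th) (- a * gaussF th a).
Proof.
pose f a w := gauss w * cos (w * a + th).
have igc x := integ_cos_comp integ_gauss (@lin_continuous x th).
have igs x := integ_sin_comp integ_mul_gauss (@lin_continuous x th).
have df x w : is_derive x 1 (f^~ w) (- (w * gauss w * sin (w * x + th))).
  have h : is_derive x 1 (fun x => w * x + th) w.
    by apply: is_derive_eq; rewrite /GRing.scale/=; ring.
  have h2 := is_derive1_comp (is_derive_cos _) h.
  apply: (is_derive_eq (is_deriveZ (gauss w) h2)).
  by rewrite /GRing.scale/=; ring.
have dfE x w : partial1of2 f x w = - (w * gauss w * sin (w * x + th)).
  by rewrite /partial1of2 derive1E; have := df x w => /@derive_val.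
have Ia : [set` `]a - 1, a + 1[ ] a by rewrite /= in_itv/=; apply/andP; split; lra.
have fi x : [set` `]a - 1, a + 1[ ] x -> mu.-integrable setT (EFin \o f x).
  by move=> _; exact: igc.
have fd x w : [set` `]a - 1, a + 1[ ] x -> setT w -> derivable (f^~ w) x 1.
  by move=> _ _; exact: (@ex_derive _ _ _ _ _ _ _ (df x w)).
have G0 w : 0 <= `|w * gauss w| by [].
have Gi : mu.-integrable setT (EFin \o (fun w => `|w * gauss w|)).
  exact: integ_abs integ_mul_gauss.
have fG x w : [set` `]a - 1, a + 1[ ] x -> setT w -> `|partial1of2 f x w| <= `|w * gauss w|.
  by move=> _ _; rewrite dfE normrN normrM ler_piMr// normr_sin.
apply: DeriveDef; first exact: (derivable_under_integral measurableT Ia fi fd G0 Gi fG).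
rewrite -derive1E (differentiation_under_integral measurableT Ia fi fd G0 Gi fG).
(* Integration by parts: this integrand is the derivative of [gauss w * sin (w * a + th)]. *)
have E0 : RI (fun w => a * (gauss w * cos (w * a + th)) - w * gauss w * sin (w * a + th)) = 0.
  have hD w : is_derive w 1 (fun w => gauss w * sin (w * a + th))
      (a * (gauss w * cos (w * a + th)) - w * gauss w * sin (w * a + th)).
    have h : is_derive w 1 (fun w => w * a + th) a.
      by apply: is_derive_eq; rewrite /GRing.scale/=; ring.
    have h2 := is_derive1_comp (is_derive_sin _) h.
    apply: (is_derive_eq (is_deriveM (is_derive_gauss w) h2)).
    by rewrite /GRing.scale/=; ring.
  have hc : continuous (fun w => a * (gauss w * cos (w * a + th)) - w * gauss w * sin (w * a + th)).
    move=> w; apply: cvgB; apply: cvgM.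
    + exact: cvg_cst.
    + apply: cvgM; first exact: continuous_gauss.
      by apply: continuous_comp; [exact: lin_continuous|exact: continuous_cos].
    + by apply: cvgM; [exact: cvg_id|exact: continuous_gauss].
    + by apply: continuous_comp; [exact: lin_continuous|exact: continuous_sin].
  have hi : integ (fun w => a * (gauss w * cos (w * a + th)) - w * gauss w * sin (w * a + th)).
    exact: integB (integZ a (igc a)) (igs a).
  have hb w : `|gauss w * sin (w * a + th)| <= 16 * (1 + w ^+ 2)^-1.
    rewrite normrM (ger0_norm (ltW (gauss_gt0 w))).
    apply: le_trans (gauss_bound w); rewrite ler_piMr ?normr_sin//.
    exact: ltW (gauss_gt0 w).
  exact: (RI_derive0 hD hc hi hb).
move: E0; rewrite (RIB (integZ a (igc a)) (igs a)) (RIZ a (igc a)) => /eqP.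
rewrite subr_eq0 => /eqP E0; rewrite mulNr E0 -[RHS]mulN1r -(RIZ (-1) (igs a)).
by apply: RI_ext => w; rewrite dfE mulN1r.
Qed.

(** By the differential equation, [gaussF th a] times exp (a^2 / 2) has derivative 0 and keeps its
    value at a = 0. *)
Lemma gaussFE th a : gaussF th a = cos th * RI gauss * gauss a.
Proof.
pose H x := gaussF th x * expR (x ^+ 2 / 2).
have dH x : is_derive x 1 H 0.
  have h : is_derive x 1 (fun x : R => (x ^+ 2) / 2) x.
    by apply: is_derive_eq; rewrite /GRing.scale/= !mulr1; lra.
  have h2 := is_derive1_comp (is_derive_expR _) h.
  apply: (is_derive_eq (is_deriveM (is_derive_gaussF th x) h2)).
  by rewrite /GRing.scale/=; ring.
have := is_derive_0_is_cst a 0 dH.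
rewrite /H expr0n/= mul0r expR0 mulr1 => E.
have -> : cos th * RI gauss = gaussF th 0.
  rewrite -(RIZ _ integ_gauss); apply: RI_ext => w.
  by rewrite mulr0 add0r mulrC.
by rewrite -E -mulrA /gauss mulNr expRN divff ?mulr1// gt_eqF// expR_gt0.
Qed.

Lemma RI_gauss_gt0 : 0 < RI gauss.
Proof.
pose l x : R := expR (- 2^-1) * \1_`[0, 1] x.
have i1 : integ (\1_`[0, 1] : R -> R) by exact: integrable_indic_itv.
have il : integ l by exact: integZ.
apply: (@lt_le_trans _ _ (RI l)).
  rewrite /l RIZ//.
  rewrite mulr_gt0 ?expR_gt0// /RI /Rintegral integral_indic// setIT.
  have E : (mu `[0, 1]%classic = 1%E) by rewrite lebesgue_measure_itv/= lte_fin ltr01 -EFinB subr0.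
  by change (0 < fine (mu `[0, 1]%classic)); rewrite E.
apply: RI_le => //; first exact: integ_gauss.
move=> x; rewrite /l indicE.
have [/set_mem/=|_] := boolP (x \in _); last by rewrite mulr0 expR_ge0.
rewrite in_itv/= => /andP[x0 x1]; rewrite mulr1 ler_expR; nra.
Qed.

End gaussian.

(** * The Gamma function on vertical lines *)

Section gamma_density.
Variable R : realType.
Implicit Types (p q r w y s : R).

(** With u = k |w| / 2, exp (2 u) >= (1 + u)^2 >= 1 + u^2, and (1 + u^2)(1 + 4 / k^2) >= 1 + w^2. *)
Lemma expR_abs_bound (k : R) w : 0 < k ->
  expR (- (k * `|w|)) <= (1 + 4 / k ^+ 2) * (1 + w ^+ 2)^-1.
Proof.
move=> k0; rewrite expRN ler_pdivlMr; last by rewrite ltr_wpDr// sqr_ge0.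
rewrite ler_pdivrMl ?expR_gt0//.
have -> : k * `|w| = (k * `|w| / 2) * 2%:R by field.
rewrite expRM_natr.
have u0 : 0 <= k * `|w| / 2 by rewrite divr_ge0// mulr_ge0// ltW.
apply: (@le_trans _ _ ((1 + (k * `|w| / 2) ^+ 2) * (1 + 4 / k ^+ 2))).
  rewrite -(real_normK (num_real w)) (_ : (k * `|w| / 2) ^+ 2 = k ^+ 2 * `|w| ^+ 2 / 4); last by field.
  have k2 : 0 < k ^+ 2 by rewrite exprn_gt0.
  have : (1 + k ^+ 2 * `|w| ^+ 2 / 4) * (1 + 4 / k ^+ 2) =
      1 + `|w| ^+ 2 + (k ^+ 2 * `|w| ^+ 2 / 4 + 4 / k ^+ 2).
    by field; rewrite gt_eqF.
  move=> ->; rewrite lerDl addr_ge0//; last by rewrite divr_ge0// ltW.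
  by rewrite divr_ge0// mulr_ge0 ?sqr_ge0.
rewrite ler_wpM2r//; first by rewrite addr_ge0// divr_ge0// sqr_ge0.
apply: (@le_trans _ _ ((1 + k * `|w| / 2) ^+ 2)).
  move: u0; set u := k * `|w| / 2 => u0; nra.
by rewrite lerXn2r ?nnegrE ?expR_ge0 ?expR_ge1Dx// addr_ge0.
Qed.

(** The concave function l w - exp w has its maximum at w = ln l. *)
Lemma mul_sub_expR_le (l w : R) : 0 < l -> l * w - expR w <= l * (ln l - 1).
Proof.
move=> l0; have := expR_ge1Dx (w - ln l).
rewrite expRB lnK ?posrE// ler_pdivlMr// => h.
rewrite mulrC; nra.
Qed.

(* The integrand [u^(p-1) exp(-u) du] of [Gamma p] in the variable [w = ln u]. *)
Definition gamma_dens p w : R := expR (p * w - expR w).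

Lemma gamma_dens_gt0 p w : 0 < gamma_dens p w. Proof. exact: expR_gt0. Qed.

Lemma gamma_densM p q w : gamma_dens p w * expR (q * w) = gamma_dens (p + q) w.
Proof. by rewrite /gamma_dens -expRD mulrDl; congr expR; ring. Qed.

Lemma gamma_densS p w : gamma_dens p w * expR w = gamma_dens (p + 1) w.
Proof. by rewrite -gamma_densM mul1r. Qed.

Lemma is_derive_gamma_dens p w :
  is_derive w 1 (gamma_dens p) (p * gamma_dens p w - gamma_dens (p + 1) w).
Proof.
have h : is_derive w 1 (fun w => p * w - expR w) (p - expR w).
  by apply: is_derive_eq; rewrite /GRing.scale/=; ring.
apply: (is_derive_eq (is_derive1_comp (is_derive_expR _) h)).
rewrite -gamma_densS /gamma_dens; ring.
Qed.

Lemma continuous_gamma_dens p : continuous (gamma_dens p).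
Proof. exact: is_derive_continuous (is_derive_gamma_dens p). Qed.

(** The exponent p w - exp w is at most a constant minus p |w| / 2: the maximum of l w - exp w is
    used with l = 3 p / 2 for w >= 0 and with l = p / 2 for w < 0. *)
Lemma gamma_dens_bound p : 0 < p ->
  exists C, forall w, gamma_dens p w <= C * (1 + w ^+ 2)^-1.
Proof.
move=> p0; pose C1 := expR (p * (3 / 2) * (ln (p * (3 / 2)) - 1)).
pose C2 := expR (p * (1 / 2) * (ln (p * (1 / 2)) - 1)).
exists ((C1 + C2) * (1 + 4 / (p / 2) ^+ 2)) => w.
have p2 : 0 < p / 2 by rewrite divr_gt0.
rewrite -mulrA; apply: le_trans; last first.
  apply: ler_wpM2l; first by rewrite addr_ge0// expR_ge0.
  exact: expR_abs_bound p2.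
have [w0|w0] := leP 0 w.
  apply: (@le_trans _ _ (C1 * expR (- (p / 2 * w)))).
    rewrite -expRD ler_expR.
    have h : 0 < p * (3 / 2) by lra.
    by have := mul_sub_expR_le w h; lra.
  by rewrite ger0_norm// ler_wpM2r ?expR_ge0// lerDl expR_ge0.
apply: (@le_trans _ _ (C2 * expR (- (p / 2 * - w)))).
  rewrite -expRD ler_expR.
  have h : 0 < p * (1 / 2) by lra.
  by have := mul_sub_expR_le w h; lra.
by rewrite ltr0_norm// ler_wpM2r ?expR_ge0// lerDr expR_ge0.
Qed.

Lemma integ_gamma_dens p : 0 < p -> integ (gamma_dens p).
Proof.
move=> /gamma_dens_bound[C hC]; apply: (@integ_dom _ _ C).
  by apply: continuous_measurable_fun; exact: continuous_gamma_dens.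
by move=> w; rewrite ger0_norm ?hC// ltW// gamma_dens_gt0.
Qed.

Lemma is_derive_cos_lin y w :
  is_derive w 1 (fun w => cos (y * (1 * w))) (- (y * sin (y * (1 * w)))).
Proof.
have h : is_derive w 1 (fun w => y * (1 * w)) y.
  by apply: is_derive_eq; rewrite /GRing.scale/=; ring.
apply: (is_derive_eq (is_derive1_comp (is_derive_cos _) h)).
by rewrite mulNr mulrC.
Qed.

Lemma is_derive_sin_lin y w :
  is_derive w 1 (fun w => sin (y * (1 * w))) (y * cos (y * (1 * w))).
Proof.
have h : is_derive w 1 (fun w => y * (1 * w)) y.
  by apply: is_derive_eq; rewrite /GRing.scale/=; ring.
apply: (is_derive_eq (is_derive1_comp (is_derive_sin _) h)).
by rewrite mulrC.
Qed.

Lemma continuous_cos_lin y s : continuous (fun w => cos (y * (s * w))).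
Proof.
move=> w; apply: continuous_comp; first exact: continuous_mulr.
exact: continuous_cos.
Qed.

Lemma continuous_sin_lin y s : continuous (fun w => sin (y * (s * w))).
Proof.
move=> w; apply: continuous_comp; first exact: continuous_mulr.
exact: continuous_sin.
Qed.

Let ic p y : 0 < p -> integ (fun w => gamma_dens p w * cos (y * (1 * w))).
Proof.
by move=> p0; apply: integ_cos_comp (integ_gamma_dens p0) _; exact: continuous_mulr.
Qed.

Let is_ p y : 0 < p -> integ (fun w => gamma_dens p w * sin (y * (1 * w))).
Proof.
by move=> p0; apply: integ_sin_comp (integ_gamma_dens p0) _; exact: continuous_mulr.
Qed.

(** Real part of Gamma(z + 1) = z Gamma(z) at z = p - i y, by integrating the derivative of [F],
    which vanishes at both ends. [Fsin_gammaS] is the imaginary part. *)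
Lemma Fcos_gammaS p y : 0 < p -> Fcos (gamma_dens (p + 1)) 1 y =
  p * Fcos (gamma_dens p) 1 y - y * Fsin (gamma_dens p) 1 y.
Proof.
move=> p0; have p1 : 0 < p + 1 by rewrite addr_gt0.
have [C hC] := gamma_dens_bound p0.
pose F w := gamma_dens p w * cos (y * (1 * w)).
pose f w := p * (gamma_dens p w * cos (y * (1 * w))) -
  gamma_dens (p + 1) w * cos (y * (1 * w)) -
  y * (gamma_dens p w * sin (y * (1 * w))).
have hD w : is_derive w 1 F (f w).
  apply: (is_derive_eq (is_deriveM (is_derive_gamma_dens p w) (is_derive_cos_lin y w))).
  by rewrite /f /GRing.scale/=; ring.
have hc : continuous f.
  move=> w; apply: cvgB; [apply: cvgB|]; apply: cvgM; try exact: cvg_cst.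
  - by apply: cvgM; [exact: continuous_gamma_dens|exact: continuous_cos_lin].
  - exact: continuous_gamma_dens.
  - exact: continuous_cos_lin.
  - by apply: cvgM; [exact: continuous_gamma_dens|exact: continuous_sin_lin].
have i1 := integZ p (ic y p0); have i2 := ic y p1; have i3 := integZ y (is_ y p0).
have hi : integ f by exact: integB (integB i1 i2) i3.
have hb w : `|F w| <= C * (1 + w ^+ 2)^-1.
  apply: le_trans (hC w); rewrite /F normrM (ger0_norm (ltW (gamma_dens_gt0 p w))).
  by rewrite ler_piMr ?normr_cos// ltW// gamma_dens_gt0.
have := RI_derive0 hD hc hi hb.
rewrite /f (RIB (integB i1 i2) i3) (RIB i1 i2) (RIZ p (ic y p0)) (RIZ y (is_ y p0)).
move=> /eqP; rewrite subr_eq0 subr_eq addrC -subr_eq => /eqP h.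
by rewrite /Fcos /Fsin -h.
Qed.

Lemma Fsin_gammaS p y : 0 < p -> Fsin (gamma_dens (p + 1)) 1 y =
  p * Fsin (gamma_dens p) 1 y + y * Fcos (gamma_dens p) 1 y.
Proof.
move=> p0; have p1 : 0 < p + 1 by rewrite addr_gt0.
have [C hC] := gamma_dens_bound p0.
pose F w := gamma_dens p w * sin (y * (1 * w)).
pose f w := p * (gamma_dens p w * sin (y * (1 * w))) -
  gamma_dens (p + 1) w * sin (y * (1 * w)) +
  y * (gamma_dens p w * cos (y * (1 * w))).
have hD w : is_derive w 1 F (f w).
  apply: (is_derive_eq (is_deriveM (is_derive_gamma_dens p w) (is_derive_sin_lin y w))).
  by rewrite /f /GRing.scale/=; ring.
have hc : continuous f.
  move=> w; apply: cvgD; [apply: cvgB|]; apply: cvgM; try exact: cvg_cst.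
  - by apply: cvgM; [exact: continuous_gamma_dens|exact: continuous_sin_lin].
  - exact: continuous_gamma_dens.
  - exact: continuous_sin_lin.
  - by apply: cvgM; [exact: continuous_gamma_dens|exact: continuous_cos_lin].
have i1 := integZ p (is_ y p0); have i2 := is_ y p1; have i3 := integZ y (ic y p0).
have hi : integ f by exact: integD (integB i1 i2) i3.
have hb w : `|F w| <= C * (1 + w ^+ 2)^-1.
  apply: le_trans (hC w); rewrite /F normrM (ger0_norm (ltW (gamma_dens_gt0 p w))).
  by rewrite ler_piMr ?normr_sin// ltW// gamma_dens_gt0.
have := RI_derive0 hD hc hi hb.
rewrite /f (RID (integB i1 i2) i3) (RIB i1 i2) (RIZ p (is_ y p0)) (RIZ y (ic y p0)).
rewrite addrAC => /eqP; rewrite subr_eq0 => /eqP h.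
by rewrite /Fcos /Fsin h.
Qed.

(** The squared modulus of Gamma(p - i y). *)
Definition gamma_sqnorm p y :=
  Fcos (gamma_dens p) 1 y ^+ 2 + Fsin (gamma_dens p) 1 y ^+ 2.

Lemma gamma_sqnormS p y : 0 < p ->
  gamma_sqnorm (p + 1) y = (p ^+ 2 + y ^+ 2) * gamma_sqnorm p y.
Proof.
move=> p0; rewrite /gamma_sqnorm (Fcos_gammaS y p0) (Fsin_gammaS y p0).
by move: (Fcos _ _ _) (Fsin _ _ _) => a b; ring.
Qed.

Lemma gamma_mean_gt0 p : 0 < p -> 0 < RI (gamma_dens p).
Proof.
move=> p0; have i1 : integ (\1_`[0, 1] : R -> R) by exact: integrable_indic_itv.
pose l w : R := expR (- expR 1) * \1_`[0, 1] w.
have il : integ l by exact: integZ.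
apply: (@lt_le_trans _ _ (RI l)).
  rewrite /l (RIZ _ i1) mulr_gt0 ?expR_gt0// /RI /Rintegral integral_indic// setIT.
  have E : (@lebesgue_measure R `[0, 1]%classic = 1%E).
    by rewrite lebesgue_measure_itv/= lte_fin ltr01 -EFinB subr0.
  by change (0 < fine (@lebesgue_measure R `[0, 1]%classic)); rewrite E.
apply: RI_le => //; first exact: integ_gamma_dens.
move=> w; rewrite /l indicE.
have [/set_mem/=|_] := boolP (w \in _); last by rewrite mulr0 ltW// gamma_dens_gt0.
rewrite in_itv/= => /andP[w0 w1]; rewrite mulr1 ler_expR.
have := mulr_ge0 (ltW p0) w0; have : expR w <= expR 1 by rewrite ler_expR.
lra.
Qed.

Lemma gamma_meanS p : 0 < p -> RI (gamma_dens (p + 1)) = p * RI (gamma_dens p).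
Proof.
move=> p0; have E q : Fcos (gamma_dens q) 1 0 = RI (gamma_dens q).
  by apply: RI_ext => w; rewrite mul0r cos0 mulr1.
by rewrite -!E (Fcos_gammaS 0 p0) mul0r subr0.
Qed.

(** For x > 0 the mean value theorem gives cos x >= 1 - x, and 1 - x exceeds the right-hand
    quadratic by (x - 1)^2 / 2 below; the case x < 0 follows by parity. *)
Lemma cos_ge_quad (x : R) : 1 / 2 - x ^+ 2 / 2 <= cos x.
Proof.
wlog x0 : x / 0 < x.
  move=> H; have [x0|x0|->] := ltgtP x 0; [|exact: H|].
    by rewrite -cosN -sqrrN; apply: H; rewrite oppr_gt0.
  by rewrite expr0n/= mul0r subr0 cos0; lra.
have [c _ Hc] := @MVT R cos (fun z => - sin z) 0 x x0 (fun z _ => is_derive_cos z)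
  (continuous_subspaceT (@continuous_cos R)).
have := sin_le1 c; have := sin_geN1 c; move: Hc; rewrite cos0 subr0 => /eqP.
rewrite subr_eq => /eqP ->; have := sqr_ge0 (x - 1); nra.
Qed.

(** With h = x / 2 >= 0 the bracket is the square of exp h - exp (- h), which is at least h. The
    bound turns a square of w - ln m into exponentials of w, whose integrals against a gamma density
    are again Gamma values. *)
Lemma sqr_le_expR (x : R) : x ^+ 2 <= 4 * (expR x - 2 + expR (- x)).
Proof.
wlog x0 : x / 0 <= x.
  move=> H; have [|/ltW x0] := leP 0 x; first exact: H.
  by have := H (- x); rewrite oppr_ge0 sqrrN opprK addrAC => /(_ x0); lra.
pose h := x / 2; have h0 : 0 <= h by rewrite divr_ge0.
have Ex : x = h * 2%:R by rewrite /h; field.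
rewrite Ex -mulNr !expRM_natr expRN.
have := expR_ge1Dx h; set e := expR h => e1.
have e0 : 0 < e by rewrite expR_gt0.
have -> : e ^+ 2 - 2 + e^-1 ^+ 2 = (e - e^-1) ^+ 2.
  by field; rewrite gt_eqF.
have : h <= e - e^-1.
  have : e^-1 <= 1 by rewrite invf_le1//; lra.
  lra.
move=> hh; have := lerXn2r; move=> /(_ _ 2 h (e - e^-1)).
rewrite !nnegrE h0 => /(_ isT (le_trans h0 hh) hh); lra.
Qed.

(* For large n the normalized density gamma_dens (p + n) concentrates around
   ln (p + n), so its Fourier transform cannot vanish; the functional equation
   carries this back to p. *)
Lemma gamma_sqnorm_gt0 p y : 0 < p -> 0 < gamma_sqnorm p y.
Proof.
move=> p0; rewrite lt_def addr_ge0 ?sqr_ge0// andbT; apply/eqP => N0.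
have Nn n : gamma_sqnorm (p + n%:R) y = 0.
  elim: n => [|n IH]; first by rewrite addr0.
  by rewrite -natr1 addrA gamma_sqnormS ?IH ?mulr0// ltr_wpDr.
(* n is large enough that q > 4 y^2, that is q / 2 > k for the [k] below; this is what the final
   inequality contradicts. *)
pose n := Num.truncn (4 * y ^+ 2 + 1); pose q := p + n%:R.
have q0 : 0 < q by rewrite ltr_wpDr.
have qy : 4 * y ^+ 2 < q.
  have := truncnS_gt (4 * y ^+ 2 + 1); rewrite -/n -natr1 /q; lra.
pose m := q + 1; have m0 : 0 < m by rewrite addr_gt0.
have : gamma_sqnorm m y = 0 by rewrite /m gamma_sqnormS// Nn mulr0.
move=> /eqP; rewrite paddr_eq0 ?sqr_ge0// !sqrf_eq0 => /andP[/eqP C0 /eqP S0].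
(* If the transform vanishes at y, so does the cosine integral with any phase; the phase y ln m
   centres the cosine at ln m, where [gamma_dens m] is largest. *)
have := RI_cosB 1 (ln m) y (integ_gamma_dens m0).
rewrite C0 S0 !mulr0 addr0 => E0.
have m1 : 0 < m + 1 by rewrite addr_gt0.
have im := integ_gamma_dens m0; have im1 := integ_gamma_dens m1.
have iq := integ_gamma_dens q0.
pose k := 2 * y ^+ 2.
(* The quadratic lower bound of the cosine, multiplied by [gamma_dens m]. The factors exp w / m and
   m / exp w shift the parameter to m + 1 and to m - 1 = q, so the integral is explicit. *)
pose low w := (1 / 2 + 2 * k) * gamma_dens m w - (k / m) * gamma_dens (m + 1) w
  - (k * m) * gamma_dens q w.
have ilow : integ low by exact: integB (integB (integZ _ im) (integZ _ im1)) (integZ _ iq).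
have : RI low <= RI (fun w => gamma_dens m w * cos (y * (ln m - 1 * w))).
  apply: RI_le => //.
    by apply: integ_cos_comp => //; exact: continuous_mul_affine.
  move=> w; apply: (@le_trans _ _ (gamma_dens m w * (1 / 2 - (y * (ln m - 1 * w)) ^+ 2 / 2))).
    2: by apply: ler_wpM2l; [exact: ltW (gamma_dens_gt0 m w)|exact: cos_ge_quad].
  have := sqr_le_expR (w - ln m); rewrite opprB 2!expRB lnK ?posrE// => hx.
  have Eq : gamma_dens q w = gamma_dens m w / expR w.
    by rewrite -gamma_densS mulfK// gt_eqF// expR_gt0.
  have -> : low w = gamma_dens m w * (1 / 2 - k * (expR w / m - 2 + m / expR w)).
    rewrite /low Eq -gamma_densS; have := expR_gt0 w; have := m0.
    move: (gamma_dens m w) (expR w) => a b h1 h2; field.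
    by rewrite !gt_eqF.
  apply: ler_wpM2l; first exact: ltW (gamma_dens_gt0 m w).
  rewrite [1 * w]mul1r (_ : (y * (ln m - w)) ^+ 2 = y ^+ 2 * (w - ln m) ^+ 2); last by ring.
  move: hx; rewrite /k; set A := expR w / m - 2 + _; set B := (w - ln m) ^+ 2.
  by move=> hx; have := ler_wpM2l (sqr_ge0 y) hx; lra.
rewrite E0 /low (RIB (integB (integZ _ im) (integZ _ im1)) (integZ _ iq)).
rewrite (RIB (integZ _ im) (integZ _ im1)) !RIZ// (gamma_meanS m0).
have G0 := gamma_mean_gt0 q0.
rewrite {1 2}/m (gamma_meanS q0) -/m => hle.
have : (1 / 2 + 2 * k) * (q * RI (gamma_dens q)) -
    k / m * (m * (q * RI (gamma_dens q))) - k * m * RI (gamma_dens q) =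
    RI (gamma_dens q) * (q / 2 - k).
  by rewrite /m; field; rewrite gt_eqF.
move=> E; move: hle; rewrite E pmulr_rle0// /k; lra.
Qed.

Lemma gamma_sqnorm_bound p : 0 < p ->
  exists2 C, 0 <= C & forall y, gamma_sqnorm p y <= (C * (1 + y ^+ 2)^-1) ^+ 2.
Proof.
move=> p0; have p1 : 0 < p + 1 by rewrite addr_gt0.
have p2 : 0 < p + 1 + 1 by rewrite addr_gt0.
pose B := RI (fun w => `|gamma_dens (p + 1 + 1) w|).
have B0 : 0 <= B by exact: RI_ge0.
have i2 := integ_gamma_dens p2.
have hB y : gamma_sqnorm (p + 1 + 1) y <= 2 * B ^+ 2.
  rewrite /gamma_sqnorm -(real_normK (num_real (Fcos _ _ _))).
  rewrite -(real_normK (num_real (Fsin _ _ _))).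
  have := Fcos_bound 1 y i2; have := Fsin_bound 1 y i2; rewrite -/B.
  move: (Fcos _ _ _) (Fsin _ _ _) => a b hb ha.
  have := normr_ge0 a; have := normr_ge0 b; nra.
(* A single constant for which e^2 (1 + y^2) bounds from below both factors p^2 + y^2 and (p + 1)^2
   + y^2 of the functional equation. *)
pose e := Num.min 1 p; have e0 : 0 < e by rewrite lt_min ltr01.
have e1 : e <= 1 by rewrite ge_min lexx.
have ep : e <= p by rewrite ge_min lexx orbT.
have e2 : e ^+ 2 <= 1 by rewrite exprn_ile1// ltW.
have He q y : p <= q -> e ^+ 2 * (1 + y ^+ 2) <= q ^+ 2 + y ^+ 2.
  move=> pq; rewrite mulrDr mulr1 lerD//.
    by rewrite lerXn2r ?nnegrE ?(le_trans ep)// ?ltW// (lt_le_trans e0)// (le_trans ep).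
  by rewrite ler_piMl// sqr_ge0.
exists (2 * B / e ^+ 2); first by rewrite divr_ge0 ?sqr_ge0// mulr_ge0.
move=> y; have := hB y; rewrite (gamma_sqnormS _ p1) (gamma_sqnormS _ p0) => h.
have ee : 0 < e ^+ 2 by rewrite exprn_gt0.
have y1 : 0 < 1 + y ^+ 2 by rewrite ltr_wpDr// sqr_ge0.
rewrite -(mulrA (2 * B)) -invfM (mulrC (e ^+ 2)) exprMn exprVn.
rewrite ler_pdivlMr ?exprn_gt0 ?mulr_gt0//.
apply: (@le_trans _ _ (2 * B ^+ 2)); last by have := sqr_ge0 B; nra.
apply: le_trans h; rewrite [leRHS]mulrA [leLHS]mulrC ler_wpM2r ?addr_ge0 ?sqr_ge0//.
have ey := mulr_ge0 (ltW ee) (ltW y1).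
rewrite expr2 (mulrC (1 + y ^+ 2)); apply: ler_pM => //; last exact: He.
by apply: He; rewrite lerDl.
Qed.

Lemma Fgamma_bound p : 0 < p -> exists C, forall y,
  `|Fcos (gamma_dens p) 1 y| <= C * (1 + y ^+ 2)^-1 /\
  `|Fsin (gamma_dens p) 1 y| <= C * (1 + y ^+ 2)^-1.
Proof.
move=> /gamma_sqnorm_bound[C C0 hC]; exists C => y.
have h0 : 0 <= C * (1 + y ^+ 2)^-1 by rewrite mulr_ge0// invr_ge0 addr_ge0// sqr_ge0.
have H a b : a ^+ 2 + b ^+ 2 <= (C * (1 + y ^+ 2)^-1) ^+ 2 -> `|a| <= C * (1 + y ^+ 2)^-1.
  move=> h; rewrite -(ger0_norm h0) -ler_sqr ?nnegrE// !real_normK ?num_real//.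
  by apply: le_trans h; rewrite lerDl sqr_ge0.
split; first exact: H (hC y).
by apply: (H _ (Fcos (gamma_dens p) 1 y)); rewrite addrC; exact: hC.
Qed.

End gamma_density.

(** * The power density on (0, 1] and its Fourier transform *)

Section power_density.
Variable R : realType.
Local Notation mu := (@lebesgue_measure R).
Implicit Types (p w y s : R).

(* The integrand [u^(p-1) du] of [1 / p] on (0, 1] in the variable [w = ln u]. *)
Definition power_dens p w : R := if w <= 0 then expR (p * w) else 0.

Lemma power_dens_ge0 p w : 0 <= power_dens p w.
Proof. by rewrite /power_dens; case: ifP => // _; exact: expR_ge0. Qed.

Lemma power_densE p : power_dens p = (fun w => expR (p * w)) \_ `]-oo, 0].
Proof.
apply/funext => w; rewrite /power_dens patchE; case: ifPn => w0.
  by rewrite mem_set//= in_itv.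
by rewrite memNset//= in_itv/=; exact/negP.
Qed.

Lemma continuous_expR_lin p : continuous (fun w => expR (p * w)).
Proof.
move=> w; apply: continuous_comp; last exact: continuous_expR.
by apply: cvgM; [exact: cvg_cst|exact: cvg_id].
Qed.

Lemma expR_lin_bound p w : 0 < p -> w <= 0 ->
  expR (p * w) <= (1 + 4 / p ^+ 2) * (1 + w ^+ 2)^-1.
Proof.
move=> p0 w0; rewrite (_ : p * w = - (p * `|w|)); first exact: expR_abs_bound.
by rewrite ler0_norm// mulrN opprK.
Qed.

Lemma integ_power_dens p : 0 < p -> integ (power_dens p).
Proof.
move=> p0; apply: (@integ_dom _ _ (1 + 4 / p ^+ 2)).
  rewrite power_densE; apply/(measurable_restrictT _ _).1; first exact: measurable_itv.
  by apply: measurable_funTS; apply: continuous_measurable_fun; exact: continuous_expR_lin.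
move=> w; rewrite ger0_norm ?power_dens_ge0// /power_dens; case: ifPn => w0.
  exact: expR_lin_bound.
by rewrite mulr_ge0 ?invr_ge0 ?addr_ge0 ?divr_ge0 ?sqr_ge0.
Qed.

Lemma power_densM p q w : power_dens p w * expR (q * w) = power_dens (p + q) w.
Proof.
by rewrite /power_dens; case: ifP => _; rewrite ?mul0r// -expRD mulrDl.
Qed.

(** [expR (p * w) * F w] is a primitive that vanishes at minus infinity, so the integral is its
    value at 0. The bound [B] on [h] gives integrability, that on [F] the decay of the primitive. *)
Lemma RI_power_dens_primitive p (h F : R -> R) B : 0 < p -> continuous h ->
  (forall w : R, is_derive w 1 (fun w => expR (p * w) * F w) (expR (p * w) * h w)) ->
  (forall w, `|F w| <= B) -> (forall w, `|h w| <= B) ->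
  RI (fun w => power_dens p w * h w) = F 0.
Proof.
move=> p0 ch dF FB hB.
have B0 : 0 <= B by rewrite (le_trans _ (hB 0)).
have E : (fun w => power_dens p w * h w) = (fun w => expR (p * w) * h w) \_ `]-oo, 0].
  by apply/funext => w; rewrite power_densE !patchE; case: ifP; rewrite ?mul0r.
have i : integ (fun w => power_dens p w * h w).
  by apply: integM (integ_power_dens p0) _ hB; exact: continuous_measurable_fun.
rewrite /RI E -Rintegral_mkcond.
have hc : continuous (fun w => expR (p * w) * h w).
  by move=> w; apply: cvgM; [exact: continuous_expR_lin|exact: ch].
have hi : mu.-integrable `]-oo, 0] (EFin \o (fun w => expR (p * w) * h w)).
  apply/integrable_mkcond; first exact: measurable_itv.
  by move: i; rewrite /integ E restrict_EFin.
have hb w : w <= 0 -> `|expR (p * w) * F w| <= (1 + 4 / p ^+ 2) * B * (1 + w ^+ 2)^-1.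
  move=> w0; rewrite normrM (ger0_norm (expR_ge0 _)) mulrAC.
  by apply: ler_pM => //; exact: expR_lin_bound.
by rewrite (RI_deriveNy dF hc hi hb) mulr0 expR0 mul1r.
Qed.

Lemma is_derive_expR_lin p w : is_derive w 1 (fun w => expR (p * w)) (p * expR (p * w)).
Proof.
have h : is_derive w 1 (fun w => p * w) p.
  by apply: is_derive_eq; rewrite /GRing.scale/=; ring.
by apply: (is_derive_eq (is_derive1_comp (is_derive_expR _) h)); rewrite mulrC.
Qed.

(** The summand 1 is slack: the same constant must also majorize the cosine or the sine itself in
    [RI_power_dens_primitive]. *)
Lemma power_trig_bound p y (a b : R) : 0 < p -> `|a| <= 1 -> `|b| <= 1 ->
  `|(p * a + y * b) / (p ^+ 2 + y ^+ 2)| <= 1 + (p + `|y|) / (p ^+ 2 + y ^+ 2).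
Proof.
move=> p0 ha hb; have d0 : 0 < p ^+ 2 + y ^+ 2 by rewrite ltr_wpDr ?sqr_ge0 ?exprn_gt0.
rewrite normrM normfV (gtr0_norm d0).
apply: (@le_trans _ _ ((p + `|y|) / (p ^+ 2 + y ^+ 2))); last by rewrite lerDr.
apply: ler_wpM2r; first by rewrite invr_ge0 ltW.
apply: le_trans (ler_normD _ _) _; rewrite !normrM (gtr0_norm p0).
by apply: lerD; apply: ler_piMr => //; exact: ltW.
Qed.

Lemma Fcos_power p y : 0 < p -> Fcos (power_dens p) 1 y = p / (p ^+ 2 + y ^+ 2).
Proof.
move=> p0; have d0 : 0 < p ^+ 2 + y ^+ 2 by rewrite ltr_wpDr ?sqr_ge0 ?exprn_gt0.
pose F w := (p * cos (y * (1 * w)) + y * sin (y * (1 * w))) / (p ^+ 2 + y ^+ 2).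
have -> : p / (p ^+ 2 + y ^+ 2) = F 0 by rewrite /F !mulr0 cos0 sin0 mulr0 mulr1 addr0.
apply: (@RI_power_dens_primitive _ _ _ (1 + (p + `|y|) / (p ^+ 2 + y ^+ 2)) p0).
- exact: continuous_cos_lin.
- move=> w.
  have h1 := is_deriveZ p (is_derive_cos_lin y w).
  have h2 := is_deriveZ y (is_derive_sin_lin y w).
  have h3 := is_deriveZ (p ^+ 2 + y ^+ 2)^-1 (is_deriveD h1 h2).
  have h4 : is_derive w 1 F ((p ^+ 2 + y ^+ 2)^-1 *
     (p * (- (y * sin (y * (1 * w)))) + y * (y * cos (y * (1 * w))))).
    rewrite (_ : F = (p ^+ 2 + y ^+ 2)^-1 \*: (p \*: (fun w => cos (y * (1 * w))) +
       y \*: (fun w => sin (y * (1 * w))))) //.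
    by apply/funext => z; rewrite /F mulrC.
  apply: (is_derive_eq (is_deriveM (is_derive_expR_lin p w) h4)).
  rewrite /GRing.scale/= /F; move: (cos _) (sin _) (expR _) => c s e.
  by field; rewrite gt_eqF.
- by move=> w; apply: power_trig_bound => //; [exact: normr_cos|exact: normr_sin].
- move=> w; apply: le_trans (normr_cos _) _; rewrite lerDl.
  by rewrite divr_ge0 ?addr_ge0 ?sqr_ge0// ltW.
Qed.

Lemma Fsin_power p y : 0 < p -> Fsin (power_dens p) 1 y = - (y / (p ^+ 2 + y ^+ 2)).
Proof.
move=> p0; have d0 : 0 < p ^+ 2 + y ^+ 2 by rewrite ltr_wpDr ?sqr_ge0 ?exprn_gt0.
pose F w := (p * sin (y * (1 * w)) + y * - cos (y * (1 * w))) / (p ^+ 2 + y ^+ 2).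
have -> : - (y / (p ^+ 2 + y ^+ 2)) = F 0.
  by rewrite /F !mulr0 cos0 sin0 mulr0 add0r mulrN1 mulNr.
apply: (@RI_power_dens_primitive _ _ _ (1 + (p + `|y|) / (p ^+ 2 + y ^+ 2)) p0).
- exact: continuous_sin_lin.
- move=> w.
  have h1 := is_deriveZ p (is_derive_sin_lin y w).
  have h2 := is_deriveZ y (is_deriveN (is_derive_cos_lin y w)).
  have h3 := is_deriveZ (p ^+ 2 + y ^+ 2)^-1 (is_deriveD h1 h2).
  have h4 : is_derive w 1 F ((p ^+ 2 + y ^+ 2)^-1 *
     (p * (y * cos (y * (1 * w))) + y * - (- (y * sin (y * (1 * w)))))).
    rewrite (_ : F = (p ^+ 2 + y ^+ 2)^-1 \*: (p \*: (fun w => sin (y * (1 * w))) +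
       y \*: (- (fun w => cos (y * (1 * w)))))) //.
    by apply/funext => z; rewrite /F mulrC.
  apply: (is_derive_eq (is_deriveM (is_derive_expR_lin p w) h4)).
  rewrite /GRing.scale/= /F; move: (cos _) (sin _) (expR _) => c s e.
  by field; rewrite gt_eqF.
- move=> w; apply: power_trig_bound => //; first exact: normr_sin.
  by rewrite normrN; exact: normr_cos.
- move=> w; apply: le_trans (normr_sin _) _; rewrite lerDl.
  by rewrite divr_ge0 ?addr_ge0 ?sqr_ge0// ltW.
Qed.

End power_density.

(** * Meijer functions as inverse Fourier transforms *)

Section complex_gamma.
Variable R : realType.
Implicit Types (p q r s w y x c : R).
Local Notation mu := (@lebesgue_measure R).
Local Open Scope complex_scope.

Definition Fhat (d : R -> R) s y : R[i] := Fcos d s y +i* (- Fsin d s y).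

Lemma mulcE (a b c d : R) :
  (a +i* b) * (c +i* d) = (a * c - b * d) +i* (a * d + b * c) :> R[i].
Proof. by []. Qed.

Lemma addcE (a b c d : R) : (a +i* b) + (c +i* d) = (a + c) +i* (b + d) :> R[i].
Proof. by []. Qed.

Lemma oppcE (a b : R) : - (a +i* b) = (- a) +i* (- b) :> R[i].
Proof. by []. Qed.

Lemma Rintegral_gamma_trig p (f : R -> R) : 0 < p -> continuous f ->
  (forall w, `|f w| <= 1) ->
  let h u := expR (p * ln u) / u * expR (- u) * f (ln u) in
  mu.-integrable `]0, +oo[ (EFin \o h) /\
  Rintegral mu `]0, +oo[ h = RI (fun w => gamma_dens p w * f w).
Proof.
move=> p0 cf f1 h.
have E w : h (expR w) * expR w = gamma_dens p w * f w.
  rewrite /h expRK /gamma_dens expRB [expR (- expR w)]expRN.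
  by field; rewrite !gt_eqF ?expR_gt0.
have ch : {in `]0, +oo[, continuous h}.
  move=> x; rewrite in_itv/= andbT => x0.
  have cl : {for x, continuous (@ln R)} by exact: continuous_ln.
  apply: cvgM; last by apply: continuous_comp; [exact: cl|exact: cf].
  apply: cvgM; last first.
    apply: continuous_comp; last exact: continuous_expR.
    by apply: cvgN; exact: cvg_id.
  apply: cvgM; last by apply: cvgV; [rewrite gt_eqF|exact: cvg_id].
  apply: continuous_comp; last exact: continuous_expR.
  by apply: cvgM; [exact: cvg_cst|exact: cl].
have i : integ (fun w => h (expR w) * expR w).
  rewrite (funext E); apply: (integM (integ_gamma_dens p0) _ f1).
  exact: continuous_measurable_fun.
have [h1 h2] := Rintegral_expR ch i.
by split=> //; rewrite h2 (funext E).
Qed.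

(** For positive real part the shift [N] in [Gamma] is 0, which leaves Euler's integral; the
    substitution u = exp w makes it the Fourier transform of [gamma_dens p]. *)
Lemma GammaE p s y : 0 < p ->
  Gamma (p +i* (- (s * y))) = Fhat (gamma_dens p) s y.
Proof.
move=> p0; rewrite /Gamma /=.
have -> : Num.truncn (1 - p) = 0%N.
  by apply/truncn0Pn; rewrite -ltNge ltrBlDl ltrDr.
rewrite big_geq// divr1 addr0 /eulerGamma /Cintegral /Fhat.
have [_ Ec] := Rintegral_gamma_trig p0 (@continuous_cos_lin _ y s) (fun w => normr_cos _).
have [Is Es] := Rintegral_gamma_trig p0 (@continuous_sin_lin _ y s) (fun w => normr_sin _).
have P u : u \in `]0, +oo[%classic -> expR (ln u * (p - 1)) = expR (p * ln u) / u.
  rewrite inE /= in_itv/= andbT => u0.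
  by rewrite mulrBr mulr1 expRB lnK ?posrE// [ln u * p]mulrC.
have T u : ln u * - (s * y) = - (y * (s * ln u)) by ring.
apply: congr2.
- rewrite /Fcos -Ec; apply: eq_Rintegral => u u0.
  rewrite /cpow /cexp /= !mul0r !subr0 !addr0 !mulr0 subr0 T cosN (P u u0).
  by rewrite mulrAC.
- have /= N := (fun m => RintegralZl (-1) m Is) (measurable_itv `]0, +oo[).
  rewrite /Fsin -Es -[RHS]mulN1r; apply: (etrans _ N); apply: eq_Rintegral => u u0.
  rewrite /cpow /cexp /= !mul0r !subr0 !addr0 !mulr0 add0r T sinN (P u u0).
  by rewrite mulrN mulNr mulN1r mulrAC.
Qed.

Lemma Fhat_power p y : 0 < p -> Fhat (power_dens p) 1 y = (p +i* (- y))^-1.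
Proof.
move=> p0; have d0 : 0 < p ^+ 2 + y ^+ 2 by rewrite ltr_wpDr ?sqr_ge0 ?exprn_gt0.
rewrite /Fhat (Fcos_power y p0) (Fsin_power y p0) opprK.
have z0 : (p +i* (- y) : R[i]) != 0.
  by apply/eqP => -[/eqP]; rewrite gt_eqF.
apply: (mulfI z0); rewrite divff// mulcE.
by apply: congr2; field; rewrite gt_eqF.
Qed.

Lemma Fhat_gammaS p y : 0 < p ->
  Fhat (gamma_dens (p + 1)) 1 y = (p +i* (- y)) * Fhat (gamma_dens p) 1 y.
Proof.
move=> p0; rewrite /Fhat (Fcos_gammaS y p0) (Fsin_gammaS y p0) mulcE.
by move: (Fcos _ _ _) (Fsin _ _ _) => a b; apply: congr2; ring.
Qed.

(* Dividing by Gamma requires that it does not vanish ([gamma_sqnorm_gt0]). *)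
Lemma Gamma_ratio p y : 0 < p ->
  Gamma (p +i* (- (1 * y))) / Gamma ((p + 1) +i* (- (1 * y))) =
  Fhat (power_dens p) 1 y.
Proof.
move=> p0; rewrite !GammaE//; last by rewrite addr_gt0.
rewrite (Fhat_power y p0) (Fhat_gammaS y p0).
have G0 : Fhat (gamma_dens p) 1 y != 0.
  apply/eqP => -[/eqP a0 /eqP b0]; have := gamma_sqnorm_gt0 y p0.
  by rewrite /gamma_sqnorm (eqP a0) -[Fsin _ _ _]opprK (eqP b0) oppr0 expr0n/= addr0 ltxx.
by rewrite invfM mulrCA divff// mulr1.
Qed.

Lemma mulr_Fhat (K1 K2 d : R -> R) s y :
  (K1 y +i* K2 y) * Fhat d s y = KRe K1 K2 d s y +i* KIm K1 K2 d s y.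
Proof. by rewrite mulcE /KRe /KIm; apply: congr2; ring. Qed.

End complex_gamma.

(** * The Meijer integrand as a kernel on the contour *)

Section mellin_kernel.
Variable R : realType.
Implicit Types (p q r s w y x c : R) (a b : seq R).
Local Open Scope complex_scope.

Definition gammaRe q : R -> R := Fcos (gamma_dens q) 1.
Definition gammaIm q : R -> R := fun y => - Fsin (gamma_dens q) 1 y.

(** [q] and [r] belong to the two Gamma factors, [p] to the ratio reduced to 1 / z; only the factor
    of [r] carries the sign [s]. *)
Definition kernelRe p q r s : R -> R :=
  KRe (KRe (gammaRe q) (gammaIm q) (power_dens p) 1)
      (KIm (gammaRe q) (gammaIm q) (power_dens p) 1) (gamma_dens r) s.
Definition kernelIm p q r s : R -> R :=
  KIm (KRe (gammaRe q) (gammaIm q) (power_dens p) 1)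
      (KIm (gammaRe q) (gammaIm q) (power_dens p) 1) (gamma_dens r) s.

Lemma kernelE p q r s y :
  Fhat (gamma_dens q) 1 y * Fhat (power_dens p) 1 y * Fhat (gamma_dens r) s y =
  kernelRe p q r s y +i* kernelIm p q r s y.
Proof.
have -> : Fhat (gamma_dens q) 1 y = gammaRe q y +i* gammaIm q y by [].
by rewrite !mulr_Fhat.
Qed.

Lemma integ_gammaRe q : 0 < q -> integ (gammaRe q).
Proof.
move=> q0; have [C hC] := Fgamma_bound q0; apply: (@integ_dom _ _ C).
  apply: continuous_measurable_fun; apply: continuous_Fcos.
  exact: integ_gamma_dens.
by move=> y; have [] := hC y.
Qed.

Lemma integ_gammaIm q : 0 < q -> integ (gammaIm q).
Proof.
move=> q0; have [C hC] := Fgamma_bound q0; apply: (@integ_dom _ _ C).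
  apply: measurableT_comp => //; apply: continuous_measurable_fun.
  apply: continuous_Fsin; exact: integ_gamma_dens.
by move=> y; rewrite normrN; have [] := hC y.
Qed.

(** The decay comes from the Gamma factor of [q]; the other two transforms are bounded
    multipliers. *)
Lemma integ_kernel p q r s : 0 < p -> 0 < q -> 0 < r ->
  integ (kernelRe p q r s) /\ integ (kernelIm p q r s).
Proof.
move=> p0 q0 r0.
have i1 := integ_gammaRe q0; have i2 := integ_gammaIm q0.
have dp := integ_power_dens p0; have dr := integ_gamma_dens r0.
by split; [apply: integ_KRe|apply: integ_KIm] => //;
  (exact: integ_KRe || exact: integ_KIm).
Qed.

(* On the line Re s = c the Meijer integrand is [cpow x s] times the Fourier
   transform of the law of a sum of three independent variables; [s = -1] occurs
   for a factor Gamma(1 - a + s), [s = 1] for a factor Gamma(b - s). *)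
Definition meijer_repr m n a b c p q r s : Prop := forall x, 0 < x ->
  complex.Re (meijerG m n a b x) =
  expR (c * ln x) / (2 * pi) * Finv (kernelRe p q r s) (kernelIm p q r s) (ln x).

Lemma meijer_reprP m n a b p q r s : 0 < p -> 0 < q -> 0 < r ->
  let c := xget 0 [set c | separates m n a b c] in
  (forall x y, meijerG_integrand m n a b x (c +i* y) =
     (kernelRe p q r s y +i* kernelIm p q r s y) * cpow x (c +i* y)) ->
  meijer_repr m n a b c p q r s.
Proof.
move=> p0 q0 r0 c H x x0; rewrite /meijerG -/c.
have [i1 i2] := integ_kernel s p0 q0 r0.
(* The prefactor is 1 / (2 pi i), and Re (V / (2 pi i)) = Im V / (2 pi): the imaginary part of the
   contour integral carries the whole value. *)
set V := Cintegral _ _; have : complex.Im V = expR (c * ln x) *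
    Finv (kernelRe p q r s) (kernelIm p q r s) (ln x).
  rewrite /V /Cintegral /= /Finv -(RIZ _ (integ_Finv (ln x) i1 i2)).
  apply: RI_ext => y; rewrite H -complexiE /cpow /cexp.
  rewrite ImiRe !mulcE /= !mul0r addr0 subr0 [ln x * c]mulrC [ln x * y]mulrC.
  by move: (kernelRe _ _ _ _ _) (kernelIm _ _ _ _ _) (cos _) (sin _) => *; ring.
move=> HV; rewrite [RHS]mulrAC -HV -complexiE; clearbody V.
set I := ((2 * pi)%:C * 'i)%C.
have pi0 : 0 < 2 * pi :> R by rewrite mulr_gt0// pi_gt0.
have IE : I = 0 +i* (2 * pi) by rewrite /I mulcE; apply: congr2; ring.
have I0 : I != 0 by rewrite IE; apply/eqP => -[/eqP]; rewrite gt_eqF.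
case E : (I^-1 * V) => [w1 w2] /=.
have : V = I * (w1 +i* w2) by rewrite -E mulVKf.
rewrite IE mulcE => ->/=.
by rewrite mul0r add0r [RHS]mulrC mulKf// gt_eqF.
Qed.

End mellin_kernel.

(** * The two orders of Meijer functions that occur *)

Section meijer_instances.
Variable R : realType.
Local Open Scope complex_scope.

Let sub_cE (b c y : R) : (b%:C - (c +i* y) : R[i]) = (b - c) +i* (- (1 * y)).
Proof. by rewrite mul1r oppcE addcE add0r. Qed.

(** Since a = b1 + 1, the denominator Gamma(a - s) turns Gamma(b1 - s) into 1 / (b1 - s). The
    abscissa stays existential: what is used of it is its position with respect to the poles. *)
Lemma meijer_repr_30 (a b1 b2 b3 : R) : a = b1 + 1 ->
  exists c, [/\ c < b1, c < b2, c < b3 &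
    meijer_repr 3 0 [:: a] [:: b1; b2; b3] c (b1 - c) (b2 - c) (b3 - c) 1].
Proof.
move=> ->; set b := [:: b1; b2; b3]; set a' := [:: b1 + 1].
pose c := xget 0 [set c | separates 3 0 a' b c].
have [H _] : separates 3 0 a' b c.
  rewrite /c; apply: xgetPex; exists (Num.min b1 (Num.min b2 b3) - 1); split => //.
  have h1 : Num.min b1 (Num.min b2 b3) <= b1 by rewrite ge_min lexx.
  have h2 : Num.min b1 (Num.min b2 b3) <= b2 by rewrite !ge_min lexx orbT.
  have h3 : Num.min b1 (Num.min b2 b3) <= b3 by rewrite !ge_min lexx !orbT.
  by move=> j k; have := ler0n R k; case: j => [|[|[|//]]] /= k0 _; lra.
have c1 : c < b1 by have := H 0%N 0%N isT; rewrite addr0.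
have c2 : c < b2 by have := H 1%N 0%N isT; rewrite addr0.
have c3 : c < b3 by have := H 2%N 0%N isT; rewrite addr0.
exists c; split=> //; apply: meijer_reprP; rewrite ?subr_gt0// => x y.
rewrite /meijerG_integrand unlock /= !mulr1 -/c !sub_cE.
rewrite [b1 + 1 - c]addrAC -kernelE -!GammaE ?subr_gt0// -Gamma_ratio ?subr_gt0//.
move: (Gamma ((b1 - c) +i* _)) (Gamma ((b2 - c) +i* _)) (Gamma ((b3 - c) +i* _)).
by move: (Gamma _)^-1 (cpow _ _) => d e g1 g2 g3; ring.
Qed.

Lemma meijer_repr_21 (a1 a2 b1 b2 : R) : a2 = b2 + 1 -> a1 - 1 < b1 -> a1 - 1 < b2 ->
  exists c, [/\ c < b1, c < b2, a1 - 1 < c &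
    meijer_repr 2 1 [:: a1; a2] [:: b1; b2] c (b2 - c) (b1 - c) (1 - a1 + c) (-1)].
Proof.
move=> -> h1 h2; set b := [:: b1; b2]; set a := [:: a1; b2 + 1].
pose c := xget 0 [set c | separates 2 1 a b c].
have [H1 H2] : separates 2 1 a b c.
  (* The hypotheses leave a strip between the two families of poles; its midline separates them. *)
  rewrite /c; apply: xgetPex; exists ((a1 - 1 + Num.min b1 b2) / 2).
  have h3 : Num.min b1 b2 <= b1 by rewrite ge_min lexx.
  have h4 : Num.min b1 b2 <= b2 by rewrite ge_min lexx orbT.
  have h5 : a1 - 1 < Num.min b1 b2 by rewrite lt_min h1.
  split.
    by move=> j k; have := ler0n R k; case: j => [|[|//]] /= k0 _; lra.
  by move=> j k; have := ler0n R k; case: j => [|//] /= k0 _; lra.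
have c1 : c < b1 by have := H1 0%N 0%N isT; rewrite addr0.
have c2 : c < b2 by have := H1 1%N 0%N isT; rewrite addr0.
have c3 : a1 - 1 < c by have := H2 0%N 0%N isT; rewrite subr0.
have c4 : 0 < 1 - a1 + c by lra.
exists c; split=> //; apply: meijer_reprP; rewrite ?subr_gt0// => x y.
rewrite /meijerG_integrand unlock /= !mulr1 -/c !sub_cE.
(* Here s enters with a plus sign, so y has the opposite sign to the other factors: this is the
   factor with sign -1. *)
have -> : ((1 - a1) +i* (- (1 * 0)) + (c +i* y) : R[i]) = (1 - a1 + c) +i* (- (-1 * y)).
  by rewrite mulN1r opprK addcE mulr0 oppr0 add0r.
rewrite [b2 + 1 - c]addrAC -kernelE -!GammaE ?subr_gt0// -Gamma_ratio ?subr_gt0//.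
move: (Gamma ((b1 - c) +i* _)) (Gamma ((b2 - c) +i* _)) (Gamma ((1 - a1 + c) +i* _)).
by move: (Gamma _)^-1 (cpow _ _) => d e g1 g2 g3; ring.
Qed.

End meijer_instances.

(** * Meijer functions tested against a Gaussian in ln x *)

Section gauss_test.
Variable R : realType.
Implicit Types (p q r s w y x c b m a : R).
Local Notation mu := (@lebesgue_measure R).
Local Notation gint := (RI (@gauss R)).

Let continuous_lin (m y : R) : continuous (fun w : R => (w + m) * y).
Proof.
move=> w; apply: cvgM; last exact: cvg_cst.
by apply: cvgD; [exact: cvg_id|exact: cvg_cst].
Qed.

Lemma integ_gauss_shift m : integ (fun w => gauss (w - m)).
Proof. by have [] := RI_shift (- m) (@continuous_gauss R) (integ_gauss R). Qed.

Lemma RI_gauss_shift_cos m y :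
  RI (fun w => gauss (w - m) * cos (w * y)) = cos (m * y) * gint * gauss y.
Proof.
rewrite -gaussFE.
have ch : continuous (fun w => gauss w * cos ((w + m) * y)).
  move=> w; apply: cvgM; first exact: continuous_gauss.
  by apply: continuous_comp; [exact: continuous_lin|exact: continuous_cos].
have ih := integ_cos_comp (integ_gauss R) (@continuous_lin m y).
have [_ E] := RI_shift (- m) ch ih.
transitivity (RI (fun w => gauss w * cos ((w + m) * y))).
  by rewrite -E; apply: RI_ext => w; rewrite subrK.
by apply: RI_ext => w; rewrite mulrDl.
Qed.

Lemma RI_gauss_shift_sin m y :
  RI (fun w => gauss (w - m) * sin (w * y)) = sin (m * y) * gint * gauss y.
Proof.
have sE (x : R) : sin x = cos (x - pi / 2).
  by rewrite cosB cos_pihalf sin_pihalf mulr0 mulr1 add0r.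
rewrite [sin (m * y)]sE -gaussFE.
have ch : continuous (fun w => gauss w * sin ((w + m) * y)).
  move=> w; apply: cvgM; first exact: continuous_gauss.
  by apply: continuous_comp; [exact: continuous_lin|exact: continuous_sin].
have ih := integ_sin_comp (integ_gauss R) (@continuous_lin m y).
have [_ E] := RI_shift (- m) ch ih.
transitivity (RI (fun w => gauss w * sin ((w + m) * y))).
  by rewrite -E; apply: RI_ext => w; rewrite subrK.
by apply: RI_ext => w; rewrite sE mulrDl addrA.
Qed.

Lemma Fcos_gauss_shift m y :
  Fcos (fun w => gauss (w - m)) (-1) y = cos (m * y) * gint * gauss y.
Proof.
rewrite -RI_gauss_shift_cos; apply: RI_ext => w.
by rewrite mulN1r mulrN cosN [y * w]mulrC.
Qed.

Lemma Fsin_gauss_shift m y :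
  Fsin (fun w => gauss (w - m)) (-1) y = - (sin (m * y) * gint * gauss y).
Proof.
rewrite -RI_gauss_shift_sin -[RHS]mulN1r -(RIZ (-1) (integ_sin y (integ_gauss_shift m))).
by apply: RI_ext => w; rewrite !mulN1r mulrN sinN mulrN [y * w]mulrC.
Qed.

(** The transform of a Gaussian centred at m is a Gaussian times a phase: the Gaussian damps the
    kernel and the phase moves the point of evaluation by m. *)
Lemma Finv_gauss_conv (K1 K2 : R -> R) m a : integ K1 -> integ K2 ->
  conv (-1) (fun w => gauss (w - m)) (Finv K1 K2) a =
  gint * Finv (fun y => gauss y * K1 y) (fun y => gauss y * K2 y) (a + m).
Proof.
move=> i1 i2; rewrite -(Finv_conv (-1) a i1 i2 (integ_gauss_shift m)).
have cg := continuous_measurable_fun (@continuous_gauss R).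
have gi (K : R -> R) : integ K -> integ (fun y => gauss y * K y).
  move=> Ki; apply: (@integ_ext _ (fun y => K y * gauss y)).
    by move=> y; rewrite mulrC.
  apply: (integM (B := 1) Ki cg) => y.
  by rewrite ger0_norm ?gauss_le1// ltW// gauss_gt0.
rewrite -(RIZ gint (integ_Finv (a + m) (gi _ i1) (gi _ i2))); apply: RI_ext => y.
rewrite /KRe /KIm Fcos_gauss_shift Fsin_gauss_shift [y * (a + m)]mulrDr cosD sinD [m * y]mulrC.
move: (cos _) (sin _) (cos _) (sin _) (gauss y) gint (K1 y) (K2 y) => *; ring.
Qed.

(** Up to normalization, the density of the sum of a standard Gaussian variable, of two independent
    variables with laws [gamma_dens q] and [power_dens p], and of s times a third with law
    [gamma_dens r]. *)
Definition smooth_density p q r s : R -> R :=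
  conv s (gamma_dens r) (conv 1 (power_dens p) (conv 1 (gamma_dens q)
    (fun a => gint * gauss a))).

Let integ0 : integ (fun _ : R => 0 : R). Proof. exact: integrable0. Qed.

(** The same product of transforms read from the other end: the Gaussian is the initial kernel, with
    a known inverse transform, and each remaining factor becomes a convolution by [Finv_conv]. *)
Lemma Finv_gauss_kernel p q r s : 0 < p -> 0 < q -> 0 < r ->
  Finv (fun y => gauss y * kernelRe p q r s y) (fun y => gauss y * kernelIm p q r s y) =
  smooth_density p q r s.
Proof.
move=> p0 q0 r0.
have dq := integ_gamma_dens q0; have dp := integ_power_dens p0.
have dr := integ_gamma_dens r0; have g := integ_gauss R.
pose K1 := KRe (@gauss R) (fun=> 0) (gamma_dens q) 1.
pose K1' := KIm (@gauss R) (fun=> 0) (gamma_dens q) 1.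
pose K2 := KRe K1 K1' (power_dens p) 1; pose K2' := KIm K1 K1' (power_dens p) 1.
have i1 : integ K1 by exact: integ_KRe. have i1' : integ K1' by exact: integ_KIm.
have i2 : integ K2 by exact: integ_KRe. have i2' : integ K2' by exact: integ_KIm.
have F0 : Finv (@gauss R) (fun=> 0) = (fun a => gint * gauss a).
  apply/funext => a; have := gaussFE 0 a; rewrite cos0 mul1r => <-.
  by apply: RI_ext => y; rewrite mul0r subr0 addr0.
have F1 : Finv K1 K1' = conv 1 (gamma_dens q) (fun a => gint * gauss a).
  by apply/funext => a; rewrite (Finv_conv 1 a g integ0 dq) F0.
have F2 : Finv K2 K2' = conv 1 (power_dens p) (Finv K1 K1').
  by apply/funext => a; rewrite (Finv_conv 1 a i1 i1' dp).
apply/funext => a; rewrite /smooth_density -F1 -F2 -(Finv_conv s a i2 i2' dr).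
apply: RI_ext => y.
rewrite /kernelRe /kernelIm /K2 /K2' /K1 /K1' /KRe /KIm /gammaRe /gammaIm mul0r.
move: (Fcos (gamma_dens q) 1 y) (Fsin (gamma_dens q) 1 y) => fq1 fq2.
move: (Fcos (power_dens p) 1 y) (Fsin (power_dens p) 1 y) => fp1 fp2.
move: (Fcos (gamma_dens r) s y) (Fsin (gamma_dens r) s y) => fr1 fr2.
move: (gauss y) (cos _) (sin _) => *; ring.
Qed.

(** Completing the square: a power of x against the Gaussian only moves its centre. *)
Lemma gauss_tilt (k w b : R) :
  expR (k * w) * gauss (w - b) = expR (k * b + k ^+ 2 / 2) * gauss (w - (b + k)).
Proof. by rewrite /gauss -!expRD; congr expR; field. Qed.

(* Testing the contour integral against a Gaussian in [ln x] makes the double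
   integral absolutely convergent; Fubini in both orders gives Fourier inversion. *)
Lemma meijer_smoothing (m n : nat) (a b' : seq R) c p q r s (phi C b : R) :
  0 < p -> 0 < q -> 0 < r -> 0 < C -> meijer_repr m n a b' c p q r s ->
  let h x := x `^ (phi - 1) * complex.Re (meijerG m n a b' (C * x)) * gauss (ln x - b) in
  mu.-integrable `]0, +oo[ (EFin \o h) /\
  Rintegral mu `]0, +oo[ h =
    expR ((phi + c) * b + (phi + c) ^+ 2 / 2 + c * ln C) / (2 * pi) * gint *
    smooth_density p q r s (ln C + (b + (phi + c))).
Proof.
move=> p0 q0 r0 C0 repr h.
have [i1 i2] := integ_kernel s p0 q0 r0.
set M1 := kernelRe p q r s in i1; set M2 := kernelIm p q r s in i2.
pose H x := expR ((phi - 1) * ln x) *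
  (expR (c * (ln C + ln x)) / (2 * pi) * Finv M1 M2 (ln C + ln x)) * gauss (ln x - b).
have hH x : 0 < x -> h x = H x.
  move=> x0; rewrite /h /H /powR gt_eqF// repr ?mulr_gt0// lnM ?posrE//.
pose A := expR ((phi + c) * b + (phi + c) ^+ 2 / 2 + c * ln C) / (2 * pi).
(* The total power of x is (phi - 1) + c + 1, the last unit coming from dx = exp w dw. *)
pose k := phi + c.
have HE w : H (expR w) * expR w =
    A * (gauss (w - (b + k)) * Finv M1 M2 (ln C - -1 * w)).
  rewrite /H /A; set P := (2 * pi)^-1; clearbody P.
  rewrite expRK mulN1r opprK -/k.
  have := gauss_tilt k w b.
  rewrite !mulrDr !expRD => T.
  have -> : expR ((phi - 1) * w) = expR (k * w) / expR w / expR (c * w).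
    by rewrite -!expRB; congr expR; rewrite /k; ring.
  move: T; have := expR_gt0 w; have := expR_gt0 (c * w).
  move: (expR (k * w)) (expR (c * w)) (expR w) (gauss (w - (b + k))) (gauss (w - b)) (expR (k * b)).
  move: (expR (c * ln C)) (expR (k ^+ 2 / 2)) (Finv _ _ _) P.
  move=> e1 e2 e3 e4 e5 e6 e7 e8 e9 e10 h6 h7 T.
  transitivity (e5 * e9 * e1 * e4 * e3).
    by field; rewrite !gt_eqF.
  by rewrite T; ring.
have iA : integ (fun w => gauss (w - (b + k)) * Finv M1 M2 (ln C - -1 * w)).
  exact: integ_conv (integ_gauss_shift _) i1 i2.
have iH : integ (fun w => H (expR w) * expR w).
  by rewrite (funext HE); exact: integZ.
have cH : {in `]0, +oo[, continuous H}.
  move=> x; rewrite in_itv/= andbT => x0.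
  have cl : {for x, continuous (@ln R)} by exact: continuous_ln.
  have clC : {for x, continuous (fun x => ln C + ln x)}.
    by apply: cvgD; [exact: cvg_cst|exact: cl].
  apply: cvgM; [apply: cvgM|].
  - apply: continuous_comp; last exact: continuous_expR.
    by apply: cvgM; [exact: cvg_cst|exact: cl].
  - apply: cvgM; [apply: cvgM|].
    + apply: continuous_comp; last exact: continuous_expR.
      by apply: cvgM; [exact: cvg_cst|exact: clC].
    + exact: cvg_cst.
    + apply: (@continuous_comp _ _ _ (fun x => ln C + ln x) (Finv M1 M2)); first exact: clC.
      exact: continuous_Finv.
  - apply: (@continuous_comp _ _ _ (fun x => ln x - b) (@gauss R)).
      by apply: cvgB; [exact: cl|exact: cvg_cst].
    exact: continuous_gauss.
have [h1 h2] := Rintegral_expR cH iH.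
split.
  apply: eq_integrable h1 => //=.
  by move=> x; rewrite inE /= in_itv/= andbT => x0; rewrite hH.
transitivity (Rintegral mu `]0, +oo[ H).
  by apply: eq_Rintegral => x; rewrite inE /= in_itv/= andbT; exact: hH.
rewrite h2 (funext HE) (RIZ A iA) -(Finv_gauss_kernel s p0 q0 r0) -mulrA -/k.
by rewrite -Finv_gauss_conv.
Qed.

End gauss_test.

(** * Exponents of the smoothed density *)

Section convolution_bounds.
Variable R : realType.
Implicit Types (p q r s w x c b a t v L K : R) (d F : R -> R).
Local Notation gint := (RI (@gauss R)).

(** A class that contains the Gaussian and is stable under [conv], so that every iterated
    convolution is integrable. *)
Definition tame F : Prop :=
  [/\ continuous F, forall a, 0 <= F a & exists B, forall a, F a <= B].

Lemma integ_conv_tame s d F a : integ d -> tame F ->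
  integ (fun w => d w * F (a - s * w)).
Proof.
move=> di [cF F0 [B FB]]; apply: (integM (B := B) di).
- apply: continuous_measurable_fun => w.
  apply: continuous_comp; last exact: cF.
  exact: continuous_affine.
- by move=> w; rewrite ger0_norm.
Qed.

Lemma conv_tame s d F : integ d -> (forall w, 0 <= d w) -> tame F ->
  tame (conv s d F).
Proof.
move=> di d0 tF; have [cF F0 [B FB]] := tF; split.
- apply: (@RI_continuous _ (fun a w => d w * F (a - s * w)) (fun w => B * d w)).
  + by move=> a; exact: integ_conv_tame.
  + exact: integZ.
  + move=> w a; apply: cvgM; first exact: cvg_cst.
    apply: (@continuous_comp _ _ _ (fun a => a - s * w) F); last exact: cF.
    by apply: cvgB; [exact: cvg_id|exact: cvg_cst].
  + move=> a w; rewrite !ger0_norm ?mulr_ge0//; first by rewrite mulrC ler_wpM2r.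
    by rewrite (le_trans (F0 0)).
- by move=> a; apply: RI_ge0 => w; rewrite mulr_ge0.
- exists (RI (fun w => B * d w)) => a; apply: RI_le.
  + exact: integ_conv_tame.
  + exact: integZ.
  + by move=> w; rewrite mulrC ler_wpM2r.
Qed.

(** The factor exp (r (a - s w)) splits: the rate in [a] is kept, and the constant is multiplied by
    an exponential moment of [d]. *)
Lemma conv_le s d F r K : integ d -> (forall w, 0 <= d w) -> tame F ->
  integ (fun w => d w * expR (- r * s * w)) ->
  (forall a, F a <= K * expR (r * a)) ->
  forall a, conv s d F a <= K * RI (fun w => d w * expR (- r * s * w)) * expR (r * a).
Proof.
move=> di d0 tF ie FK a.
have E : K * RI (fun w => d w * expR (- r * s * w)) * expR (r * a) =
    RI (fun w => (K * expR (r * a)) * (d w * expR (- r * s * w))).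
  by rewrite RIZ// mulrAC.
rewrite E; apply: RI_le; [exact: integ_conv_tame|exact: integZ|] => w.
rewrite mulrCA; apply: ler_wpM2l => //.
apply: le_trans (FK _) _; rewrite -[K * _ * _]mulrA -expRD.
by rewrite (_ : r * (a - s * w) = r * a + - r * s * w)//; ring.
Qed.

Lemma RI_indic_itv t : RI (\1_`[t - 1, t] : R -> R) = 1.
Proof.
rewrite /RI /Rintegral integral_indic// setIT.
have E : (@lebesgue_measure R `[t - 1, t]%classic = 1%E).
  rewrite lebesgue_measure_itv/= lte_fin ltrBlDr ltrDl ltr01 -EFinB.
  by congr EFin; ring.
by change (fine (@lebesgue_measure R `[t - 1, t]%classic) = 1); rewrite E.
Qed.

(** The integral is restricted to the unit window ending at t'. There a - s w moves by at most 1, so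
    the radius on which [F] must be controlled grows by 1. *)
Lemma conv_ge s d F a t t' e v L : `|s| <= 1 -> integ d -> (forall w, 0 <= d w) ->
  tame F -> 0 <= v -> 0 <= L ->
  (forall w, t' - 1 <= w <= t' -> v <= d w) ->
  (forall z, `|z - t| <= e + 1 -> L <= F z) ->
  `|a - t - s * t'| <= e -> v * L <= conv s d F a.
Proof.
move=> s1 di d0 tF v0 L0 dv FL ae; have [_ F0 _] := tF.
have i1 : integ (\1_`[t' - 1, t'] : R -> R) by exact: integrable_indic_itv.
rewrite -[v * L]mulr1 -(RI_indic_itv t') -(RIZ (v * L) i1).
apply: RI_le; [exact: integZ|exact: integ_conv_tame|] => w.
rewrite indicE; have [/set_mem/=|_] := boolP (w \in _); last first.
  by rewrite mulr0 mulr_ge0.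
rewrite in_itv/= => tw; rewrite mulr1; apply: ler_pM => //; first exact: dv.
apply: FL; rewrite (_ : _ - t = (a - t - s * t') + s * (t' - w)); last by ring.
apply: le_trans (ler_normD _ _) _; apply: lerD => //.
rewrite normrM -[1]mulr1; apply: ler_pM => //.
by rewrite ler_norml; apply/andP; split; lra.
Qed.

Lemma tame_gauss : tame (fun a => gint * gauss a).
Proof.
have g0 := RI_gauss_gt0 R; split.
- by move=> a; apply: cvgM; [exact: cvg_cst|exact: continuous_gauss].
- by move=> a; rewrite mulr_ge0// ltW// gauss_gt0.
- by exists gint => a; rewrite ler_piMr ?gauss_le1// ltW.
Qed.

Variables p q r : R.
Hypotheses (p0 : 0 < p) (q0 : 0 < q) (r0 : 0 < r).

Let dq := integ_gamma_dens q0.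
Let dp := integ_power_dens p0.
Let dr := integ_gamma_dens r0.
Let pq w : 0 <= gamma_dens q w. Proof. exact: ltW (gamma_dens_gt0 q w). Qed.
Let pr w : 0 <= gamma_dens r w. Proof. exact: ltW (gamma_dens_gt0 r w). Qed.
Let F0 : R -> R := fun a => gint * gauss a.
Let F1 := conv 1 (gamma_dens q) F0.
Let F2 := conv 1 (power_dens p) F1.
Let t1 : tame F1. Proof. exact: conv_tame dq pq tame_gauss. Qed.
Let t2 : tame F2. Proof. exact: conv_tame dp (power_dens_ge0 p) t1. Qed.

(** Tilting a gamma or power density shifts its parameter; the hypotheses keep the three shifted
    parameters positive, hence the three moments finite. *)
Lemma smooth_density_le s rho : rho < p -> rho < q -> 0 < r - rho * s ->
  exists2 K, 0 <= K & forall a, smooth_density p q r s a <= K * expR (rho * a).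
Proof.
move=> hp hq hr.
have E1 w : gamma_dens q w * expR (- rho * 1 * w) = gamma_dens (q - rho) w.
  by rewrite mulr1 gamma_densM.
have E2 w : power_dens p w * expR (- rho * 1 * w) = power_dens (p - rho) w.
  by rewrite mulr1 power_densM.
have E3 w : gamma_dens r w * expR (- rho * s * w) = gamma_dens (r - rho * s) w.
  by rewrite gamma_densM mulNr.
have i1 : integ (fun w => gamma_dens q w * expR (- rho * 1 * w)).
  by rewrite (funext E1); apply: integ_gamma_dens; rewrite subr_gt0.
have i2 : integ (fun w => power_dens p w * expR (- rho * 1 * w)).
  by rewrite (funext E2); apply: integ_power_dens; rewrite subr_gt0.
have i3 : integ (fun w => gamma_dens r w * expR (- rho * s * w)).
  by rewrite (funext E3); exact: integ_gamma_dens.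
have g0 := RI_gauss_gt0 R.
(* Expanding (a + rho)^2 >= 0. *)
have h0 a : F0 a <= gint * expR (rho ^+ 2 / 2) * expR (rho * a).
  rewrite -mulrA ler_wpM2l ?(ltW g0)// -expRD ler_expR.
  by have := sqr_ge0 (a + rho); nra.
have h1 := conv_le dq pq tame_gauss i1 h0.
have h2 := conv_le dp (power_dens_ge0 p) t1 i2 h1.
have h3 := conv_le dr pr t2 i3 h2.
eexists; last exact: h3.
rewrite !mulr_ge0 ?expR_ge0 ?(ltW g0)//; apply: RI_ge0 => w;
  by rewrite mulr_ge0 ?expR_ge0// power_dens_ge0.
Qed.

Lemma gamma_dens_ge z t w : 0 < z -> t <= 0 -> t - 1 <= w <= t ->
  expR (z * (t - 1) - 1) <= gamma_dens z w.
Proof.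
move=> z0 t0 /andP[h1 h2]; rewrite ler_expR lerB//; first by rewrite ler_wpM2l// ltW.
by rewrite -expR0 ler_expR (le_trans h2).
Qed.

Lemma power_dens_ge z t w : 0 < z -> t <= 0 -> t - 1 <= w <= t ->
  expR (z * (t - 1)) <= power_dens z w.
Proof.
move=> z0 t0 /andP[h1 h2]; rewrite /power_dens (le_trans h2 t0) ler_expR.
by rewrite ler_wpM2l// ltW.
Qed.

(** Each convolution is restricted to the unit window ending at [u1], [u2] or [u3]. The three
    displacements of at most 1 add up, so the Gaussian is needed on [-3, 3], where it is at least
    exp (- 9 / 2). *)
Lemma smooth_density_ge s u1 u2 u3 : `|s| <= 1 -> u1 <= 0 -> u2 <= 0 -> u3 <= 0 ->
  expR (r * (u3 - 1) - 1) * (expR (p * (u2 - 1)) * (expR (q * (u1 - 1) - 1) *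
    (gint * expR (- (9 / 2))))) <= smooth_density p q r s (u1 + u2 + s * u3).
Proof.
move=> s1 h1 h2 h3; have g0 := RI_gauss_gt0 R.
have n1 : `|1 : R| <= 1 by rewrite normr1.
have L0 : 0 <= gint * expR (- (9 / 2)) by rewrite mulr_ge0 ?expR_ge0// ltW.
have B0 z : `|z - 0| <= 2 + 1 -> gint * expR (- (9 / 2)) <= F0 z.
  rewrite subr0 => z3; rewrite ler_wpM2l ?(ltW g0)// ler_expR mulNr lerN2.
  rewrite ler_wpM2r// -(real_normK (num_real z)).
  have := normr_ge0 z; nra.
have B1 z : `|z - u1| <= 1 + 1 -> expR (q * (u1 - 1) - 1) * (gint * expR (- (9 / 2))) <= F1 z.
  move=> zu; apply: (conv_ge n1 dq pq tame_gauss (expR_ge0 _) L0 _ B0).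
    by move=> w; exact: gamma_dens_ge.
  by rewrite subr0 mul1r.
have L1 := mulr_ge0 (expR_ge0 (q * (u1 - 1) - 1)) L0.
have B2 z : `|z - (u1 + u2)| <= 0 + 1 ->
    expR (p * (u2 - 1)) * (expR (q * (u1 - 1) - 1) * (gint * expR (- (9 / 2)))) <= F2 z.
  move=> zu; apply: (conv_ge n1 dp (power_dens_ge0 p) t1 (expR_ge0 _) L1 _ B1).
    by move=> w; exact: power_dens_ge.
  by move: zu; rewrite add0r mul1r opprD addrA.
have L2 := mulr_ge0 (expR_ge0 (p * (u2 - 1))) L1.
apply: (conv_ge s1 dr pr t2 (expR_ge0 _) L2 _ B2).
  by move=> w; exact: gamma_dens_ge.
by rewrite [u1 + u2 + _]addrC addrK subrr normr0.
Qed.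

(* Only the factors entering with a positive power create a singularity at 0;
   for s = -1 the third one does not. *)
Lemma smooth_density_lower s e : `|s| <= 1 -> e = p \/ e = q \/ (e = r /\ s = 1) ->
  exists2 c, 0 < c & forall a, a <= 0 -> c * expR (e * a) <= smooth_density p q r s a.
Proof.
move=> s1 he; have g0 := RI_gauss_gt0 R.
pose c := expR (- r - 1) * (expR (- p) * (expR (- q - 1) * (gint * expR (- (9 / 2))))).
have c0 : 0 < c by rewrite !mulr_gt0 ?expR_gt0.
have E z : z * (0 - 1) = - z by rewrite sub0r mulrN1.
have D z (a : R) : z * (a - 1) = - z + z * a by ring.
(* The factor with exponent [e] takes its window at [a], the other two at 0. *)
exists c => // a a0; move: he => [->|[->|[-> s1']]].
- have := smooth_density_ge s1 (lexx 0) a0 (lexx 0).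
  rewrite (_ : 0 + a + s * 0 = a); last by ring.
  rewrite !E D [expR (- p + _)]expRD; apply: le_trans.
  rewrite le_eqVlt; apply/orP; left; apply/eqP; rewrite /c.
  move: (expR (- r - 1)) (expR (- p)) (expR (- q - 1)) (expR (p * a)) (gint * _).
  by move=> *; ring.
- have := smooth_density_ge s1 a0 (lexx 0) (lexx 0).
  rewrite (_ : a + 0 + s * 0 = a); last by ring.
  rewrite !E D (addrAC (- q)) [expR (- q - 1 + _)]expRD; apply: le_trans.
  rewrite le_eqVlt; apply/orP; left; apply/eqP; rewrite /c.
  move: (expR (- r - 1)) (expR (- p)) (expR (- q - 1)) (expR (q * a)) (gint * _).
  by move=> *; ring.
- have := smooth_density_ge s1 (lexx 0) (lexx 0) a0.
  rewrite (_ : 0 + 0 + s * a = a); last by rewrite s1'; ring.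
  rewrite !E D (addrAC (- r)) [expR (- r - 1 + _)]expRD; apply: le_trans.
  rewrite le_eqVlt; apply/orP; left; apply/eqP; rewrite /c.
  move: (expR (- r - 1)) (expR (- p)) (expR (- q - 1)) (expR (r * a)) (gint * _).
  by move=> *; ring.
Qed.

End convolution_bounds.

(** * Growth rates of one smoothed Meijer term *)

Section meijer_term.
Variable R : realType.
Local Notation mu := (@lebesgue_measure R).
Variables (m n : nat) (a b' : seq R) (c p q r s phi C : R).
Hypotheses (p0 : 0 < p) (q0 : 0 < q) (r0 : 0 < r) (C0 : 0 < C) (s1 : `|s| <= 1).
Hypothesis repr : meijer_repr m n a b' c p q r s.

Definition meijer_smooth (m n : nat) (a b' : seq R) (phi C : R) (b x : R) : R :=
  x `^ (phi - 1) * complex.Re (meijerG m n a b' (C * x)) * gauss (ln x - b).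

Let k := phi + c.
Let A := expR (k ^+ 2 / 2 + c * ln C) / (2 * pi) * RI (@gauss R).

Let A0 : 0 < A.
Proof.
by rewrite mulr_gt0 ?RI_gauss_gt0// divr_gt0 ?expR_gt0// mulr_gt0// pi_gt0.
Qed.

Let E (b : R) : Rintegral mu `]0, +oo[ (meijer_smooth m n a b' phi C b) =
  A * expR (k * b) * smooth_density p q r s (ln C + (b + k)).
Proof.
have [_ ->] := meijer_smoothing phi b p0 q0 r0 C0 repr; rewrite -/k /A.
by rewrite -addrA expRD; move: (2 * pi)^-1 => P; ring.
Qed.

Lemma integrable_meijer_smooth b :
  mu.-integrable `]0, +oo[ (EFin \o meijer_smooth m n a b' phi C b).
Proof. by have [] := meijer_smoothing phi b p0 q0 r0 C0 repr. Qed.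

Lemma meijer_smooth_ge0 b : 0 <= Rintegral mu `]0, +oo[ (meijer_smooth m n a b' phi C b).
Proof.
rewrite E; apply: mulr_ge0; first by rewrite mulr_ge0 ?expR_ge0// ltW.
apply: RI_ge0 => w; apply: mulr_ge0; first exact: ltW (gamma_dens_gt0 _ _).
apply: RI_ge0 => w'; apply: mulr_ge0; first exact: power_dens_ge0.
apply: RI_ge0 => w''; apply: mulr_ge0; first exact: ltW (gamma_dens_gt0 _ _).
by rewrite mulr_ge0// ltW// ?RI_gauss_gt0// gauss_gt0.
Qed.

(** The tilt accounts for rate [k] and the smooth density for rate [e - k]. With p = b_i - c and k =
    phi + c, the sum p + k is phi + b_i. *)
Lemma meijer_smooth_le e : e < p + k -> e < q + k -> 0 < r - (e - k) * s ->
  exists2 K, 0 <= K & forall b,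
    Rintegral mu `]0, +oo[ (meijer_smooth m n a b' phi C b) <= K * expR (e * b).
Proof.
move=> ep eq er.
have [||K K0 hK] := @smooth_density_le _ _ _ _ p0 q0 r0 s (e - k) _ _ er.
- by rewrite ltrBlDr.
- by rewrite ltrBlDr.
exists (A * (K * expR ((e - k) * (ln C + k)))).
  by rewrite mulr_ge0 ?(ltW A0)// mulr_ge0 ?expR_ge0.
move=> b; rewrite E; have := hK (ln C + (b + k)) => h.
apply: (@le_trans _ _ (A * expR (k * b) * (K * expR ((e - k) * (ln C + (b + k)))))).
  by rewrite ler_wpM2l// mulr_ge0 ?expR_ge0// ltW.
rewrite le_eqVlt; apply/orP; left; apply/eqP.
have -> : (e - k) * (ln C + (b + k)) = (e - k) * (ln C + k) + (e * b - k * b) by ring.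
rewrite expRD expRB; have := expR_gt0 (k * b).
move: (expR (k * b)) (expR (e * b)) (expR ((e - k) * _)) => e1 e2 e3 e10.
by field; rewrite gt_eqF.
Qed.

Lemma meijer_smooth_lower e : e = p + k \/ e = q + k \/ (e = r + k /\ s = 1) ->
  exists2 c', 0 < c' & exists b0, forall b, b <= b0 ->
    c' * expR (e * b) <= Rintegral mu `]0, +oo[ (meijer_smooth m n a b' phi C b).
Proof.
move=> he; have he' : e - k = p \/ e - k = q \/ (e - k = r /\ s = 1).
  by case: he => [->|[->|[-> ?]]]; rewrite addrK; auto.
have [c' c0 hc] := smooth_density_lower p0 q0 r0 s1 he'.
exists (A * (c' * expR ((e - k) * (ln C + k)))).
  by rewrite mulr_gt0 ?A0// mulr_gt0 ?expR_gt0.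
exists (- (ln C + k)) => b hb; rewrite E.
have := hc (ln C + (b + k)); rewrite (_ : ln C + (b + k) <= 0); last by lra.
move=> /(_ isT) h.
apply: (@le_trans _ _ (A * expR (k * b) * (c' * expR ((e - k) * (ln C + (b + k)))))).
  rewrite le_eqVlt; apply/orP; left; apply/eqP.
  have -> : (e - k) * (ln C + (b + k)) = (e - k) * (ln C + k) + (e * b - k * b) by ring.
  rewrite expRD expRB; have := expR_gt0 (k * b).
  move: (expR (k * b)) (expR (e * b)) (expR ((e - k) * _)) => e1 e2 e3 e10.
  by field; rewrite gt_eqF.
by rewrite ler_wpM2l// mulr_ge0 ?expR_ge0// ltW.
Qed.

End meijer_term.

(** * The three fading models *)

Section fading_models.
Variable R : realType.
Local Notation mu := (@lebesgue_measure R).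
Implicit Types (phi C e b c K : R) (X : tp_params R).

Lemma rGamma_gt0 (x : R) : 0 < x -> 0 < rGamma x.
Proof.
move=> x0; rewrite /rGamma.
have -> : (x%:C)%C = (x +i* (- (1 * 0)))%C by rewrite mulr0 oppr0.
rewrite (GammaE 1 0 x0) /=; have -> : Fcos (gamma_dens x) 1 0 = RI (gamma_dens x).
  by apply: RI_ext => w; rewrite mul0r cos0 mulr1.
exact: gamma_mean_gt0.
Qed.

(** The interface between Meijer terms and tail estimates: the abscissa and the kernel parameters
    are gone, and the rates phi + b_i remain. *)
Record fading_term (phi C : R) (m n : nat) (a b : seq R) : Prop := {
  term_integrable : forall x0,
    mu.-integrable `]0, +oo[ (EFin \o meijer_smooth m n a b phi C x0);
  term_ge0 : forall x0, 0 <= Rintegral mu `]0, +oo[ (meijer_smooth m n a b phi C x0);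
  term_le : forall e, 0 <= e -> (forall i, (i < m)%N -> e < phi + b`_i) ->
    exists2 K, 0 <= K & forall x0,
      Rintegral mu `]0, +oo[ (meijer_smooth m n a b phi C x0) <= K * expR (e * x0);
  term_lower : forall i, (i < m)%N ->
    exists2 c, 0 < c & exists b0, forall x0, x0 <= b0 ->
      c * expR ((phi + b`_i) * x0) <=
      Rintegral mu `]0, +oo[ (meijer_smooth m n a b phi C x0)
}.

Lemma fading_term_30 phi C (a b1 b2 b3 : R) : 0 < C -> a = b1 + 1 ->
  fading_term phi C 3 0 [:: a] [:: b1; b2; b3].
Proof.
move=> C0 /(@meijer_repr_30 R a b1 b2 b3)[c [c1 c2 c3 repr]].
have p0 : 0 < b1 - c by rewrite subr_gt0.
have q0 : 0 < b2 - c by rewrite subr_gt0.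
have r0 : 0 < b3 - c by rewrite subr_gt0.
have n1 : `|1 : R| <= 1 by rewrite normr1.
split.
- by move=> x0; exact: (integrable_meijer_smooth phi p0 q0 r0 C0 repr).
- by move=> x0; exact: (meijer_smooth_ge0 phi p0 q0 r0 C0 repr).
- move=> e e0 he.
  have h1 := he 0%N isT; have h2 := he 1%N isT; have h3 := he 2%N isT.
  rewrite /= in h1 h2 h3.
  by apply: (meijer_smooth_le p0 q0 r0 C0 repr); lra.
- move=> [|[|[|//]]] _; apply: (meijer_smooth_lower p0 q0 r0 C0 n1 repr) => /=.
  + by left; ring.
  + by right; left; ring.
  + by right; right; split=> //; ring.
Qed.

(** The ratio is formed with b2, so b2 gives [p] and b1 gives [q]. For the reflected factor the
    condition 0 < r - (e - k) s reads a1 + phi < 1 + e; it follows from e >= 0 and a1 + phi < 1,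
    which for the model F is beta > 0. *)
Lemma fading_term_21 phi C (a1 a2 b1 b2 : R) : 0 < C -> a2 = b2 + 1 ->
  a1 - 1 < b1 -> a1 - 1 < b2 -> a1 + phi < 1 ->
  fading_term phi C 2 1 [:: a1; a2] [:: b1; b2].
Proof.
move=> C0 a2E hb1 hb2 ha.
have [c [c1 c2 c3 repr]] := meijer_repr_21 a2E hb1 hb2.
have p0 : 0 < b2 - c by rewrite subr_gt0.
have q0 : 0 < b1 - c by rewrite subr_gt0.
have r0 : 0 < 1 - a1 + c by lra.
have n1 : `|-1 : R| <= 1 by rewrite normrN1.
split.
- by move=> x0; exact: (integrable_meijer_smooth phi p0 q0 r0 C0 repr).
- by move=> x0; exact: (meijer_smooth_ge0 phi p0 q0 r0 C0 repr).
- move=> e e0 he.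
  have h1 := he 0%N isT; have h2 := he 1%N isT; rewrite /= in h1 h2.
  by apply: (meijer_smooth_le p0 q0 r0 C0 repr); lra.
- move=> [|[|//]] _; apply: (meijer_smooth_lower p0 q0 r0 C0 n1 repr) => /=.
  + by right; left; ring.
  + by left; ring.
Qed.

Definition tp_exponent X (l i : nat) : R := tp_phi X + (tp_b X l)`_i.

Record tp_regular X : Prop := {
  reg_psi : 0 < tp_psi X;
  reg_P : (0 < tp_P X)%N;
  reg_m : (0 < tp_m X)%N;
  reg_zeta : forall l, (0 < l)%N -> (l < (tp_P X).+1)%N -> 0 < tp_zeta X l;
  reg_exponent : forall l i, (0 < l)%N -> (i < tp_m X)%N -> 0 < tp_exponent X l i;
  reg_term : forall l, fading_term (tp_phi X) (tp_C X l) (tp_m X) (tp_n X)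
    (tp_a X l) (tp_b X l)
}.

Lemma tp_model_regular X : tp_model X -> tp_regular X.
Proof.
case=> [rho A0 alpha beta rho0 A00 al0 be0|
        rho A0 alpha beta g Omega rho0 A00 al0 be0 g0 Om0|
        rho A0 alpha beta rho0 A00 al0 be1].
- have G1 := rGamma_gt0 al0; have G2 := rGamma_gt0 be0.
  have r2 : 0 < rho ^+ 2 by rewrite exprn_gt0.
  split => //=.
  + by rewrite divr_gt0// !mulr_gt0.
  + by move=> l [|[|[|//]]] _ _; rewrite /tp_exponent /=; lra.
  + by move=> l; apply: fading_term_30; [rewrite divr_gt0// mulr_gt0|rewrite subrK].
- have G1 := rGamma_gt0 al0.
  have r2 : 0 < rho ^+ 2 by rewrite exprn_gt0.
  have b0 : 0 < beta%:R :> R by rewrite ltr0n.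
  have gO : 0 < g * beta%:R + Omega by rewrite addr_gt0// mulr_gt0.
  split => //=.
  + rewrite divr_gt0// mulr_gt0// /malaga_A mulr_gt0 ?powR_gt0//; last first.
      by rewrite divr_gt0// mulr_gt0.
    by rewrite divr_gt0// !mulr_gt0// powR_gt0.
  + move=> l l0 lb; rewrite /malaga_b !mulr_gt0 ?powR_gt0 ?exprn_gt0 ?divr_gt0 ?mulr_gt0//.
    (* The binomial weight is positive because l <= beta. *)
    rewrite ltr0n bin_gt0; case: l l0 lb => // l _ /=; rewrite ltnS.
    by case: (beta) be0.
  + move=> l [|[|[|//]]] l0 _; rewrite /tp_exponent /= add0r//.
    by rewrite ltr0n.
  + by move=> l; apply: fading_term_30 => //; rewrite divr_gt0 ?mulr_gt0.
- have be0 : 0 < beta by lra.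
  have G1 := rGamma_gt0 al0; have G2 := rGamma_gt0 be0.
  have r2 : 0 < rho ^+ 2 by rewrite exprn_gt0.
  have b1 : 0 < beta - 1 by lra.
  split => //=.
  + by rewrite divr_gt0// !mulr_gt0.
  + by move=> l [|[|//]] _ _; rewrite /tp_exponent /=; lra.
  + move=> l; apply: fading_term_21; [by rewrite divr_gt0// mulr_gt0|by rewrite subrK|lra|lra|lra].
Qed.

Lemma Rintegral_big (D : set R) (f : nat -> R -> R) (n : nat) : measurable D ->
  (forall l, mu.-integrable D (EFin \o f l)) ->
  mu.-integrable D (EFin \o (fun x => \sum_(1 <= l < n.+1) f l x)) /\
  Rintegral mu D (fun x => \sum_(1 <= l < n.+1) f l x) =
  \sum_(1 <= l < n.+1) Rintegral mu D (f l).
Proof.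
move=> mD fi; elim: n => [|n [IH1 IH2]].
  rewrite big_geq// (_ : (fun x => _) = fun=> 0); last first.
    by apply/funext => x; rewrite big_geq.
  split; first exact: integrable0.
  by rewrite /Rintegral integral0.
rewrite big_nat_recr//= -IH2 (_ : (fun x => \sum_(1 <= l < n.+2) f l x) =
  fun x => \sum_(1 <= l < n.+1) f l x + f n.+1 x); last first.
  by apply/funext => x; rewrite big_nat_recr.
split; last exact: (RintegralD _ IH1 (fi n.+1)).
exact: (integrableD _ IH1 (fi n.+1)).
Qed.

Variable X : tp_params R.
Hypothesis HX : tp_regular X.

Definition tp_smooth b : R := RI (fun x => tp_pdf X x * gauss (ln x - b)).

Let mD : measurable (`]0, +oo[%classic : set R). Proof. exact: measurable_itv. Qed.

Let J l b := Rintegral mu `]0, +oo[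
  (meijer_smooth (tp_m X) (tp_n X) (tp_a X l) (tp_b X l) (tp_phi X) (tp_C X l) b).

Lemma tp_smoothE b : integ (fun x => tp_pdf X x * gauss (ln x - b)) /\
  tp_smooth b = tp_psi X * \sum_(1 <= l < (tp_P X).+1) tp_zeta X l * J l b.
Proof.
pose f l x := tp_zeta X l * meijer_smooth (tp_m X) (tp_n X) (tp_a X l) (tp_b X l)
  (tp_phi X) (tp_C X l) b x.
have fi l : mu.-integrable `]0, +oo[ (EFin \o f l).
  exact: (integrableZl _ (tp_zeta X l) (term_integrable (reg_term HX l) b)).
have [Si SE] := Rintegral_big (tp_P X) mD fi.
have E : (fun x => tp_pdf X x * gauss (ln x - b)) =
    (fun x => tp_psi X * \sum_(1 <= l < (tp_P X).+1) f l x) \_ `]0, +oo[.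
  apply/funext => x; rewrite patchE /tp_pdf; case: ifPn => x0; last first.
    by rewrite memNset ?mul0r//= in_itv/= andbT; exact/negP.
  rewrite mem_set; last by rewrite /= in_itv/= x0.
  rewrite -!mulrA; congr (_ * _).
  rewrite mulr_suml mulr_sumr; apply: eq_bigr => l _.
  rewrite /f /meijer_smooth; ring.
have i2 : mu.-integrable `]0, +oo[ (EFin \o (fun x => tp_psi X * \sum_(1 <= l < (tp_P X).+1) f l x)).
  exact: (integrableZl _ (tp_psi X) Si).
split.
  rewrite E /integ -restrict_EFin; apply: (iffLR (integrable_mkcond _ _)); last exact: i2.
  exact: measurable_itv.
rewrite /tp_smooth /RI E -Rintegral_mkcond.
have -> : Rintegral mu `]0, +oo[ (fun x => tp_psi X * \sum_(1 <= l < (tp_P X).+1) f l x) =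
  tp_psi X * Rintegral mu `]0, +oo[ (fun x => \sum_(1 <= l < (tp_P X).+1) f l x).
  exact: (RintegralZl (tp_psi X) _ Si).
rewrite SE; congr (_ * _); apply: eq_bigr => l _.
exact: (RintegralZl _ _ (term_integrable (reg_term HX l) b)).
Qed.

Lemma tp_smooth_le e : 0 <= e ->
  (forall l i, (0 < l)%N -> (l < (tp_P X).+1)%N -> (i < tp_m X)%N -> e < tp_exponent X l i) ->
  exists2 K, 0 <= K & forall b, tp_smooth b <= K * expR (e * b).
Proof.
move=> e0 he.
suff [K K0 hK] : exists2 K, 0 <= K & forall b,
    \sum_(1 <= l < (tp_P X).+1) tp_zeta X l * J l b <= K * expR (e * b).
  exists (tp_psi X * K); first by rewrite mulr_ge0// ltW// (reg_psi HX).
  move=> b; have [_ ->] := tp_smoothE b.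
  by rewrite -mulrA ler_wpM2l// ltW// (reg_psi HX).
(* Induction on the number of terms kept; the bound by [tp_P X] is carried along so that the
   hypotheses on the indices still apply. *)
have : (tp_P X <= tp_P X)%N by [].
elim: {1 3}(tp_P X) => [|n IH] nP.
  by exists 0 => // b; rewrite big_geq// mul0r.
have [K K0 hK] := IH (ltnW nP).
have zn : 0 < tp_zeta X n.+1 by apply: (reg_zeta HX).
have [K1 K10 hK1] := term_le (reg_term HX n.+1) e0 (fun i im => he n.+1 i isT nP im).
exists (K + tp_zeta X n.+1 * K1); first by rewrite addr_ge0// mulr_ge0// ltW.
move=> b; rewrite big_nat_recr//= mulrDl lerD// -mulrA ler_wpM2l ?hK1//.
exact: ltW.
Qed.

(** All smoothed terms are nonnegative and all weights positive, so the sum dominates its l-th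
    term. *)
Lemma tp_smooth_lower l i : (0 < l)%N -> (l < (tp_P X).+1)%N -> (i < tp_m X)%N ->
  exists2 c, 0 < c & exists b0, forall b, b <= b0 ->
    c * expR (tp_exponent X l i * b) <= tp_smooth b.
Proof.
move=> l0 lP im; have [c c0 [b0 hb]] := term_lower (reg_term HX l) im.
have z0 := reg_zeta HX l0 lP; have psi0 := reg_psi HX.
exists (tp_psi X * (tp_zeta X l * c)); first by rewrite !mulr_gt0.
exists b0 => b bb0; have [_ ->] := tp_smoothE b.
rewrite -mulrA ler_wpM2l ?(ltW psi0)// -mulrA.
rewrite (bigD1_seq l) /= ?iota_uniq ?mem_index_iota ?l0//=.
apply: (@le_trans _ _ (tp_zeta X l * J l b)).
  by rewrite ler_wpM2l ?(ltW z0)// hb.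
rewrite lerDl big_seq_cond; apply: sumr_ge0 => j; rewrite mem_index_iota => /andP[/andP[j0 jP] _].
by rewrite mulr_ge0 ?(term_ge0 (reg_term HX j))// ltW// (reg_zeta HX).
Qed.

End fading_models.

(** * Distribution functions near 0 *)

Section density_facts.
Variables (R : realType) (d : measure_display) (T : measurableType d).
Variable Pr : probability T R.
Local Notation mu := (@lebesgue_measure R).
Implicit Types (Y : {RV Pr >-> R}) (f : R -> R) (b c r K x : R).

(** A unit interval in ln x; half-open, so that those at b, b - 1, b - 2, ... tile []0, expR b]]. *)
Definition annulus b : set R := `]expR (b - 1), expR b].

Definition prob Y (A : set R) : R := fine (Pr (Y @^-1` A)).

Lemma prob_measurable Y (A : set R) : measurable A -> measurable (Y @^-1` A).
Proof. by move=> mA; rewrite -[_ @^-1` _]setTI; exact: measurable_funPT. Qed.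

Lemma EFin_prob Y A : measurable A -> (prob Y A)%:E = Pr (Y @^-1` A).
Proof.
by move=> mA; rewrite fineK//; apply: fin_num_measure; exact: prob_measurable.
Qed.

Lemma prob_ge0 Y A : 0 <= prob Y A. Proof. exact: fine_ge0. Qed.

Lemma density_integ Y f : has_density Y f -> integ f /\ RI f = 1.
Proof.
move=> [mf f0 fE]; have E : (\int[mu]_x (f x)%:E = 1)%E.
  rewrite -(fE setT measurableT) /distribution /pushforward preimage_setT.
  exact: probability_setT.
split; last by rewrite /RI /Rintegral E.
by apply: integ_ge0P => //; rewrite E ltry.
Qed.

Lemma integ_mul_indic f (A : set R) : integ f -> measurable A ->
  integ (fun x => f x * \1_A x).
Proof.
move=> fi mA; apply: (integM (B := 1) fi); first exact: measurable_indic.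
by move=> x; rewrite indicE; case: (_ \in _); rewrite /= ?normr1 ?normr0.
Qed.

Lemma probE Y f A : has_density Y f -> measurable A ->
  prob Y A = RI (fun x => f x * \1_A x).
Proof.
move=> hY mA; have [mf f0 fE] := hY; have [fi _] := density_integ hY.
rewrite /prob; have := fE A mA; rewrite /distribution /pushforward => ->.
rewrite integral_mkcond; congr fine; apply: eq_integral => x _.
by rewrite patchE indicE; case: (x \in A); rewrite ?mulr1 ?mulr0.
Qed.

Lemma prob_full Y f A : has_density Y f -> measurable A ->
  (forall x, ~ A x -> f x = 0) -> prob Y A = 1.
Proof.
move=> hY mA fA; have [_ <-] := density_integ hY; rewrite (probE hY mA).
apply: RI_ext => x; rewrite indicE; have [_|] := boolP (x \in A).
  by rewrite mulr1.
by rewrite notin_setE => /fA ->; rewrite mul0r.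
Qed.

Lemma RI_indic_oc x0 x1 : x0 < x1 ->
  integ (\1_`]x0, x1] : R -> R) /\ RI (\1_`]x0, x1] : R -> R) = x1 - x0.
Proof.
move=> x01; split; first exact: integrable_indic_itv.
rewrite /RI /Rintegral integral_indic// setIT.
have E : (mu `]x0, x1]%classic = (x1 - x0)%:E).
  by rewrite lebesgue_measure_itv/= lte_fin x01 EFinB.
by change (fine (mu `]x0, x1]%classic) = x1 - x0); rewrite E.
Qed.

Let annulus_len b : expR (b - 1) < expR b.
Proof. by rewrite ltr_expR ltrBlDr ltrDl. Qed.

Lemma measurable_annulus b : measurable (annulus b).
Proof. exact: measurable_itv. Qed.

Lemma annulusP b x : annulus b x <-> 0 < x /\ b - 1 < ln x <= b.
Proof.
rewrite /annulus /= in_itv/=; split => [/andP[h1 h2]|[x0 /andP[h1 h2]]].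
  have x0 : 0 < x by exact: lt_trans (expR_gt0 _) h1.
  by split=> //; rewrite -ltr_expR -(ler_expR (ln x)) !lnK ?posrE ?h1.
by rewrite -{1}[x]lnK ?posrE// ltr_expR h1 /= -[x]lnK ?posrE// ler_expR.
Qed.

Lemma prob_annulus_le Y f b K : has_density Y f -> 0 <= K ->
  (forall x, annulus b x -> f x <= K) -> prob Y (annulus b) <= K * expR b.
Proof.
move=> hY K0 fK; have [mf f0 _] := hY; have [fi _] := density_integ hY.
have [i1 E1] := RI_indic_oc (annulus_len b).
rewrite (probE hY (measurable_annulus b)).
apply: (@le_trans _ _ (RI (fun x => K * \1_(annulus b) x))).
  apply: RI_le; [exact: integ_mul_indic (measurable_annulus b)|exact: integZ|] => x.
  rewrite indicE; have [xA|_] := boolP (x \in annulus b); last by rewrite !mulr0.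
  by rewrite !mulr1 fK//; move: xA; rewrite inE.
rewrite (RIZ K i1) E1 ler_wpM2l// lerBlDr lerDl; exact: expR_ge0.
Qed.

Lemma prob_annulus_ge Y f b K : has_density Y f -> 0 <= K ->
  (forall x, annulus b x -> K <= f x) ->
  K * (1 - expR (-1)) * expR b <= prob Y (annulus b).
Proof.
move=> hY K0 fK; have [mf f0 _] := hY; have [fi _] := density_integ hY.
have [i1 E1] := RI_indic_oc (annulus_len b).
rewrite (probE hY (measurable_annulus b)).
apply: (@le_trans _ _ (RI (fun x => K * \1_(annulus b) x))).
  rewrite (RIZ K i1) E1 -mulrA ler_wpM2l// expRD le_eqVlt; apply/orP; left.
  by apply/eqP; ring.
apply: RI_le; [exact: integZ|exact: integ_mul_indic (measurable_annulus b)|] => x.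
rewrite indicE; have [xA|_] := boolP (x \in annulus b); last by rewrite !mulr0.
by rewrite !mulr1 fK//; move: xA; rewrite inE.
Qed.

Lemma expRN1_lt1 : expR (- (1 : R)) < 1.
Proof. by rewrite expR_lt1 ltrN10. Qed.

Lemma prob_bigcup_le (A : set T) (B : nat -> set T) K (rho : R) :
  measurable A -> (forall k, measurable (B k)) -> A `<=` \bigcup_k B k ->
  0 <= K -> 0 <= rho -> rho < 1 ->
  (forall k, (Pr (B k) <= (K * rho ^+ k)%:E)%E) ->
  (Pr A <= (K / (1 - rho))%:E)%E.
Proof.
move=> mA mB AB K0 rho0 rho1 hB.
have r1 : 0 < 1 - rho by rewrite subr_gt0.
apply: le_trans (measure_sigma_subadditive _ mB mA AB) _.
apply: lime_le; first by apply: is_cvg_nneseries => n _ _; exact: measure_ge0.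
apply: nearW => n.
have : (\sum_(0 <= k < n) Pr (B k) <= (K * (1 - rho ^+ n) / (1 - rho))%:E)%E.
  elim: n => [|n IH]; first by rewrite big_geq// expr0 subrr mulr0 mul0r.
  rewrite big_nat_recr//=; apply: le_trans (leeD IH (hB n)) _.
  rewrite -EFinD lee_fin le_eqVlt; apply/orP; left; apply/eqP.
  by rewrite exprS; field; rewrite gt_eqF.
move=> h; apply: le_trans h _; rewrite lee_fin ler_wpM2r ?invr_ge0 ?(ltW r1)//.
by rewrite ler_piMr// lerBlDr lerDl exprn_ge0.
Qed.

(** Summation over the tiling annuli is a geometric series of ratio exp (- r). *)
Lemma prob_tail_le Y K r : 0 <= K -> 0 < r ->
  (forall b, prob Y (annulus b) <= K * expR (r * b)) ->
  forall b, prob Y `]0, expR b] <= K / (1 - expR (- r)) * expR (r * b).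
Proof.
move=> K0 r0 hA b; rewrite -lee_fin EFin_prob; last exact: measurable_itv.
rewrite mulrAC; apply: (@prob_bigcup_le _ (fun k => Y @^-1` annulus (b - k%:R))).
- by apply: prob_measurable; exact: measurable_itv.
- by move=> k; apply: prob_measurable; exact: measurable_annulus.
- move=> w /=; rewrite in_itv/= => /andP[w0 wb].
  have lb : ln (Y w) <= b by rewrite -ler_expR lnK.
  have /andP[h1 h2] := truncn_itv (etrans (subr_ge0 _ _) lb).
  exists (Num.truncn (b - ln (Y w))) => //; apply/annulusP; split=> //.
  by move: h2; rewrite -natr1 => h2; apply/andP; split; lra.
- by rewrite mulr_ge0 ?expR_ge0.
- exact: expR_ge0.
- by rewrite expR_lt1 oppr_lt0.
- move=> k; rewrite -EFin_prob ?lee_fin; last exact: measurable_annulus.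
  apply: le_trans (hA _) _; rewrite -mulrA ler_wpM2l//.
  rewrite -expRM_natr -expRD ler_expR le_eqVlt; apply/orP; left; apply/eqP; ring.
Qed.

Lemma ln_annulus_exp b x : annulus b x -> [/\ 0 < x, b - 1 < ln x & ln x <= b].
Proof. by move=> /annulusP[x0 /andP[]]. Qed.

(** * A law compared with its Gaussian smoothing *)

Section gauss_smoothing.
Variables (Y : {RV Pr >-> R}) (f : R -> R).
Hypothesis hY : has_density Y f.
Hypothesis f_neg : forall x, x <= 0 -> f x = 0.

Let smooth b : R := RI (fun x => f x * gauss (ln x - b)).

Let f0 x : 0 <= f x. Proof. by have [_ + _] := hY; exact. Qed.

Lemma integ_gauss_ln b : integ (fun x => f x * gauss (ln x - b)).
Proof.
have [fi _] := density_integ hY; apply: (integM (B := 1) fi).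
  apply: measurableT_comp.
    by apply: continuous_measurable_fun; exact: continuous_gauss.
  by apply: measurable_funB => //; exact: measurable_ln.
by move=> x; rewrite ger0_norm ?gauss_le1// ltW// gauss_gt0.
Qed.

(** On the annulus |ln x - b| <= 1, so the Gaussian is at least exp (- 1 / 2). *)
Lemma prob_annulus_smooth b : prob Y (annulus b) <= expR (1 / 2) * smooth b.
Proof.
have [fi _] := density_integ hY; have gi := integ_gauss_ln b.
rewrite (probE hY (measurable_annulus b)) -(RIZ _ gi).
apply: RI_le; [exact: integ_mul_indic (measurable_annulus b)|exact: integZ|] => x.
rewrite mulrCA indicE; have [xA|_] := boolP (x \in annulus b); last first.
  by rewrite mulr0 mulr_ge0// mulr_ge0 ?expR_ge0// ltW// gauss_gt0.
rewrite ler_wpM2l//= -expRD -[leLHS]expR0 ler_expR.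
move: xA; rewrite inE => /ln_annulus_exp[_ h1 h2].
rewrite mulNr; have : (ln x - b) ^+ 2 <= 1.
  by nra.
lra.
Qed.

(** Cut at ln x = b + K: below, the Gaussian is at most 1; above, it is at most exp (- K^2 / 2) and
    the total mass is 1. *)
Lemma smooth_le_prob b K : 0 <= K ->
  smooth b <= prob Y `]0, expR (b + K)] + expR (- (K ^+ 2 / 2)).
Proof.
move=> K0; have [fi f1] := density_integ hY; have gi := integ_gauss_ln b.
have mA : measurable (`]0, expR (b + K)]%classic : set R) by exact: measurable_itv.
have ii := integ_mul_indic fi mA.
have ei := integZ (expR (- (K ^+ 2 / 2))) fi.
have e : expR (- (K ^+ 2 / 2)) = RI (fun x => expR (- (K ^+ 2 / 2)) * f x).
  by rewrite (RIZ _ fi) f1 mulr1.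
rewrite (probE hY mA) e -(RID ii ei).
apply: RI_le => //; first exact: integD.
move=> x; have [x0|x0] := leP x 0; first by rewrite f_neg// !mul0r mulr0 addr0.
rewrite indicE; have [xA|] := boolP (x \in _).
  rewrite mulr1 -[leLHS]addr0 lerD//; last by rewrite mulr_ge0 ?expR_ge0.
  by rewrite ler_piMr// gauss_le1.
rewrite notin_setE /= in_itv/= x0/= => /negP; rewrite -ltNge => xb.
rewrite mulr0 add0r mulrC ler_wpM2r// ler_expR mulNr lerN2 ler_wpM2r//.
have : b + K < ln x by rewrite -ltr_expR lnK.
by move=> h; rewrite lerXn2r ?nnegrE//; lra.
Qed.

End gauss_smoothing.

End density_facts.

(** * Distribution functions of the two gains *)

Section fading_tails.
Variables (R : realType) (d : measure_display) (T : measurableType d).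
Variable Pr : probability T R.
Implicit Types (Y : {RV Pr >-> R}) (b c r v x K e : R).

Lemma tp_tail_le (X : tp_params R) Y e : tp_regular X -> has_density Y (tp_pdf X) ->
  0 < e ->
  (forall l i, (0 < l)%N -> (l < (tp_P X).+1)%N -> (i < tp_m X)%N -> e < tp_exponent X l i) ->
  exists2 K, 0 <= K & forall b, prob Y `]0, expR b] <= K * expR (e * b).
Proof.
move=> HX hY e0 he; have [K K0 hK] := tp_smooth_le HX (ltW e0) he.
exists (expR (1 / 2) * K / (1 - expR (- e))).
  by rewrite divr_ge0 ?mulr_ge0 ?expR_ge0// subr_ge0 expR_le1 oppr_le0 ltW.
apply: prob_tail_le => //; first by rewrite mulr_ge0 ?expR_ge0.
move=> b; apply: le_trans (prob_annulus_smooth hY b) _.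
by rewrite -mulrA ler_wpM2l ?expR_ge0//; exact: hK.
Qed.

Lemma tp_pdf_neg (X : tp_params R) x : x <= 0 -> tp_pdf X x = 0.
Proof. by rewrite /tp_pdf ltNge => ->. Qed.

(* The smoothed density at (1 + delta) b is compared with the Gaussian tail
   exp (- (delta b)^2 / 2), which is negligible against exp ((e + eps) b). *)
Lemma tp_tail_ge (X : tp_params R) Y l i eps : tp_regular X ->
  has_density Y (tp_pdf X) ->
  (0 < l)%N -> (l < (tp_P X).+1)%N -> (i < tp_m X)%N -> 0 < eps ->
  exists2 c, 0 < c & exists b1, forall b, b <= b1 ->
    c * expR ((tp_exponent X l i + eps) * b) <= prob Y `]0, expR b].
Proof.
move=> HX hY l0 lP im eps0.
have [c c0 [b0 hb]] := tp_smooth_lower HX l0 lP im.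
have := reg_exponent HX l0 im; set m := tp_exponent X l i => m0.
(* Chosen so that (1 + dl) m = m + eps. *)
pose dl := eps / m; have dl0 : 0 < dl by rewrite divr_gt0.
pose L := ln (c / 2); pose nu := m + eps; have nu0 : 0 < nu by rewrite addr_gt0.
(* For -b above the second entry, (dl b)^2 / 2 >= (nu + |L|) (-b), and -b >= 1 absorbs the constant
   L. The Gaussian tail then costs at most half of the main term. *)
pose B1 := Num.max 1 (2 / dl ^+ 2 * (nu + `|L|)).
exists (c / 2); first by rewrite divr_gt0.
exists (Num.min b0 (- B1)) => b; rewrite le_min => /andP[bb0 bB1].
have B11 : 1 <= B1 by rewrite le_max lexx.
have B12 : 2 / dl ^+ 2 * (nu + `|L|) <= B1 by rewrite le_max lexx orbT.
have bneg : b <= -1 by lra.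
have K0 : 0 <= - (dl * b) by rewrite -mulrN mulr_ge0 ?(ltW dl0)//; lra.
have := smooth_le_prob hY (@tp_pdf_neg X) (b - - (dl * b)) K0.
rewrite subrK => h.
have hlow : c * expR (nu * b) <= tp_smooth X (b - - (dl * b)).
  have -> : nu * b = m * (b - - (dl * b)).
    by rewrite /nu /dl; field; rewrite gt_eqF.
  by apply: hb; rewrite opprK; have := mulr_ge0 (ltW dl0) (ltW (ltr01 : 0 < 1 :> R)); nra.
have htail : expR (- ((- (dl * b)) ^+ 2 / 2)) <= c / 2 * expR (nu * b).
  have -> : c / 2 = expR L by rewrite lnK// posrE divr_gt0.
  rewrite -expRD ler_expR sqrrN exprMn.
  have d2 : 0 < dl ^+ 2 by rewrite exprn_gt0.
  have h1 : 2 * (nu + `|L|) <= dl ^+ 2 * - b.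
    have : 2 / dl ^+ 2 * (nu + `|L|) <= - b by lra.
    by rewrite mulrAC ler_pdivrMr// [_ * dl ^+ 2]mulrC.
  have h2 : 2 * (nu + `|L|) * - b <= dl ^+ 2 * b ^+ 2.
    have bp : 0 <= - b by lra.
    by rewrite (_ : dl ^+ 2 * b ^+ 2 = dl ^+ 2 * - b * - b) ?ler_wpM2r//; ring.
  have h3 : - L <= `|L| by rewrite -normrN ler_norm.
  have := normr_ge0 L; nra.
move: (le_trans hlow h) htail; rewrite -/nu.
by move: (expR (nu * b)) (expR (- _)) => *; lra.
Qed.

Lemma exprn_le_expR (u : R) n : 0 <= u -> u ^+ n <= n`!%:R * expR u.
Proof.
move=> u0; case: n => [|n]; first by rewrite expr0 mul1r -expR0 ler_expR.
have := expR_ge1Dxn n u0 => h.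
have f0 : 0 < (n.+1)`!%:R :> R by rewrite ltr0n fact_gt0.
rewrite mulrC -ler_pdivrMr//; by apply: le_trans h; rewrite lerDr.
Qed.

Section fog.
Variables (Y : {RV Pr >-> R}) (v : R) (k : nat).
Hypotheses (v0 : 0 < v) (k0 : (0 < k)%N) (hY : has_density Y (fog_pdf v k)).

Let A := v ^+ k / rGamma (k%:R : R).

Let A0 : 0 < A.
Proof. by rewrite divr_gt0 ?exprn_gt0// rGamma_gt0// ltr0n. Qed.

Lemma fog_pdfE b x : b <= 0 -> annulus b x ->
  fog_pdf v k x = A * (- ln x) ^+ k.-1 * expR ((v - 1) * ln x).
Proof.
move=> b0 /ln_annulus_exp[x0 _ xb]; rewrite /fog_pdf x0 /=.
have -> : x <= 1 by rewrite -[x]lnK// -expR0 ler_expR (le_trans xb).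
by rewrite /powR gt_eqF// div1r lnV.
Qed.

(** The power of the logarithm is absorbed by x^(r - v), which is why r stays below v. The factor
    exp 1 covers the variation of x^(r - 1) over the annulus. *)
Lemma fog_annulus_le r : 0 <= r -> r < v ->
  exists2 K, 0 <= K & forall b, b <= 0 -> prob Y (annulus b) <= K * expR (r * b).
Proof.
move=> r0 rv; pose dl := v - r; have dl0 : 0 < dl by rewrite subr_gt0.
pose C := (k.-1)`!%:R / dl ^+ k.-1.
have C0 : 0 <= C by rewrite divr_ge0// exprn_ge0// ltW.
have AC0 : 0 <= A * C by exact: mulr_ge0 (ltW A0) C0.
have ACe0 : 0 <= A * C * expR 1 by exact: mulr_ge0 AC0 (expR_ge0 1).
exists (A * C * expR 1) => //.
move=> b b0.
have K0 := mulr_ge0 ACe0 (expR_ge0 ((r - 1) * b)).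
have := prob_annulus_le (b := b) hY K0.
rewrite -[_ * _ * expR b]mulrA -expRD (_ : (r - 1) * b + b = r * b); last by ring.
apply=> x xA; rewrite (fog_pdfE b0 xA).
have [x0 h1 h2] := ln_annulus_exp xA.
have w0 : 0 <= - ln x by lra.
have hpow : (- ln x) ^+ k.-1 <= C * expR (dl * - ln x).
  have := exprn_le_expR k.-1 (mulr_ge0 (ltW dl0) w0).
  rewrite exprMn /C mulrAC ler_pdivlMr ?exprn_gt0//.
  by rewrite [_ * dl ^+ _]mulrC.
apply: (@le_trans _ _ (A * (C * expR (dl * - ln x)) * expR ((v - 1) * ln x))).
  by rewrite ler_wpM2r ?expR_ge0// ler_wpM2l// ltW.
have E1 (a c e1 e2 : R) : a * (c * e1) * e2 = a * c * (e1 * e2) by ring.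
rewrite E1 -(mulrA (A * C)) -!expRD ler_wpM2l// ler_expR /dl.
have := ler_wpM2l r0 h2; lra.
Qed.

(** For b <= -1 one has -ln x >= 1 on the annulus, so the power of the logarithm is at least 1. *)
Lemma fog_annulus_ge :
  exists2 c, 0 < c & forall b, b <= -1 -> c * expR (v * b) <= prob Y (annulus b).
Proof.
have e1 : 0 < 1 - expR (- (1 : R)) by rewrite subr_gt0; exact: expRN1_lt1.
exists (A * expR (- v) * (1 - expR (-1))).
  exact: mulr_gt0 (mulr_gt0 A0 (expR_gt0 _)) e1.
move=> b b1; have b0 : b <= 0 by lra.
have K0 : 0 <= A * expR (v * (b - 1)) * expR (- b).
  exact: mulr_ge0 (mulr_ge0 (ltW A0) (expR_ge0 _)) (expR_ge0 _).
have := prob_annulus_ge (b := b) hY K0.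
have -> : A * expR (v * (b - 1)) * expR (- b) * (1 - expR (-1)) * expR b =
    A * expR (- v) * (1 - expR (-1)) * expR (v * b).
  have -> : v * (b - 1) = - v + v * b by ring.
  rewrite expRD [expR (- b)]expRN; have := expR_gt0 b.
  move: (1 - _) (expR (- v)) (expR (v * b)) (expR b) => *; field.
  by rewrite gt_eqF.
apply=> x xA; rewrite (fog_pdfE b0 xA).
have [x0 h1 h2] := ln_annulus_exp xA.
have p1 : 1 <= (- ln x) ^+ k.-1 by rewrite exprn_ege1//; lra.
rewrite -(mulrA A) -expRD -(mulrA A) ler_wpM2l ?(ltW A0)//.
apply: (@le_trans _ _ (expR ((v - 1) * ln x))); last by rewrite ler_peMl ?expR_ge0.
rewrite ler_expR; have := ler_wpM2l (ltW v0) (ltW h1); lra.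
Qed.

End fog.

(** * Outage probability of the product *)

Section outage_bounds.
Variables (X : tp_params R) (v gth : R) (k t : nat) (htp hf h : {RV Pr >-> R}).
Hypotheses (HX : tp_regular X) (v0 : 0 < v) (k0 : (0 < k)%N) (t0 : (0 < t)%N).
Hypotheses (gth0 : 0 < gth).
Hypotheses (dtp : has_density htp (tp_pdf X)) (df : has_density hf (fog_pdf v k)).
Hypotheses (ind : independent_RV htp hf) (hE : forall w, h w = htp w * hf w).

(** The logarithm of the largest h > 0 in outage. *)
Definition outage_exponent (g : R) : R := (ln gth - ln g) / t%:R.

Let E g : set T := [set w | g * h w ^+ t <= gth].
Let tR : 0 < t%:R :> R. Proof. by rewrite ltr0n. Qed.

Let mE g : measurable (E g).
Proof.
have mf : measurable_fun setT (fun w => g * h w ^+ t).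
  by apply: measurable_funM => //; apply: measurable_funX.
rewrite (_ : E g = setT `&` (fun w => g * h w ^+ t) @^-1` `]-oo, gth]); last first.
  by rewrite setTI; apply/seteqP; split => w /=; rewrite in_itv.
by apply: mf => //; exact: measurable_itv.
Qed.

Let EP g w : 0 < g -> 0 < htp w -> 0 < hf w ->
  E g w <-> ln (htp w) + ln (hf w) <= outage_exponent g.
Proof.
move=> g0 a0 b0; have h0 : 0 < h w by rewrite hE mulr_gt0.
rewrite -lnM ?posrE// -hE /outage_exponent ler_pdivlMr//.
rewrite /E /= -(@ler_ln _ (_ * _)) ?posrE ?mulr_gt0 ?exprn_gt0//.
rewrite lnM ?posrE ?exprn_gt0// lnXn// -mulr_natr.
by split=> ?; lra.
Qed.

(** The almost sure event on which both logarithms are meaningful. *)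
Let good : set T := htp @^-1` `]0, +oo[ `&` hf @^-1` `]0, 1].

Let mgood : measurable good.
Proof. by apply: measurableI; apply: prob_measurable; exact: measurable_itv. Qed.

Let prob_hf : prob hf `]0, 1] = 1.
Proof.
apply: (prob_full df); first exact: measurable_itv.
by move=> x; rewrite /= in_itv/= /fog_pdf; case: ifP.
Qed.

Let prob_htp : prob htp `]0, +oo[ = 1.
Proof.
apply: (prob_full dtp); first exact: measurable_itv.
by move=> x; rewrite /= in_itv/= andbT /tp_pdf; case: ifP.
Qed.

Let indE A B : measurable A -> measurable B ->
  Pr (htp @^-1` A `&` hf @^-1` B) = (prob htp A * prob hf B)%:E.
Proof. by move=> mA mB; rewrite ind// EFinM !EFin_prob. Qed.

Let Pr_good : Pr good = 1%E.
Proof. by rewrite indE ?prob_htp ?prob_hf ?mulr1//; exact: measurable_itv. Qed.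

Let Pr_E_good g : Pr (E g) = Pr (E g `&` good).
Proof.
have n0 : Pr (~` good) = 0%E by rewrite probability_setC// Pr_good subee.
have Z : Pr (E g `\` good) = 0%E.
  apply/eqP; rewrite eq_le measure_ge0 andbT -n0.
  apply: le_measure; rewrite ?inE; [exact: measurableD|exact: measurableC|].
  by move=> w [].
apply: etrans (measureDI Pr (mE g) mgood) _.
by apply: etrans (congr1 (fun z => (z + _)%E) Z) _; rewrite add0e.
Qed.

Let EFin_outage g : (outage Pr h t gth g)%:E = Pr (E g).
Proof. by rewrite /outage fineK//; apply: fin_num_measure; exact: mE. Qed.

Lemma outage_le r : 0 < r -> r < v ->
  (forall l i, (0 < l)%N -> (l < (tp_P X).+1)%N -> (i < tp_m X)%N -> r < tp_exponent X l i) ->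
  exists2 K, 0 <= K & forall g, 0 < g ->
    outage Pr h t gth g <= K * expR (r * outage_exponent g).
Proof.
move=> r0 rv he; have [K1 K10 hK1] := tp_tail_le HX dtp r0 he.
(* The turbulence bound grows like exp (r j) while the fog annulus decays like exp (- r' j):
   summability needs a rate strictly between r and v. *)
pose r' := (r + v) / 2; have rr' : r < r' by rewrite /r'; lra.
have r'v : r' < v by rewrite /r'; lra.
have [K2 K20 hK2] := fog_annulus_le v0 k0 df (ltW (lt_trans r0 rr')) r'v.
pose rho := expR (- (r' - r)).
have rho1 : rho < 1 by rewrite expR_lt1 oppr_lt0 subr_gt0.
exists (K1 * K2 * expR r / (1 - rho)).
  by rewrite divr_ge0 ?mulr_ge0 ?expR_ge0// subr_ge0 ltW.
move=> g g0; rewrite -lee_fin EFin_outage Pr_E_good mulrAC.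
pose y := outage_exponent g.
(* On the j-th annulus ln h^(f) > - j - 1, hence the j + 1 in the bound on the turbulence gain. *)
apply: (@prob_bigcup_le _ _ _ _ _ (fun j => htp @^-1` `]0, expR (y + (j%:R + 1))] `&`
  hf @^-1` annulus (- j%:R))).
- exact: measurableI.
- move=> j; apply: measurableI; apply: prob_measurable; first exact: measurable_itv.
  exact: measurable_annulus.
- move=> w [Ew [/=]]; rewrite !in_itv/= andbT => a0 /andP[b0 b1].
  have := (EP g0 a0 b0).1 Ew; rewrite -/y => hy.
  have lb : 0 <= - ln (hf w) by rewrite oppr_ge0 ln_le0.
  have /andP[h1 h2] := truncn_itv lb.
  exists (Num.truncn (- ln (hf w))) => //; move: h2; rewrite -natr1 => h2; split.
    by rewrite /= in_itv/= a0 -[htp w]lnK// ler_expR; lra.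
  by apply/annulusP; split=> //; apply/andP; split; lra.
- by rewrite !mulr_ge0 ?expR_ge0.
- exact: expR_ge0.
- by [].
- move=> j; rewrite indE; [|exact: measurable_itv|exact: measurable_annulus].
  rewrite lee_fin.
  have jn : - (j%:R : R) <= 0 by rewrite oppr_le0.
  apply: (@le_trans _ _ (K1 * expR (r * (y + (j%:R + 1))) * (K2 * expR (r' * - j%:R)))).
    by apply: ler_pM; rewrite ?prob_ge0//; exact: hK2.
  have -> : r * (y + (j%:R + 1)) = r * y + r + r * j%:R by ring.
  rewrite /rho -expRM_natr (_ : - (r' - r) * j%:R = r * j%:R + r' * - j%:R); last by ring.
  rewrite !expRD le_eqVlt; apply/orP; left; apply/eqP; ring.
Qed.

Let outage_ge_prob g A B : measurable A -> measurable B ->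
  (htp @^-1` A `&` hf @^-1` B `<=` E g) ->
  prob htp A * prob hf B <= outage Pr h t gth g.
Proof.
move=> mA mB AB; rewrite -lee_fin EFin_outage -indE//.
apply: le_measure; rewrite ?inE//.
by apply: measurableI; exact: prob_measurable.
Qed.

(** The fog gain is at most 1, so a small turbulence gain alone forces an outage. *)
Lemma outage_ge_tp l i eps : (0 < l)%N -> (l < (tp_P X).+1)%N -> (i < tp_m X)%N ->
  0 < eps ->
  exists2 c, 0 < c & exists y0, forall g, 0 < g -> outage_exponent g <= y0 ->
    c * expR ((tp_exponent X l i + eps) * outage_exponent g) <= outage Pr h t gth g.
Proof.
move=> l0 lP im eps0; have [c c0 [b1 hb]] := tp_tail_ge HX dtp l0 lP im eps0.
exists c => //; exists b1 => g g0 gb; apply: le_trans (hb _ gb) _.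
rewrite -[leLHS]mulr1 -prob_hf; apply: outage_ge_prob; try exact: measurable_itv.
move=> w [/=]; rewrite !in_itv/= => /andP[a0 a1] /andP[h0 h1].
apply/(EP g0 a0 h0); rewrite -[leRHS]addr0 lerD ?ln_le0//.
by rewrite -ler_expR lnK.
Qed.

Lemma outage_ge_fog :
  exists2 c, 0 < c & exists y0, forall g, 0 < g -> outage_exponent g <= y0 ->
    c * expR (v * outage_exponent g) <= outage Pr h t gth g.
Proof.
(* This serves to find a level [b1] below which ln h^(tp) lies with positive probability [Q]; any
   exponent and any loss would do. *)
have [c c0 [b1 hb]] := tp_tail_ge HX dtp (ltn0Sn 0) (reg_P HX) (reg_m HX) ltr01.
have [c' c'0 hc'] := fog_annulus_ge v0 k0 df.
set Q := prob htp `]0, expR b1].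
have Q0 : 0 < Q by apply: lt_le_trans (hb _ (lexx _)); rewrite mulr_gt0 ?expR_gt0.
exists (Q * (c' * expR (- (v * b1)))); first by rewrite !mulr_gt0 ?expR_gt0.
exists (b1 - 1) => g g0 gb; set y := outage_exponent g in gb *.
apply: (@le_trans _ _ (Q * prob hf (annulus (y - b1)))).
  rewrite -mulrA ler_wpM2l ?(ltW Q0)// -mulrA -expRD.
  rewrite (_ : - (v * b1) + v * y = v * (y - b1)); last by ring.
  by apply: hc'; lra.
apply: outage_ge_prob; [exact: measurable_itv|exact: measurable_annulus|].
move=> w [/=]; rewrite in_itv/= => /andP[a0 a1] /ln_annulus_exp[h0 _ h1].
have h2 : ln (htp w) <= b1 by rewrite -ler_expR lnK.
by apply/(EP g0 a0 h0); rewrite -/y; lra.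
Qed.

End outage_bounds.
End fading_tails.

(** * From exponential bounds to the logarithmic limit *)

Section diversity_limit.
Variable R : realType.

Lemma cvg_log_ratio (P : R -> R) (th t M : R) : 0 < t -> 0 < M ->
  (forall r, 0 < r -> r < M -> exists2 C, 0 < C & forall g, 0 < g ->
     P g <= C * expR (r * ((th - ln g) / t))) ->
  (forall eps, 0 < eps -> exists2 c, 0 < c & exists y0, forall g, 0 < g ->
     (th - ln g) / t <= y0 -> c * expR ((M + eps) * ((th - ln g) / t)) <= P g) ->
  log_ratio P g @[g --> +oo] --> - (M / t).
Proof.
move=> t0 M0 hU hL; apply/cvgrPdist_le => e e0.
(* Positive, below M, and within e t / 2 of it: half of the tolerance e goes to the rate, half to
   the constants. *)
pose r := Num.max (M / 2) (M - e * t / 2).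
have r0 : 0 < r by rewrite lt_max divr_gt0.
have et : 0 < e * t by rewrite mulr_gt0.
have rM : r < M by rewrite gt_max; apply/andP; split; lra.
have rE : M - e * t / 2 <= r by rewrite le_max lexx orbT.
have [C C0 hC] := hU r r0 rM.
have et2 : 0 < e * t / 2 by rewrite divr_gt0.
have [c c0 [y0 hc]] := hL _ et2.
pose eps := e * t / 2; pose D1 := ln C + r * (th / t).
pose D2 := ln c + (M + eps) * (th / t).
(* Beyond [G0]: ln g is positive, the lower bound is in force, and the additive constants [D1] and
   [D2] are at most e / 2 times ln g. *)
pose G0 := Num.max 1 (Num.max (th - t * y0) (2 / e * (`|D1| + `|D2|))).
exists (expR G0); split; first exact: num_real.
move=> g gG; have g0 : 0 < g by exact: lt_trans (expR_gt0 _) gG.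
have : G0 < ln g by rewrite -ltr_expR lnK.
rewrite !gt_max => /and3P[G1 G2 G3]; set G := ln g in G1 G2 G3 *.
have Gp : 0 < G by exact: lt_trans ltr01 G1.
have G4 : `|D1| + `|D2| <= e / 2 * G.
  move: G3; rewrite mulrAC ltr_pdivrMr// => /ltW; lra.
have hy : (th - G) / t <= y0 by rewrite ler_pdivrMr//; lra.
have U := hC g g0; have L := hc g g0 hy.
have P0 : 0 < P g by apply: lt_le_trans L; rewrite mulr_gt0 ?expR_gt0.
have lU : ln (P g) <= D1 - r / t * G.
  apply: (@le_trans _ _ (ln (C * expR (r * ((th - G) / t))))).
    by rewrite ler_ln ?posrE// mulr_gt0 ?expR_gt0.
  rewrite lnM ?posrE ?expR_gt0// expRK /D1 le_eqVlt; apply/orP; left; apply/eqP; ring.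
have lL : D2 - (M + eps) / t * G <= ln (P g).
  apply: (@le_trans _ _ (ln (c * expR ((M + eps) * ((th - G) / t))))); last first.
    by rewrite ler_ln ?posrE// mulr_gt0 ?expR_gt0.
  rewrite lnM ?posrE ?expR_gt0// expRK /D2 le_eqVlt; apply/orP; left; apply/eqP; ring.
have epst : eps / t = e / 2 by rewrite /eps; field; rewrite gt_eqF.
have rt : M / t - e / 2 <= r / t.
  by rewrite -epst -mulrBl ler_wpM2r ?invr_ge0 ?(ltW t0).
have D1n : D1 <= `|D1| by exact: ler_norm.
have D2n : - D2 <= `|D2| by rewrite -normrN ler_norm.
have n1 := normr_ge0 D1; have n2 := normr_ge0 D2.
have MG : (M / t - e / 2) * G <= r / t * G by rewrite ler_wpM2r ?(ltW Gp).
have mt : (M + eps) / t = M / t + e / 2 by rewrite mulrDl epst.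
rewrite mt in lL; rewrite /log_ratio -/G; set q := ln (P g) / G.
have qG : ln (P g) = q * G by rewrite /q divfK// gt_eqF.
rewrite qG in lU lL; move: (M / t) (r / t) lU lL MG => mt' rt' lU lL MG.
have q1 : q <= e - mt' by rewrite -(ler_pM2r Gp); lra.
have q2 : - mt' - e <= q by rewrite -(ler_pM2r Gp); lra.
by rewrite ler_norml; apply/andP; split; lra.
Qed.

End diversity_limit.

Section bigmin.
Variable R : realType.

(** The default element takes part in the minimum, which is therefore attained either there or at a
    member of the list; in the theorem it is the fog exponent. *)
Lemma bigmin_leP (I : eqType) (s : seq I) (F : I -> R) (x0 : R) :
  let V := \big[Num.min/x0]_(i <- s) F i in
  [/\ V <= x0, forall i, i \in s -> V <= F i &
       V = x0 \/ exists2 i, i \in s & V = F i].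
Proof.
elim: s => [|j s [IH1 IH2 IH3]]; first by rewrite big_nil; split=> //; left.
rewrite big_cons; set V := \big[_/_]_(_ <- s) _ in IH1 IH2 IH3 *.
split.
- by rewrite ge_min IH1 orbT.
- move=> i; rewrite inE => /orP[/eqP ->|/IH2 Vi]; first by rewrite ge_min lexx.
  by rewrite ge_min Vi orbT.
- have [jV|Vj] := leP (F j) V; first by right; exists j; rewrite ?mem_head.
  case: IH3 => [->|[i si ->]]; first by left.
  by right; exists i; rewrite // inE si orbT.
Qed.

End bigmin.

Theorem mainTheorem9 (R : realType) (d : measure_display)
    (T : measurableType d) (Pr : probability T R)
    (X : tp_params R) (v : R) (k t : nat) (gamma_th : R)
    (htp hf h : {RV Pr >-> R}) :
  tp_model X ->
  0 < v -> (0 < k)%N ->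
  t = 1%N \/ t = 2%N ->
  0 < gamma_th ->
  has_density htp (tp_pdf X) ->
  has_density hf (fog_pdf v k) ->
  independent_RV htp hf ->
  (forall w, h w = htp w * hf w) ->
  let Pout := outage Pr h t gamma_th in
  cvg (log_ratio Pout gamma0 @[gamma0 --> +oo]) /\
  diversity_order Pout =
    \big[Num.min/v / t%:R]_(1 <= l < (tp_P X).+1)
      \big[Num.min/v / t%:R]_(0 <= i < tp_m X)
        ((tp_phi X + (tp_b X l)`_i) / t%:R).
Proof.
move=> HM v0 k0 ht gth0 dtp df ind hE Pout.
have HX := tp_model_regular HM.
have t0 : (0 < t)%N by case: ht => ->.
have tR : 0 < t%:R :> R by rewrite ltr0n.
set V := \big[_/_]_(1 <= l < _) _.
have [V1 V2 V3] := bigmin_leP (index_iota 1 (tp_P X).+1)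
  (fun l => \big[Num.min/v / t%:R]_(0 <= i < tp_m X)
        ((tp_phi X + (tp_b X l)`_i) / t%:R)) (v / t%:R).
rewrite -/V in V1 V2 V3.
(* The rate in terms of ln h: the division by t is already contained in [outage_exponent]. *)
pose M := V * t%:R; have VE : V = M / t%:R by rewrite /M mulfK// gt_eqF.
have Mv : M <= v by rewrite /M -ler_pdivlMr.
have Me l i : (0 < l)%N -> (l < (tp_P X).+1)%N -> (i < tp_m X)%N -> M <= tp_exponent X l i.
  move=> l0 lP im; rewrite /M -ler_pdivlMr//.
  have := V2 l; rewrite mem_index_iota l0 lP => /(_ isT) Vl; apply: le_trans Vl _.
  have [_ Vi _] := bigmin_leP (index_iota 0 (tp_m X))
    (fun i => (tp_phi X + (tp_b X l)`_i) / t%:R) (v / t%:R).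
  by apply: Vi; rewrite mem_index_iota.
have Mcase : M = v \/ exists l i, [/\ (0 < l)%N, (l < (tp_P X).+1)%N, (i < tp_m X)%N &
    M = tp_exponent X l i].
  have Mt x : V = x / t%:R -> M = x by rewrite /M => ->; rewrite divfK// gt_eqF.
  case: V3 => [/Mt|[l]]; first by left.
  rewrite mem_index_iota => /andP[l0 lP] Vl.
  have [_ _] := bigmin_leP (index_iota 0 (tp_m X))
    (fun i => (tp_phi X + (tp_b X l)`_i) / t%:R) (v / t%:R).
  rewrite -Vl => -[/Mt|[j]]; first by left.
  rewrite mem_index_iota => /andP[_ jm] /Mt ME.
  by right; exists l, j; split.
have M0 : 0 < M.
  case: Mcase => [->//|[l [j [l0 _ jm ->]]]].
  exact: (reg_exponent HX l0 jm).
have lim : log_ratio Pout g @[g --> +oo] --> - V.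
  rewrite VE; apply: (@cvg_log_ratio _ _ (ln gamma_th)) => //.
  - move=> r r0 rM.
    have [K K0 hK] := outage_le HX v0 k0 t0 gth0 dtp df ind hE r0 (lt_le_trans rM Mv)
      (fun l i l0 lP im => lt_le_trans rM (Me l i l0 lP im)).
    exists (K + 1); first by rewrite ltr_wpDl.
    move=> g g0; apply: le_trans (hK g g0) _.
    by rewrite ler_wpM2r ?expR_ge0// lerDl.
  - move=> eps eps0; case: Mcase => [Mv'|[l [j [l0 lP jm ME]]]].
      have [c c0 [y0 hc]] := outage_ge_fog HX v0 k0 t0 gth0 dtp df ind hE.
      (* For a nonpositive outage exponent the additional eps only lowers the exponential. *)
      exists c => //; exists (Num.min y0 0) => g g0.
      rewrite le_min => /andP[gy g1]; apply: le_trans (hc g g0 gy).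
      rewrite ler_wpM2l ?(ltW c0)// ler_expR Mv' /outage_exponent.
      by rewrite mulrDl gerDl mulr_ge0_le0 ?(ltW eps0).
    have [c c0 [y0 hc]] := outage_ge_tp HX t0 gth0 dtp df ind hE l0 lP jm eps0.
    by exists c => //; exists y0 => g g0 gy; rewrite ME; exact: hc.
split; first by apply/cvg_ex; exists (- V).
by rewrite /diversity_order (cvg_lim (@Rhausdorff R) lim) opprK.
Qed.
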